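(* Let $k\in\mathbb{N}\cup\{\infty\}$ and let $\Omega,F,f,\mathcal{D},\mathcal{E}_k$ be as in the context. Then: (1) For every $Z_0\in\mathbf{X}$ one has $\mathrm{GMM}(\mathbf{Z},\mathcal{E}_k,\mathcal{D};Z_0)\neq\emptyset$. Moreover, for every $Z\in\mathrm{GMM}(\mathbf{Z},\mathcal{E}_k,\mathcal{D};Z_0)$, with $z(t)=\chi_{Z(t)}$, and for any sequence $(\overline{z}_{\tau_j})_j$ of characteristic functions of left-continuous piecewise constant interpolants of discrete solutions, with $\tau_j\downarrow 0$, for which property (G) of the context holds, one has, with $\underline{z}_{\tau_j}$ the characteristic functions of the corresponding right-continuous interpolants, $$\overline{z}_{\tau_j}(t),\ \underline{z}_{\tau_j}(t)\overset{*}{\rightharpoonup} z(t)\ \text{ in } \mathrm{SBV}(\Omega;\{0,1\})\ \text{ for almost all } t\in(0,T),$$ $$\overline{z}_{\tau_j},\ \underline{z}_{\tau_j}\overset{*}{\rightharpoonup} z\ \text{ in } L^\infty(0,T;\mathrm{SBV}(\Omega;\{0,1\})),$$ $$\overline{z}_{\tau_j},\ \underline{z}_{\tau_j}\to z\ \text{ in } L^q((0,T)\times\Omega)\ \text{ for every } q\in[1,\infty).$$ (2) If in addition $$\mathcal{E}_k(0,Z_0)\le \mathcal{E}_k(0,\widetilde Z)+\mathcal{D}(Z_0,\widetilde Z)\quad\text{for all }\widetilde Z\in\mathbf{X},$$ then every Generalized Minimizing Movement is also a Stable Minimizing Movement, i.e. $\mathrm{GMM}(\mathbf{Z},\mathc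al{E}_k,\mathcal{D};Z_0)=\mathrm{SMM}(\mathbf{Z},\mathcal{E}_k,\mathcal{D};Z_0)$.
   Context: Setting. $\Omega\subset\mathbb{R}^d$ is a bounded Lipschitz domain, $T>0$, $a>0$ a constant, $\mathcal{L}^d$ Lebesgue measure. $\mathbf{Z}$ is the family of Lebesgue measurable subsets of $\Omega$; $P(Z,\Omega)\in[0,\infty]$ is the perimeter of $Z$ in $\Omega$, i.e. the total variation $|\mathrm{D}\chi_Z|(\Omega)$; $\mathbf{X}=\{Z\in\mathbf{Z}: P(Z,\Omega)<\infty\}$. All statements about sets (inclusions, emptiness of intersections) are meant up to $\mathcal{L}^d$-null sets. A set $Z$ is identified with its characteristic function $z=\chi_Z$; $\mathrm{SBV}(\Omega;\{0,1\})$ denotes the set of characteristic functions of sets in $\mathbf{X}$, and weak$^*$ convergence in it is weak$^*$ convergence in $\mathrm{BV}(\Omega)$ (strong $L^1$ convergence together with weak$^*$ convergence of the distributional derivatives as measures). Loading. $F:[0,T]\rightrightarrows\Omega$ is a set-valued map such that: $F(t)$ is open for every $t\in[0,T]$; $F(s)\subset F(t)$ for all $0\le s\le t\le T$; and there is $f\in W^{1,1}(0,T;L^1(\Omega))$ such that for a.a. $t\in(0,T)$ one has $f(t,\cdot)\ge0$ a.e. in $\Omega$ and $F(t)=\{x\in\Omega: f(t,x)>0\}$. Dissipation. $\mathcal{D}(Z_1,Z_2)=a\,\mathcal{L}^d(Z_1\setminus Z_2)$ if $Z_2\subset Z_1$, and $\mathcal{D}(Z_1,Z_2)=\infty$ otherwise.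 Energies. For $k\in\mathbb{N}\cup\{\infty\}$, $\mathcal{E}_k(t,Z)=P(Z,\Omega)+\mathcal{J}_k(t,Z)$, where $\mathcal{J}_k(t,Z)=\int_\Omega k f(t)\chi_Z\,\mathrm{d}x$ for $k\in\mathbb{N}$, while $\mathcal{J}_\infty(t,Z)=0$ if $Z\cap F(t)=\emptyset$ and $\mathcal{J}_\infty(t,Z)=\infty$ otherwise. Discrete solutions. For a partition $\Pi_\tau=\{0=\mathsf{t}_\tau^0<\mathsf{t}_\tau^1<\dots<\mathsf{t}_\tau^{N_\tau}=T\}$ with step size $\tau=\max_i(\mathsf{t}_\tau^i-\mathsf{t}_\tau^{i-1})$, a discrete solution starting from $Z_0\in\mathbf{X}$ is a family $(Z_\tau^i)_{i=0}^{N_\tau}$ with $Z_\tau^0=Z_0$ and $Z_\tau^i\in\mathrm{Argmin}_{Z\in\mathbf{X}}\{\mathcal{E}_k(\mathsf{t}_\tau^i,Z)+\mathcal{D}(Z_\tau^{i-1},Z)\}$ for $i=1,\dots,N_\tau$. Its interpolants are: $\overline{Z}_\tau(t)=Z_\tau^i$ for $t\in(\mathsf{t}_\tau^{i-1},\mathsf{t}_\tau^i]$, $\overline{Z}_\tau(0)=Z_\tau^0$ (left-continuous), and $\underline{Z}_\tau(t)=Z_\tau^{i-1}$ for $t\in[\mathsf{t}_\tau^{i-1},\mathsf{t}_\tau^i)$, $\underline{Z}_\tau(T)=Z_\tau^{N_\tau}$ (right-continuous); $\overline{z}_\tau,\underline{z}_\tau$ are their characteristic functions. Generalized Minimizing Movements.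 $\mathrm{GMM}(\mathbf{Z},\mathcal{E}_k,\mathcal{D};Z_0)$ is the set of curves $Z:[0,T]\to\mathbf{X}$ with $Z(0)=Z_0$ for which there are a sequence $\tau_j\downarrow0$ and, for each $j\in\mathbb{N}$, a partition $\Pi_{\tau_j}$ of $[0,T]$ with step size $\tau_j$ and a discrete solution $(Z_{\tau_j}^i)_{i=0}^{N_{\tau_j}}$ on $\Pi_{\tau_j}$ starting from $Z_0$, with left-continuous interpolant $\overline{Z}_{\tau_j}$ and $\overline{z}_{\tau_j}=\chi_{\overline{Z}_{\tau_j}}$, such that property (G) holds: there is $C>0$ with $\mathcal{E}_k(t,\overline{Z}_{\tau_j}(t))\le C$ for all $j\in\mathbb{N}$ and $t\in[0,T]$, and $\overline{z}_{\tau_j}(t)\overset{*}{\rightharpoonup}\chi_{Z(t)}$ in $\mathrm{SBV}(\Omega;\{0,1\})$ as $j\to\infty$ for all $t\in[0,T]$. Stable Minimizing Movements. $\mathrm{SMM}(\mathbf{Z},\mathcal{E}_k,\mathcal{D};Z_0)$ is the set of $Z\in\mathrm{GMM}(\mathbf{Z},\mathcal{E}_k,\mathcal{D};Z_0)$ such that for all $t\in[0,T]$: $\mathcal{E}_k(t,Z(t))\le\mathcal{E}_k(t,\widetilde Z)+\mathcal{D}(Z(t),\widetilde Z)$ for all $\widetilde Z\in\mathbf{Z}$.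
   Formalization: In (1), GMM is shown nonempty when E_k(0,Z_0)<∞ (automatic for k∈ℕ). If k=∞ and Z_0 meets F(0) in positive measure, (G) fails at t=0 and GMM is empty; for every Z_0, existence is shown with the energy bound only for t∈(0,T]. *)

(* Defs.v *)
From HB Require Import structures.
From mathcomp Require Import all_boot all_order all_algebra.
From mathcomp Require Import all_classical all_reals all_analysis.

Set Implicit Arguments.
Unset Strict Implicit.
Unset Printing Implicit Defensive.
Import Order.TTheory GRing.Theory Num.Theory.
Import numFieldNormedType.Exports.

Local Open Scope classical_set_scope.
Local Open Scope ring_scope.

(* The ambient space is R^n with n = d.+1 >= 1, represented by row vectors. The
   library norm on row vectors is the maximum norm, hence the separate
   Euclidean norm [enorm]. *)

Section lebesgue.
Context (R : realType) (d : nat).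
Local Notation V := 'rV[R]_d.+1.

Definition box (a b : V) : set V :=
  [set x | forall i, a 0 i < x 0 i <= b 0 i].

Definition box_volume (a b : V) : \bar R :=
  (\prod_i Num.max 0 (b 0 i - a 0 i))%:E.

Definition box_cover (A : set V) : set ((V * V)^nat) :=
  [set ab | A `<=` \bigcup_n box (ab n).1 (ab n).2].

Definition leb_outer (A : set V) : \bar R :=
  ereal_inf [set (\sum_(n <oo) box_volume (ab n).1 (ab n).2)%E
            | ab in box_cover A].

Lemma box_volume_ge0 a b : (0 <= box_volume a b)%E.
Proof. by rewrite lee_fin; apply: prodr_ge0 => i _; rewrite le_max lexx. Qed.

Lemma leb_outer_ge0 A : (0 <= leb_outer A)%E.
Proof.
apply: le_ereal_inf_tmp => _ [ab _ <-].
by apply: nneseries_ge0 => n _ _; exact: box_volume_ge0.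
Qed.

Lemma leb_outer0 : leb_outer set0 = 0%E.
Proof.
apply/eqP; rewrite eq_le leb_outer_ge0 andbT.
apply: ereal_inf_lbound; exists (fun=> (0, 0)); first by [].
apply: eseries0 => n _ _ /=; rewrite /box_volume big_ord_recl.
by rewrite subrr maxxx mul0r.
Qed.

Lemma le_leb_outer : {homo leb_outer : A B / A `<=` B >-> (A <= B)%E}.
Proof.
move=> A B AB; apply: ereal_inf_le_tmp => _ [ab Bab <-].
by exists ab => //; exact: subset_trans AB Bab.
Qed.

Lemma leb_outer_sigma_subadditive : sigma_subadditive leb_outer.
Proof.
move=> A; have [[i ioo]|] := pselect (exists i, leb_outer (A i) = +oo%E).
  rewrite (eseries_pinfty _ _ ioo) ?leey// => n _.
  by rewrite -ltNye (lt_le_trans _ (leb_outer_ge0 _)).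
rewrite -forallNE => Aoo.
apply/lee_addgt0Pr => e e0.
rewrite (le_trans _ (epsilon_trick _ _ (ltW e0)))//; last first.
  by move=> n; exact: leb_outer_ge0.
pose vol (ab : V * V) := box_volume ab.1 ab.2.
pose P n (ab : (V * V)^nat) := box_cover (A n) ab /\
  (\sum_(k <oo) vol (ab k) <= leb_outer (A n) + (e / (2 ^ n.+1)%:R)%:E)%E.
have [G PG] : {G : ((V * V)^nat)^nat & forall n, P n (G n)}.
  apply: (@choice _ _ P) => n.
  have fA : leb_outer (A n) \is a fin_num.
    by rewrite ge0_fin_numE ?leb_outer_ge0// ltey; apply/eqP; exact: Aoo.
  have en : 0 < e / (2 ^ n.+1)%:R by rewrite divr_gt0// ltr0n expn_gt0.
  have [_ [ab Aab <-] lt] := lb_ereal_inf_adherent en fA.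
  by exists ab; split => //; exact: ltW.
have vG0 (x : nat * nat) : (0 <= (vol \o uncurry G) x)%E.
  exact: box_volume_ge0.
apply: (@le_trans _ _ (\esum_(i in setT) (vol \o uncurry G) i)%E).
  apply: ereal_inf_lbound => /=.
  have /card_esym/ppcard_eqP[f] := card_nat2.
  exists (uncurry G \o f).
    move=> t [i _ Ait]; have [j _ Gt] := (PG i).1 _ Ait.
    by exists (f^-1%FUN (i, j)) => //=; rewrite invK ?inE.
  rewrite -(esum_pred_image (vol \o uncurry G) _ xpredT) ?[fun=> _]set_true//.
  by rewrite image_eq.
rewrite (_ : esum _ _ = \sum_(i <oo) \sum_(j <oo ) vol (G i j))%E; last first.
  pose J : nat -> set (nat * nat) := fun i => [set (i, j) | j in setT].
  rewrite (_ : setT = \bigcup_k J k); last first.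
    by rewrite predeqE => -[a b]; split => // _; exists a => //; exists b.
  rewrite esum_bigcupT /=; last 2 first.
    - apply/trivIsetP => i j _ _ ij.
      rewrite predeqE => -[n m] /=; split => //= -[] [_] _ [<-{n} _].
      by move=> [m' _] [] /esym/eqP; rewrite (negbTE ij).
    - by move=> /= [n m]; exact: vG0.
  rewrite -(image_id [set: nat]) -fun_true esum_pred_image//; last first.
    by move=> n _; apply: esum_ge0 => m _; exact: vG0.
  apply: eq_eseriesr => /= j _.
  rewrite -(esum_pred_image (vol \o uncurry G) (pair j) predT)//=; last 2 first.
  - by move=> m _; exact: (vG0 (j, m)).
  - by move=> ? ? _ _; exact: (@can_inj _ _ _ snd).
  by congr esum; rewrite predeqE => -[a b]; split; move=> [i _ <-]; exists i.
apply: lee_lim.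
- apply: is_cvg_nneseries => n *.
  by apply: nneseries_ge0 => m *; exact: (vG0 (n, m)).
- apply: is_cvg_nneseries => n *; apply: adde_ge0; first exact: leb_outer_ge0.
  by rewrite lee_fin divr_ge0 ?ler0n ?(ltW e0).
- by near=> n; apply: lee_sum => i _; exact: (PG i).2.
Unshelve. all: by end_near. Qed.

HB.instance Definition _ := isOuterMeasure.Build R V leb_outer
  leb_outer0 leb_outer_ge0 le_leb_outer leb_outer_sigma_subadditive.

Definition lebesgue_outer : {outer_measure set V -> \bar R} := leb_outer.

(* R^n with the sigma-algebra of Lebesgue measurable sets *)
Local Notation lebT := (caratheodory_type lebesgue_outer).

(* n-dimensional Lebesgue measure; as a function it is defined on all sets *)
Definition leb : {measure set lebT -> \bar R} := lebesgue_outer.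

Definition null (A : set V) : Prop := leb A = 0%E.
Definition ae_subset (A B : set V) : Prop := null (A `\` B).
Definition ae_equal (A B : set V) : Prop := ae_subset A B /\ ae_subset B A.

End lebesgue.

Notation lebT R d := (caratheodory_type (lebesgue_outer R d)).

(* R^n with its Borel sigma-algebra *)
Notation borelT R d := (g_sigma_algebraType (@open 'rV[R]_d.+1)).

Arguments leb {R d}.

Section domain.
Context (R : realType) (d : nat).
Local Notation V := 'rV[R]_d.+1.

Definition enorm (x : V) : R := Num.sqrt (\sum_i x 0 i ^+ 2).

(* Near each boundary point, and after a rotation or reflection Q, the domain
   is the open epigraph of a Lipschitz function of the last d coordinates. *)
Definition lipschitz_boundary (Omega : set V) : Prop :=
  forall p, closure Omega p -> ~ Omega p ->
  exists (r : R) (Q : 'M[R]_d.+1) (gamma : 'rV[R]_d -> R),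
    [/\ 0 < r, Q *m Q^T = 1%:M, lipschitz gamma &
      forall x, enorm (x - p) < r ->
        let y := (x - p) *m Q in Omega x <-> gamma (col' ord0 y) < y 0 ord0].

Definition bounded_lipschitz_domain (Omega : set V) : Prop :=
  [/\ open Omega, connected Omega, Omega !=set0, bounded_set Omega &
      lipschitz_boundary Omega].

End domain.

Section finite_perimeter.
Context (R : realType) (d : nat) (Omega : set 'rV[R]_d.+1).
Local Notation V := 'rV[R]_d.+1.

Definition basis_vector (i : 'I_d.+1) : V := delta_mx 0 i.
Local Notation "'d_ i phi" := ('D_(basis_vector i) phi)
  (at level 10, i at level 2, phi at next level).

Definition C1c (phi : V -> R) : Prop :=
  [/\ forall i x, derivable phi x (basis_vector i),
      forall i, continuous ('d_i phi) &
      exists K, [/\ compact K, K `<=` Omega &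
                    forall x, ~ K x -> phi x = 0]].

(* C_0(Omega), the closure of C_c(Omega) in the supremum norm; for bounded
   Omega these are, after extension by 0, the continuous functions on R^n
   vanishing outside Omega. *)
Definition C0 (phi : V -> R) : Prop :=
  continuous phi /\ forall x, ~ Omega x -> phi x = 0.

Definition divergence (phi : V -> V) (x : V) : R :=
  \sum_i 'd_i (fun y => phi y 0 i) x.

(* the total variation |D chi_Z|(Omega) *)
Definition perimeter (Z : set V) : \bar R :=
  ereal_sup [set (\int[leb]_(x in Omega) (\1_Z x * divergence phi x)%:E)%E
            | phi in [set phi : V -> V |
                (forall i, C1c (fun x => phi x 0 i)) /\
                (forall x, enorm (phi x) <= 1)]].

Definition lebesgue_subset (Z : set V) : Prop :=
  measurable (Z : set (lebT R d)) /\ Z `<=` Omega.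

Definition finite_perimeter (Z : set V) : Prop :=
  lebesgue_subset Z /\ (perimeter Z < +oo)%E.

(* integral with respect to a signed measure; it does not depend on the chosen
   Hahn decomposition *)
Definition charge_integral (nu : {charge set (borelT R d) -> \bar R})
    (phi : V -> R) : R :=
  let hahn := projT2 (cid (projT2 (cid (Hahn_decomposition nu)))) in
  \int[jordan_pos hahn]_(x in Omega) phi x
  - \int[jordan_neg hahn]_(x in Omega) phi x.

(* nu is the i-th component D_i u of the distributional derivative of u. The
   measure nu lives on Borel subsets of R^n, but only its trace on Omega
   matters. *)
Definition distr_partial (i : 'I_d.+1) (u : V -> R)
    (nu : {charge set (borelT R d) -> \bar R}) : Prop :=
  forall phi, C1c phi ->
    \int[leb]_(x in Omega) (u x * 'd_i phi x) = - charge_integral nu phi.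

(* Weak* convergence in SBV(Omega; {0,1}). By the Riesz representation theorem
   each finite_perimeter set has derivatives D_i chi_Z in the sense of
   [distr_partial], and their trace on Omega is unique, so the quantification
   over nu_ and nu names the measures D_i chi_(Z_j) and D_i chi_Z. *)
Definition weakstar_SBV (Z_ : nat -> set V) (Z : set V) : Prop :=
  [/\ (forall j, finite_perimeter (Z_ j)) /\ finite_perimeter Z,
      (\int[leb]_(x in Omega) `|\1_(Z_ j) x - \1_Z x|%:E)%E @[j --> \oo]
        --> 0%E &
      forall i nu_ nu,
        (forall j, distr_partial i \1_(Z_ j) (nu_ j)) ->
        distr_partial i \1_Z nu ->
        forall phi, C0 phi ->
          charge_integral (nu_ j) phi @[j --> \oo] --> charge_integral nu phi].

End finite_perimeter.

Section space_time.
Context (R : realType) (d : nat) (Omega : set 'rV[R]_d.+1) (T : R).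
Local Notation V := 'rV[R]_d.+1.
Local Notation I := `]0, T[%classic.
Local Notation leb1 := (@lebesgue_measure R).
Local Notation lebQ := (leb1 \x @leb R d)%E.

Definition cylinder : set (measurableTypeR R * lebT R d) :=
  [set y | 0 < y.1 < T /\ Omega y.2].

(* L^1(0,T; C_0(Omega)): since C_0(Omega) is separable, Bochner measurability
   amounts to measurability of all point evaluations. *)
Definition L1_C0 (psi : R -> V -> R) : Prop :=
  [/\ forall t, I t -> C0 Omega (psi t),
      forall x, measurable_fun I (fun t => psi t x) &
      (\int[leb1]_(t in I) ereal_sup (range (fun x => `|psi t x|%:E))
        < +oo)%E].

Definition Linf_SBV (Z : R -> set V) : Prop :=
  [/\ exists C : R, \forall t \ae leb1, I t ->
        finite_perimeter Omega (Z t) /\ (perimeter Omega (Z t) <= C%:E)%E,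
      forall phi, C0 Omega phi ->
        measurable_fun I (fun t => \int[leb]_(x in Omega) (phi x * \1_(Z t) x))
    & forall i nu, (forall t, I t -> distr_partial Omega i \1_(Z t) (nu t)) ->
        forall phi, C0 Omega phi ->
        measurable_fun I (fun t => charge_integral Omega (nu t) phi)].

(* Weak* convergence in L^oo(0,T; SBV(Omega; {0,1})): u |-> (u, Du) embeds
   BV(Omega) into the dual of C_0(Omega)^(1+n), and the functions and their
   derivatives are tested with L^1(0,T; C_0(Omega)). *)
Definition weakstar_Linf_SBV (Z_ : nat -> R -> set V) (Z : R -> set V) : Prop :=
  [/\ (forall j, Linf_SBV (Z_ j)) /\ Linf_SBV Z,
      forall psi, L1_C0 psi ->
        \int[leb1]_(t in I)
          (\int[leb]_(x in Omega) (psi t x * \1_(Z_ j t) x)) @[j --> \oo]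
        --> \int[leb1]_(t in I)
          (\int[leb]_(x in Omega) (psi t x * \1_(Z t) x)) &
      forall i nu_ nu,
        (forall j t, I t -> distr_partial Omega i \1_(Z_ j t) (nu_ j t)) ->
        (forall t, I t -> distr_partial Omega i \1_(Z t) (nu t)) ->
        forall psi, L1_C0 psi ->
        \int[leb1]_(t in I) charge_integral Omega (nu_ j t) (psi t)
          @[j --> \oo]
        --> \int[leb1]_(t in I) charge_integral Omega (nu t) (psi t)].

(* A family (u t)_t of functions on Omega, each meaningful up to null sets
   only, is viewed as an element of L^q((0,T) x Omega) through a jointly
   measurable representative. *)
Definition Lq_representative (q : R) (u : R -> V -> R)
    (w : measurableTypeR R * lebT R d -> R) : Prop :=
  [/\ measurable_fun cylinder w,
      \forall t \ae leb1, I t -> \forall x \ae leb, Omega x -> w (t, x) = u t x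
    & (\int[lebQ]_(y in cylinder) (`|w y| `^ q)%:E < +oo)%E].

Definition Lq_cvg (q : R) (u_ : nat -> R -> V -> R) (u : R -> V -> R) : Prop :=
  exists (w_ : nat -> measurableTypeR R * lebT R d -> R)
      (w : measurableTypeR R * lebT R d -> R),
    [/\ forall j, Lq_representative q (u_ j) (w_ j), Lq_representative q u w &
      ((\int[lebQ]_(y in cylinder) (`|w_ j y - w y| `^ q)%:E) `^ q^-1)%E
        @[j --> \oo] --> 0%E].

Definition smooth_compact_support (theta : R -> R) : Prop :=
  (forall n t, derivable (derive1n n theta) t 1) /\
  exists a b, [/\ 0 < a, b < T & forall t, ~ (a <= t <= b) -> theta t = 0].

(* f in W^{1,1}(0,T; L^1(Omega)), f being the representative that is
   continuous from [0,T] to L^1(Omega). The identity of L^1(Omega)-valued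
   Bochner integrals expressing that g is the weak time derivative is written
   by integrating it over arbitrary measurable subsets of Omega. *)
Definition W11_L1 (f : R -> V -> R) : Prop :=
  [/\ forall t, 0 <= t <= T -> leb.-integrable Omega (EFin \o f t),
      forall t, 0 <= t <= T ->
        (\int[leb]_(x in Omega) `|f s x - f t x|%:E)%E
          @[s --> within `[0, T]%classic (nbhs t)] --> 0%E &
      exists g : measurableTypeR R * lebT R d -> R,
        lebQ.-integrable cylinder (EFin \o g) /\
        forall theta A, smooth_compact_support theta -> lebesgue_subset Omega A ->
          \int[leb1]_(t in I) (derive1 theta t * \int[leb]_(x in A) f t x) =
          - \int[leb1]_(t in I) (theta t * \int[leb]_(x in A) g (t, x))].

End space_time.

Section minimizing_movements.
Context (R : realType) (d : nat) (Omega : set 'rV[R]_d.+1) (T a : R).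
Local Notation V := 'rV[R]_d.+1.
Context (F : R -> set V) (f : R -> V -> R).

Definition loading : Prop :=
  [/\ forall t, 0 <= t <= T -> open (F t) /\ F t `<=` Omega,
      forall s t, 0 <= s -> s <= t -> t <= T -> ae_subset (F s) (F t),
      W11_L1 Omega T f &
      \forall t \ae (@lebesgue_measure R), 0 < t < T ->
        (\forall x \ae leb, Omega x -> 0 <= f t x) /\
        ae_equal (F t) [set x | Omega x /\ 0 < f t x]].

Definition dissipation (Z1 Z2 : set V) : \bar R :=
  if `[< ae_subset Z2 Z1 >] then (a%:E * leb (Z1 `\` Z2))%E else +oo%E.

(* k : option nat stands for an element of N u {oo}, with None for oo *)
Definition load_energy (k : option nat) (t : R) (Z : set V) : \bar R :=
  match k with
  | Some m => (\int[leb]_(x in Omega) (m%:R * f t x * \1_Z x)%:E)%E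
  | None => if `[< null (Z `&` F t) >] then 0%E else +oo%E
  end.

Definition energy (k : option nat) (t : R) (Z : set V) : \bar R :=
  (perimeter Omega Z + load_energy k t Z)%E.

(* points t^0, ..., t^N of a partition, and sets Z^0, ..., Z^N; the values at
   larger indices are irrelevant *)
Record discrete_curve := DiscreteCurve {
  nb_steps : nat;
  node : nat -> R;
  state : nat -> set V }.

Definition is_partition (D : discrete_curve) : Prop :=
  [/\ node D 0 = 0, node D (nb_steps D) = T &
      forall i, (i < nb_steps D)%N -> node D i < node D i.+1].

Definition step_size (D : discrete_curve) : R :=
  \big[Num.max/0]_(i < nb_steps D) (node D i.+1 - node D i).

Definition discrete_solution (k : option nat) (Z0 : set V)
    (D : discrete_curve) : Prop :=
  [/\ is_partition D,
      finite_perimeter Omega (state D 0), ae_equal (state D 0) Z0 &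
      forall i, (i < nb_steps D)%N ->
        finite_perimeter Omega (state D i.+1) /\
        forall Z, finite_perimeter Omega Z ->
          (energy k (node D i.+1) (state D i.+1)
             + dissipation (state D i) (state D i.+1)
           <= energy k (node D i.+1) Z + dissipation (state D i) Z)%E].

Definition left_interpolant (D : discrete_curve) (t : R) : set V :=
  [set x | (t = 0 /\ state D 0 x) \/
    exists i, [/\ (i < nb_steps D)%N, node D i < t <= node D i.+1 &
                  state D i.+1 x]].

Definition right_interpolant (D : discrete_curve) (t : R) : set V :=
  [set x | (t = T /\ state D (nb_steps D) x) \/
    exists i, [/\ (i < nb_steps D)%N, node D i <= t < node D i.+1 &
                  state D i x]].

Definition discrete_sequence (k : option nat) (Z0 : set V)
    (D_ : nat -> discrete_curve) : Prop :=
  [/\ forall j, discrete_solution k Z0 (D_ j),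
      nonincreasing_seq (step_size \o D_) &
      step_size (D_ j) @[j --> \oo] --> 0].

Definition energy_bound (J : set R) (k : option nat)
    (D_ : nat -> discrete_curve) : Prop :=
  exists2 C : R, 0 < C & forall j t, J t ->
    (energy k t (left_interpolant (D_ j) t) <= C%:E)%E.

Definition pointwise_cvg (D_ : nat -> discrete_curve) (Z : R -> set V) : Prop :=
  forall t, 0 <= t <= T ->
    weakstar_SBV Omega (fun j => left_interpolant (D_ j) t) (Z t).

(* The energy bound in property (G) is required at the times t in J, and
   generalized minimizing movements take J = [0,T]. For k = oo and Z0 meeting
   F(0) in positive measure the energy at time 0 is infinite and no sequence
   satisfies the bound there; J = ]0,T] covers this case. *)
Definition property_G (J : set R) (k : option nat)
    (D_ : nat -> discrete_curve) (Z : R -> set V) : Prop :=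
  energy_bound J k D_ /\ pointwise_cvg D_ Z.

Definition GMM_on (J : set R) (k : option nat) (Z0 : set V) :
    set (R -> set V) :=
  [set Z | [/\ forall t, 0 <= t <= T -> finite_perimeter Omega (Z t),
               ae_equal (Z 0) Z0 &
               exists D_, discrete_sequence k Z0 D_ /\ property_G J k D_ Z]].

Definition GMM := GMM_on `[0, T]%classic.

Definition stable (k : option nat) (t : R) (Z : set V) : Prop :=
  forall Z', lebesgue_subset Omega Z' ->
    (energy k t Z <= energy k t Z' + dissipation Z Z')%E.

Definition SMM (k : option nat) (Z0 : set V) : set (R -> set V) :=
  [set Z | GMM k Z0 Z /\ forall t, 0 <= t <= T -> stable k t (Z t)].

End minimizing_movements.

(* Main.v *)
(* Every incremental minimizer is compared with the empty set, which bounds its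
   energy by a|Omega|; the dissipation makes t |-> Z(t) decrease. Existence is a
   Helly argument: sets of bounded perimeter are compact in L1, which gives
   convergence at rational times; monotonicity extends it to all continuity points
   of the limit volume, and compactness handles the countably many others.

   Compactness rests on one estimate: averaging chi_Z with a kernel of radius h
   changes it in L1 by at most n h P(Z), n the dimension, away from the boundary.
   Since Omega has finite measure, the boundary layer is negligible and the
   regularity of the boundary plays no role. The averages also yield
   submodularity of the perimeter by interpolating between two test fields.

   Discrete minimizers are stable by the triangle inequality for the dissipation.
   To pass to the limit Z(t), a competitor Z' is replaced by its intersection with
   the discrete set; submodularity then leaves only lower semicontinuous terms.

   For right interpolants, and for convergence in L^q and in the weak* sense in
   time, one uses that the monotone function t |-> |Z(t)| has at most countably
   many discontinuities, together with dominated convergence. *)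
From HB Require Import structures.
Require Import Defs.
From mathcomp Require Import all_boot all_order all_algebra.
From mathcomp Require Import all_classical all_reals all_analysis.
From mathcomp Require Import measurable_realfun ring lra.
Import Order.TTheory GRing.Theory Num.Theory.
Import numFieldNormedType.Exports.
Set Implicit Arguments.
Unset Strict Implicit.
Unset Printing Implicit Defensive.
Local Open Scope classical_set_scope.
Local Open Scope ring_scope.

(** * Lebesgue measure on row vectors *)

(** Two obstacles shape the estimates. First, the averaging kernel is a product of one-dimensional
    hats, normalized by its own integral, so that no exact volume has to be computed; should that
    integral vanish, the whole space is null and every integral over [Omega] is 0. Second, in the
    limit of minimality or stability inequalities both perimeter and load are merely lower
    semicontinuous, and for [k = None] the load may be infinite. The limit is therefore taken with
    one test field fixed: the integral of its divergence converges under L1 convergence, the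
    inequality for the load alone passes to the limit, and the supremum over the fields is formed
    afterwards. Weak* convergence is tested with C_0, whereas the perimeter controls C1 test
    functions; the gap is closed by quasi-interpolation on grids, and the same finite sums give
    measurability in time of functionals applied to time-dependent test functions. *)

Section row_norm.
Context (R : realType) (d : nat).
Local Notation V := 'rV[R]_d.+1.

Lemma norm_coord_le (x : V) i : `|x 0 i| <= `|x|.
Proof.
rewrite [leRHS]mx_normrE.
exact: (le_bigmax _ (fun ij : 'I_1 * 'I_d.+1 => `|x ij.1 ij.2|) (0, i)).
Qed.

Lemma row_norm_leP (x : V) (e : R) :
  0 <= e -> reflect (forall i, `|x 0 i| <= e) (`|x| <= e).
Proof.
move=> e0; apply: (iffP idP) => [xe i|xe].
  exact: le_trans (norm_coord_le x i) xe.
rewrite [leLHS]mx_normrE; apply/bigmax_leP; split=> //= -[i j] _.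
by rewrite (ord1 i).
Qed.

Lemma row_norm_ltP (x : V) (e : R) :
  0 < e -> reflect (forall i, `|x 0 i| < e) (`|x| < e).
Proof.
move=> e0; apply: (iffP idP) => [xe i|xe].
  exact: le_lt_trans (norm_coord_le x i) xe.
rewrite [ltLHS]mx_normrE; apply/bigmax_ltP; split=> //= -[i j] _.
by rewrite (ord1 i).
Qed.

End row_norm.

Section lebesgue_measurable_sets.
Context (R : realType) (d : nat).
Local Notation V := 'rV[R]_d.+1.
Local Notation lebV := (lebT R d).

Definition set_coord (i : 'I_d.+1) (r : R) (x : V) : V :=
  \row_j (if j == i then r else x 0 j).

(** Clamping the endpoints with min and max also covers a plane that misses the box: one piece is
    then the whole box, and the side of the other is truncated to 0 by [box_volume]. *)
Lemma box_volume_split i c (a b : V) :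
  (box_volume a (set_coord i (Num.min (b 0%R i) c) b) +
   box_volume (set_coord i (Num.max (a 0%R i) c) a) b = box_volume a b)%E.
Proof.
rewrite /box_volume -EFinD; congr EFin.
rewrite (bigD1 i)//= [X in _ + X](bigD1 i)//= [RHS](bigD1 i)//= !mxE !eqxx.
rewrite [X in _ * X + _](eq_bigr (fun j => Num.max 0 (b 0 j - a 0 j))); last first.
  by move=> j /negbTE ji; rewrite !mxE ji.
rewrite [X in _ + _ * X](eq_bigr (fun j => Num.max 0 (b 0 j - a 0 j))); last first.
  by move=> j /negbTE ji; rewrite !mxE ji.
rewrite -mulrDl; congr (_ * _).
rewrite /Num.max /Num.min; do ! case: ifPn; rewrite -?leNgt; lra.
Qed.

(** Cutting every box of a cover of [X] at the plane yields covers of the two parts of [X] with the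
    same total volume, which is the nontrivial inequality in Caratheodory's criterion. *)
Lemma lower_halfspace_measurable i c :
  measurable ([set x | x 0 i <= c] : set lebV).
Proof.
apply: le_caratheodory_measurable => X.
apply: le_ereal_inf_tmp => _ [ab Xab <-].
pose ab1 n := ((ab n).1, set_coord i (Num.min ((ab n).2 0 i) c) (ab n).2).
pose ab2 n := (set_coord i (Num.max ((ab n).1 0 i) c) (ab n).1, (ab n).2).
apply: (@le_trans _ _ (\sum_(n <oo) box_volume (ab1 n).1 (ab1 n).2 +
                       \sum_(n <oo) box_volume (ab2 n).1 (ab2 n).2)%E).
  apply: leeD; apply: ereal_inf_lbound => /=.
    exists ab1 => // x [Xx /= xc]; have [n _ bx] := Xab _ Xx.
    exists n => //= j; have /andP[ax xb] := bx j.
    rewrite !mxE; case: eqP => [->|_]; last by rewrite ax xb.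
    by rewrite le_min xc andbT; exact: bx.
  exists ab2 => // x [Xx /= /negP]; rewrite -ltNge => xc.
  have [n _ bx] := Xab _ Xx.
  exists n => //= j; have /andP[ax xb] := bx j.
  rewrite !mxE; case: eqP => [->|_]; last by rewrite ax xb.
  by rewrite gt_max xc andbT; exact: bx.
rewrite -nneseriesD; try by move=> n _ _; exact: box_volume_ge0.
apply: lee_nneseries => n *; first by rewrite adde_ge0// box_volume_ge0.
by rewrite /= box_volume_split.
Qed.

Lemma measurable_coord (i : 'I_d.+1) :
  measurable_fun [set: lebV] (fun x : V => x 0 i).
Proof.
apply: (measurability _ (RGenOInfty.measurableE R)).
move=> _ [_ [c ->] <-]; rewrite setTI.
have -> : (fun x : V => x 0 i) @^-1` `]c, +oo[ = ~` [set x | x 0 i <= c].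
  by apply/seteqP; split=> x /=; rewrite in_itv/= andbT ltNge => /negP.
apply: measurableC; exact: lower_halfspace_measurable.
Qed.

Lemma box_measurable a b : measurable (box a b : set lebV).
Proof.
have -> : box a b = \bigcap_(i in [set: 'I_d.+1])
    ((fun x : V => x 0 i) @^-1` [set` `]a 0 i, b 0 i]]).
  by apply/seteqP; split=> x bx i; [move=> _|];
    have := bx i; rewrite /= in_itv/=; [|apply].
apply: fin_bigcap_measurable => [|i _]; first exact: finite_finset.
by rewrite -[X in measurable X]setTI; exact: measurable_coord.
Qed.

(** Besides a countable base, this supplies rational points near [x]: boxes contain their upper
    corner, so [q] itself lies within [e] of [x]. *)
Lemma box_rat_nbhs (x : V) (e : R) : 0 < e ->
  exists p q : 'rV[rat]_d.+1,
    box (map_mx ratr p) (map_mx ratr q) x /\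
    forall y, box (map_mx ratr p) (map_mx ratr q) y -> `|y - x| < e.
Proof.
move=> e0.
have rats (i : 'I_d.+1) : {pq : rat * rat |
    [/\ ratr pq.1 < x 0 i, x 0 i - e < ratr pq.1, x 0 i <= ratr pq.2 &
        ratr pq.2 < x 0 i + e]}.
  have xe : x 0 i - e < x 0 i by rewrite ltrBlDr ltrDl.
  have ex : x 0 i < x 0 i + e by rewrite ltrDl.
  apply: cid.
  have [p] := rat_in_itvoo xe; rewrite in_itv/= => /andP[? ?].
  have [q] := rat_in_itvoo ex; rewrite in_itv/= => /andP[? ?].
  by exists (p, q); split => //; exact: ltW.
exists (\row_i (projT1 (rats i)).1), (\row_i (projT1 (rats i)).2).
split=> [i|y by_].
  by rewrite !mxE; case: (projT2 (rats i)) => -> _ -> _.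
apply/row_norm_ltP => // i; rewrite !mxE ltr_norml.
have := by_ i; rewrite !mxE.
case: (projT2 (rats i)) => h1 h2 h3 h4 /andP[h5 h6]; apply/andP; split; lra.
Qed.

Lemma lebesgue_open_measurable (U : set V) :
  open U -> measurable (U : set lebV).
Proof.
move=> oU.
pose F (pq : 'rV[rat]_d.+1 * 'rV[rat]_d.+1) : set V :=
  if `[< box (map_mx ratr pq.1) (map_mx ratr pq.2) `<=` U >]
  then box (map_mx ratr pq.1) (map_mx ratr pq.2) else set0.
have -> : U = \bigcup_pq F pq.
  apply/seteqP; split=> x.
    move=> Ux; have /nbhs_normP[e /= e0 eU] := open_nbhs_nbhs (conj oU Ux).
    have [p [q [bx byx]]] := box_rat_nbhs x e0.
    exists (p, q) => //; rewrite /F; case: asboolP => //= -[] y /byx yx.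
    by apply: eU; rewrite /= distrC.
  by move=> [pq _]; rewrite /F; case: asboolP => // sub /sub.
apply: countable_bigcupT_measurable; first exact: countableP.
by move=> pq; rewrite /F; case: ifP => _; [exact: box_measurable|exact: measurable0].
Qed.

Lemma continuous_lebesgue_measurable (f : V -> R) :
  continuous f -> measurable_fun [set: lebV] f.
Proof.
move=> cf; apply: (measurability _ (RGenOpens.measurableE R)).
move=> _ [U [a [b ->]] <-]; rewrite setTI; apply: lebesgue_open_measurable.
by apply: open_comp => // x _; exact: cf.
Qed.

Lemma leb_box_le (a b : V) : (leb (box a b) <= box_volume a b)%E.
Proof.
apply: ereal_inf_lbound => /=.
exists (fun n => if n == 0 then (a, b) else (0, 0)).
  by move=> x bx; exists 0.
rewrite (nneseries_split 0 1); last by move=> *; exact: box_volume_ge0.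
rewrite big_nat1/= [X in (_ + X)%E]eseries0 ?adde0// => n n1 _.
by rewrite gtn_eqF//= /box_volume big_ord_recl subrr maxxx mul0r.
Qed.

Lemma leb_bounded_lty (A : set V) : bounded_set A -> (leb A < +oo)%E.
Proof.
move=> [M [Mr AM]].
have [N N0 AN] : exists2 N : R, 0 < N & forall x, A x -> `|x| <= N.
  exists (Num.max 0 M + 1).
    by rewrite ltr_wpDl// le_max lexx.
  by move=> x Ax; apply: AM => //; rewrite ltr_pwDr// le_max lexx orbT.
(* The lower corner is [- N - 1] because boxes exclude their lower faces. *)
apply: (@le_lt_trans _ _ (leb (box (const_mx (- N - 1)) (const_mx N) : set V))).
  apply: le_leb_outer => x Ax i; rewrite !mxE.
  have := le_trans (norm_coord_le x i) (AN _ Ax).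
  by rewrite ler_norml => /andP[h1 h2]; rewrite h2 andbT; lra.
by apply: le_lt_trans (leb_box_le _ _) _; rewrite ltry.
Qed.

Lemma leb_sigma_finite : sigma_finite [set: lebV] (@leb R d).
Proof.
exists (fun n => box (const_mx (- n%:R)) (const_mx n%:R)).
  apply/esym; rewrite -subTset => x _.
  have [n xn] : exists n : nat, `|x| < n%:R.
    by exists (Num.truncn `|x|).+1; rewrite truncnS_gt.
  exists n => // i; rewrite !mxE; apply/andP.
  have := le_lt_trans (norm_coord_le x i) xn.
  by rewrite ltr_norml => /andP[? /ltW].
move=> n; split; first exact: box_measurable.
by apply: le_lt_trans (leb_box_le _ _) _; rewrite ltry.
Qed.

(** The measure [leb] packaged with its sigma-finiteness, the form in which Fubini and Tonelli
    accept it. *)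
Definition lebs : {sigma_finite_measure set lebV -> \bar R} :=
  HB.pack_for {sigma_finite_measure set lebV -> \bar R}
    (leb : set lebV -> \bar R) (Measure.class (@leb R d))
    (Measure_isSigmaFinite.Build _ lebV R (@leb R d) leb_sigma_finite).

End lebesgue_measurable_sets.

(** * Translation invariance of Lebesgue measure *)

Section translation.
Context (R : realType) (d : nat).
Local Notation V := 'rV[R]_d.+1.
Local Notation lebV := (lebT R d).

Definition translate (z x : V) : V := x + z.

Lemma leb_outer_translate z (A : set V) :
  leb_outer (translate z @^-1` A) = leb_outer A.
Proof.
have le_tr w (B : set V) : (leb_outer (translate w @^-1` B) <= leb_outer B)%E.
  apply: le_ereal_inf_tmp => _ [ab Bab <-].
  apply: ereal_inf_lbound; exists (fun n => ((ab n).1 - w, (ab n).2 - w)).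
    move=> x /= /Bab[n _ bx]; exists n => //= i; have := bx i.
    by rewrite !mxE lerBrDr ltrBlDr.
  apply: eq_eseriesr => n _; rewrite /box_volume; congr EFin.
  by apply: eq_bigr => i _ /=; rewrite !mxE opprB addrA subrK.
apply/eqP; rewrite eq_le le_tr/=.
rewrite -[X in (leb_outer X <= _)%E](_ : translate (- z) @^-1` (translate z @^-1` A) = _).
  exact: le_tr.
by apply/seteqP; split=> x; rewrite /translate/= subrK.
Qed.

Lemma measurable_translate z : measurable_fun [set: lebV] (translate z : lebV -> lebV).
Proof.
move=> _ A mA; rewrite setTI; apply: le_caratheodory_measurable => X.
(* Moving the test set [X] as well makes every set in sight a preimage under the same translation,
   so that the criterion for [A] applies. *)
have XE : X = translate z @^-1` (translate (- z) @^-1` X).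
  by apply/seteqP; split=> x; rewrite /translate/= addrK.
rewrite XE preimage_setC -!preimage_setI /= !leb_outer_translate.
rewrite -(mA (translate (- z) @^-1` X)). 
have -> : lebesgue_outer R d (translate (- z) @^-1` X) = leb_outer X.
  exact: leb_outer_translate.
exact: lexx.
Qed.

Lemma leb_translate z (A : set V) : leb (translate z @^-1` A) = leb A.
Proof. exact: leb_outer_translate. Qed.

Lemma ge0_integral_translate z (f : V -> \bar R) :
  measurable_fun [set: lebV] f -> (forall x, 0 <= f x)%E ->
  (\int[leb]_x f (translate z x) = \int[leb]_x f x)%E.
Proof.
move=> mf f0.
rewrite -[LHS](@ge0_integral_pushforward _ _ _ _ R _ (measurable_translate z)
  leb setT)//.
by apply: eq_measure_integral => [|mtr A mA _]; [exact: measurable_translate|exact: leb_translate].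
Qed.

Lemma integrable_translate z (f : V -> R) :
  leb.-integrable [set: lebV] (EFin \o f) ->
  leb.-integrable [set: lebV] (EFin \o (f \o translate z)).
Proof.
move=> /integrableP[mf foo].
have mfz : measurable_fun [set: lebV] ((EFin \o f) \o translate z).
  exact: (@measurableT_comp _ _ _ lebV lebV _ (EFin \o f) _ (translate z) mf
    (@measurable_translate z)).
apply/integrableP; split => //.
rewrite (@ge0_integral_translate z (fun x => `|(f x)%:E|%E))//.
exact: measurableT_comp.
Qed.

Lemma Rintegral_translate z (f : V -> R) :
  leb.-integrable [set: lebV] (EFin \o f) ->
  \int[leb]_x f (translate z x) = \int[leb]_x f x.
Proof.
move=> fi; rewrite /Rintegral; congr fine.
have mf := measurable_int _ fi.
rewrite -[LHS](@integral_pushforward _ _ lebV lebV R _ (measurable_translate z)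
  leb setT (EFin \o f) mf (integrable_translate z fi))//.
by apply: eq_measure_integral => [|mtr A mA _]; [exact: measurable_translate|exact: leb_translate].
Qed.

(* Countably many translates of a ball cover the space, so that nonnegative
   kernels have positive mass without computing any volume. *)
Lemma leb_null_ball (e : R) : 0 < e ->
  leb [set x : V | `|x| < e] = 0%E -> leb [set: V] = 0%E.
Proof.
move=> e0 B0.
pose B (q : 'rV[rat]_d.+1) : set V :=
  translate (- map_mx ratr q) @^-1` [set x : V | `|x| < e].
have BT : [set: V] `<=` \bigcup_q B q.
  move=> x _; have [p [q [bx byx]]] := box_rat_nbhs x e0.
  exists q => //; rewrite /B /= /translate.
  rewrite -normrN opprB; apply: byx => i; have := bx i.
  by rewrite lexx andbT => /andP[]; exact: lt_le_trans.
have BT' : [set: V] `<=` \bigcup_n (oapp B set0 (unpickle n)).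
  by move=> x /BT[q _ Bq]; exists (pickle q) => //; rewrite pickleK.
apply/eqP; rewrite eq_le measure_ge0 andbT.
apply: le_trans (le_leb_outer BT') _.
apply: le_trans (outer_measure_sigma_subadditive (lebesgue_outer R d) _) _.
rewrite eseries0// => n _ _; case: unpickle => [q|] /=; last exact: leb_outer0.
by rewrite leb_outer_translate.
Qed.

End translation.

(** * Integral calculus for bounded measurable functions *)

Section bounded_measurable.
Context dd (T : measurableType dd) (R : realType).
Implicit Types f g : T -> R.

(** These functions form an algebra and are integrable over every measurable set of finite measure,
    so integrability conditions become closure lemmas. Both requirements are global, so that one
    witness serves all domains of integration. *)
Definition bounded_measurable (f : T -> R) :=
  measurable_fun [set: T] f /\ exists M, forall x, `|f x| <= M.

Lemma bm_cst c : bounded_measurable (fun=> c).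
Proof. by split => //; exists `|c|. Qed.

Lemma bmD f g : bounded_measurable f -> bounded_measurable g ->
  bounded_measurable (fun x => f x + g x).
Proof.
move=> [mf [M fM]] [mg [N gN]]; split; first exact: measurable_funD.
by exists (M + N) => x; apply: le_trans (ler_normD _ _) _; exact: lerD.
Qed.

Lemma bmM f g : bounded_measurable f -> bounded_measurable g ->
  bounded_measurable (fun x => f x * g x).
Proof.
move=> [mf [M fM]] [mg [N gN]]; split; first exact: measurable_funM.
by exists (M * N) => x; rewrite normrM ler_pM.
Qed.

Lemma bmN f : bounded_measurable f -> bounded_measurable (fun x => - f x).
Proof.
move=> [mf [M fM]]; split; first exact: measurable_funN.
by exists M => x; rewrite normrN.
Qed.

Lemma bmB f g : bounded_measurable f -> bounded_measurable g ->
  bounded_measurable (fun x => f x - g x).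
Proof. by move=> bf bg; apply: bmD => //; exact: bmN. Qed.

Lemma bm_norm f : bounded_measurable f -> bounded_measurable (fun x => `|f x|).
Proof.
move=> [mf [M fM]]; split; first exact: measurableT_comp.
by exists M => x; rewrite normr_id.
Qed.

Lemma bm_indic A : measurable A -> bounded_measurable (\1_A : T -> R).
Proof.
move=> mA; split; first exact: measurable_indic.
by exists 1 => x; rewrite indicE; case: (x \in A); rewrite ?normr1 ?normr0.
Qed.

Lemma bm_sum (I : Type) (r : seq I) (P : pred I) (F : I -> T -> R) :
  (forall i, P i -> bounded_measurable (F i)) ->
  bounded_measurable (fun x => \sum_(i <- r | P i) F i x).
Proof.
move=> bF; elim: r => [|i r IH].
  by under eq_fun do rewrite big_nil; exact: bm_cst.
under eq_fun do rewrite big_cons.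
by case Pi: (P i) => //; apply: bmD => //; exact: bF.
Qed.

Context (mu : {measure set T -> \bar R}) (D : set T) (mD : measurable D)
  (muD : (mu D < +oo)%E).

Lemma bm_integrable f : bounded_measurable f -> mu.-integrable D (EFin \o f).
Proof.
move=> [mf [M fM]]; apply: measurable_bounded_integrable => //.
  exact: measurable_funTS.
exists M; split; first exact: num_real.
by move=> x Mx y _; exact: le_trans (fM y) (ltW Mx).
Qed.

Lemma bm_RintegralD f g : bounded_measurable f -> bounded_measurable g ->
  \int[mu]_(x in D) (f x + g x) =
  \int[mu]_(x in D) f x + \int[mu]_(x in D) g x.
Proof. by move=> bf bg; rewrite RintegralD//; exact: bm_integrable. Qed.

Lemma bm_RintegralB f g : bounded_measurable f -> bounded_measurable g ->
  \int[mu]_(x in D) (f x - g x) =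
  \int[mu]_(x in D) f x - \int[mu]_(x in D) g x.
Proof. by move=> bf bg; rewrite RintegralB//; exact: bm_integrable. Qed.

Lemma bm_RintegralZ c f : bounded_measurable f ->
  \int[mu]_(x in D) (c * f x) = c * \int[mu]_(x in D) f x.
Proof. by move=> bf; rewrite RintegralZl//; exact: bm_integrable. Qed.

Lemma bm_RintegralN f : bounded_measurable f ->
  \int[mu]_(x in D) - f x = - \int[mu]_(x in D) f x.
Proof.
move=> bf; rewrite -mulN1r -bm_RintegralZ//.
by apply: eq_Rintegral => x _; rewrite mulN1r.
Qed.

Lemma bm_Rintegral_sum (I : Type) (r : seq I) (P : pred I) (F : I -> T -> R) :
  (forall i, P i -> bounded_measurable (F i)) ->
  \int[mu]_(x in D) (\sum_(i <- r | P i) F i x) =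
  \sum_(i <- r | P i) \int[mu]_(x in D) F i x.
Proof.
move=> bF; elim: r => [|i r IH].
  rewrite big_nil -[RHS](mul0r (\int[mu]_(x in D) (cst 1 x))).
  rewrite -bm_RintegralZ; last exact: bm_cst.
  by apply: eq_Rintegral => x _; rewrite big_nil mul0r.
rewrite big_cons -IH; case: ifP => Pi; last first.
  by apply: eq_Rintegral => x _; rewrite big_cons Pi.
rewrite -bm_RintegralD; [|exact: bF|exact: bm_sum].
by apply: eq_Rintegral => x _; rewrite big_cons Pi.
Qed.

Lemma bm_le_Rintegral f g : bounded_measurable f -> bounded_measurable g ->
  (forall x, D x -> f x <= g x) ->
  \int[mu]_(x in D) f x <= \int[mu]_(x in D) g x.
Proof. by move=> bf bg; apply: le_Rintegral => //; exact: bm_integrable. Qed.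

Lemma bm_le_normr_Rintegral f : bounded_measurable f ->
  `|\int[mu]_(x in D) f x| <= \int[mu]_(x in D) `|f x|.
Proof. by move=> bf; apply: le_normr_Rintegral => //; exact: bm_integrable. Qed.

Lemma bm_normr_Rintegral_le f M : bounded_measurable f ->
  (forall x, D x -> `|f x| <= M) ->
  `|\int[mu]_(x in D) f x| <= M * fine (mu D).
Proof.
move=> bf fM; apply: le_trans (bm_le_normr_Rintegral bf) _.
rewrite -Rintegral_cst//; apply: bm_le_Rintegral => //; first exact: bm_norm.
exact: bm_cst.
Qed.

(** The dominating function takes extended real values because it will be a supremum over all points
    of space. *)
Lemma Rintegral_dominated_cvg (f_ : nat -> T -> R) f (g : T -> \bar R) :
  (forall n, measurable_fun D (f_ n)) -> measurable_fun D f ->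
  mu.-integrable D g ->
  (forall n, {ae mu, forall x, D x -> (`|f_ n x|%:E <= g x)%E}) ->
  {ae mu, forall x, D x -> f_ n x @[n --> \oo] --> f x} ->
  \int[mu]_(x in D) f_ n x @[n --> \oo] --> \int[mu]_(x in D) f x.
Proof.
move=> mf_ mf ig fg cf.
have [] := @dominated_convergence _ T R mu D mD (fun n => EFin \o f_ n)
  (EFin \o f) g.
- by move=> n; exact/measurable_EFinP.
- exact/measurable_EFinP.
- apply: filterS cf => x cf Dx; apply: cvg_EFin; last exact: cf.
  exact: nearW.
- exact: ig.
- have : {ae mu, forall x, forall n, D x -> (`|f_ n x|%:E <= g x)%E}.
    by apply/ae_foralln => n; exact: fg.
  by apply: filterS => x /= h n Dx; exact: h.
move=> intf _ cvgf.
by apply: fine_cvg; rewrite fineK ?integrable_fin_num.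
Qed.

Lemma bm_dominated_cvg (f_ : nat -> T -> R) f M :
  (forall n, measurable_fun [set: T] (f_ n)) -> measurable_fun [set: T] f ->
  (forall n x, `|f_ n x| <= M) ->
  (forall x, D x -> f_ n x @[n --> \oo] --> f x) ->
  \int[mu]_(x in D) f_ n x @[n --> \oo] --> \int[mu]_(x in D) f x.
Proof.
move=> mf_ mf fM cf; apply: (@Rintegral_dominated_cvg _ _ (EFin \o cst M)).
- by move=> n; exact: measurable_funTS.
- exact: measurable_funTS.
- by apply: bm_integrable; exact: bm_cst.
- by move=> n; apply: aeW => x _; rewrite lee_fin.
- by apply: aeW => x; exact: cf.
Qed.

End bounded_measurable.

(** * C1 functions and bumps *)

Section C1_functions.
Context (R : realType) (d : nat).
Local Notation V := 'rV[R]_d.+1.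
Local Notation e_ i := (basis_vector R i).
Implicit Types (f g : V -> R) (x y : V).

(** Partial derivatives only, as in [C1c]; continuity of [g] itself is recovered in
    [C1_continuous]. *)
Definition C1 g := (forall i x, derivable g x (e_ i)) /\
  (forall i, continuous ('D_(e_ i) g)).

Lemma is_derive_line g x v :
  (forall s : R, derivable g (x + s *: v) v) ->
  forall s : R, is_derive s 1 (fun t : R => g (x + t *: v)) ('D_v g (x + s *: v)).
Proof.
move=> dg s.
have E : (fun h : R => h^-1 *: (((fun t : R => g (x + t *: v)) \o shift s) (h *: 1)
      - g (x + s *: v))) =
    (fun h : R => h^-1 *: ((g \o shift (x + s *: v)) (h *: v) - g (x + s *: v))).
  apply/funext => h /=; congr (_ *: (g _ - _)).
  by rewrite scalerDl [h *: 1]mulr1 addrCA.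
by split; rewrite /derivable /derive E//; exact: dg.
Qed.

Lemma MVT_line g x v (t : R) :
  (forall s : R, derivable g (x + s *: v) v) ->
  exists2 c, `|c| <= `|t| & g (x + t *: v) - g x = t * 'D_v g (x + c *: v).
Proof.
move=> dg; have ds := is_derive_line dg.
have cs : continuous (fun s : R => g (x + s *: v)).
  by move=> s; apply/differentiable_continuous/derivable1_diffP; case: (ds s).
have [t0|t0] := leP 0 t.
  have [c] := MVT_segment t0 (fun s _ => ds s) (continuous_subspaceT cs).
  rewrite in_itv/= => /andP[c0 ct]; rewrite scale0r addr0 subr0 => ->.
  by exists c; [rewrite !ger0_norm|rewrite mulrC].
have [c] := MVT_segment (ltW t0) (fun s _ => ds s) (continuous_subspaceT cs).
rewrite in_itv/= => /andP[tc c0]; rewrite scale0r addr0 => h.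
exists c; first by rewrite !ler0_norm ?lerN2// ltW.
by rewrite -opprB h sub0r mulrN opprK mulrC.
Qed.

Lemma row_continuousP g : (forall x (e : R), 0 < e ->
    exists2 r : R, 0 < r & forall y, `|y - x| < r -> `|g y - g x| <= e) ->
  continuous g.
Proof.
move=> h x.
apply: (iffRL (@cvgrPdist_le R R V (nbhs x) (nbhs_filter x) g (g x))) => e e0.
have [r r0 gr] := h x e e0.
suff : nbhs x [set y | `|g x - g y| <= e] by [].
by apply/(@nbhs_normP R _ x [set y | `|g x - g y| <= e]); exists r => // y /= xy; rewrite distrC; apply: gr; rewrite distrC.
Qed.

Lemma near_row x (r : R) : 0 < r -> \forall y \near x, `|x - y| < r.
Proof. by move=> r0; apply/(@nbhs_normP R _ x); exists r. Qed.

Lemma row_continuousD f g : continuous f -> continuous g ->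
  continuous (fun x => f x + g x).
Proof. by move=> cf cg x; exact: (continuousD (cf x) (cg x)). Qed.

Lemma row_continuousM f g : continuous f -> continuous g ->
  continuous (fun x => f x * g x).
Proof. by move=> cf cg x; exact: (continuousM (cf x) (cg x)). Qed.

(** The corners of the staircase from [x] to [y] that changes one coordinate at a time. *)
Definition splice (k : nat) x y : V := \row_i (if (i < k)%N then y 0 i else x 0 i).

Lemma spliceS (i : 'I_d.+1) x y :
  splice i.+1 x y = splice i x y + (y 0 i - x 0 i) *: e_ i.
Proof.
apply/rowP => j; rewrite !mxE eqxx/= ltnS leq_eqVlt -val_eqE/=.
case: eqP => [/val_inj ->|_] /=.
  by rewrite ltnn mulr1 addrC subrK.
by rewrite mulr0 addr0.
Qed.

(** In the maximum norm no point of the staircase is farther from [x] than [y] is, so bounds on the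
    derivatives near [x] apply along all of it. *)
Lemma splice_near (i : 'I_d.+1) x y c : `|c| <= `|y 0 i - x 0 i| ->
  `|splice i x y + c *: e_ i - x| <= `|y - x|.
Proof.
move=> cle; apply/row_norm_leP => // j; rewrite !mxE eqxx/=.
have := norm_coord_le (y - x) j; rewrite !mxE => yx.
have [->|_] := eqVneq j i.
  rewrite ltnn mulr1 addrAC subrr add0r; apply: le_trans cle _.
  by have := norm_coord_le (y - x) i; rewrite !mxE.
rewrite mulr0 addr0; case: ifP => _; last by rewrite subrr normr0.
exact: yx.
Qed.

(** The increment telescopes along the staircase and each leg obeys the one-dimensional mean value
    theorem; the factor [d.+1] counts the legs. *)
Lemma C1_increment_le g C x y :
  (forall i z, derivable g z (e_ i)) ->
  (forall i z, `|z - x| <= `|y - x| -> `|'D_(e_ i) g z| <= C) ->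
  `|g y - g x| <= C * d.+1%:R * `|y - x|.
Proof.
move=> dg gC.
have E : g y - g x = \sum_(i < d.+1) (g (splice i.+1 x y) - g (splice i x y)).
  rewrite -(big_mkord xpredT (fun i => g (splice i.+1 x y) - g (splice i x y))).
  rewrite telescope_sumr//; congr (g _ - g _); apply/rowP => j.
    by rewrite mxE ltn_ord.
  by rewrite mxE.
have -> : C * d.+1%:R * `|y - x| = \sum_(i < d.+1) (C * `|y - x|).
  by rewrite sumr_const card_ord -[RHS]mulr_natr mulrAC.
rewrite E; apply: le_trans (ler_norm_sum _ _ _) _; apply: ler_sum => i _.
rewrite spliceS.
have [c cle ->] := @MVT_line g (splice i x y) (e_ i) (y 0 i - x 0 i) (fun s => dg _ _).
have C0 := gC i _ (splice_near cle).
rewrite normrM mulrC ler_pM//.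
by have := norm_coord_le (y - x) i; rewrite !mxE.
Qed.

Lemma C1_continuous g : C1 g -> continuous g.
Proof.
move=> [dg cg]; apply: row_continuousP => x e e0.
(* By continuity [C] bounds all partial derivatives in a neighbourhood of [x]; the summand 1 absorbs
   their variation. *)
pose C := 1 + \sum_i `|'D_(e_ i) g x|.
have C0 : 0 < C by rewrite ltr_pwDl// sumr_ge0.
have : \forall y \near x, forall i, `|'D_(e_ i) g y| <= C.
  apply: (@filter_forall _ _ (fun i y => `|'D_(e_ i) g y| <= C) (nbhs x)
    (nbhs_filter x)) => i.
  have := cg i x; move=> /cvgrPdist_le/(_ 1 ltr01); apply: filterS => y h.
  rewrite -(subrK ('D_(e_ i) g x) ('D_(e_ i) g y)).
  apply: le_trans (ler_normD _ _) _; apply: lerD; first by rewrite distrC.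
  by rewrite (bigD1 i)//= lerDl sumr_ge0.
move=> /nbhs_normP[r /= r0 gC].
exists (Num.min r (e / (C * d.+1%:R))) => /= [|y].
  by rewrite lt_min r0 divr_gt0// mulr_gt0.
rewrite lt_min => /andP[yr ye].
apply: (@le_trans _ _ (C * d.+1%:R * `|y - x|)).
  apply: C1_increment_le => // i z zx; apply: gC => /=.
  by rewrite distrC; exact: le_lt_trans zx yr.
by rewrite mulrC -ler_pdivlMr ?mulr_gt0// ltW.
Qed.

Lemma C1_cst c : C1 (fun=> c).
Proof.
split=> [i x|i]; first exact: derivable_cst.
have -> : 'D_(e_ i) (fun=> c) = fun=> 0 by apply/funext => x; exact: derive_cst.
exact: cst_continuous.
Qed.

Lemma derive_add f g i x : C1 f -> C1 g ->
  'D_(e_ i) (fun x => f x + g x) x = 'D_(e_ i) f x + 'D_(e_ i) g x.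
Proof. by move=> [df _] [dg _]; exact: deriveD. Qed.

Lemma derive_mul f g i x : C1 f -> C1 g ->
  'D_(e_ i) (fun x => f x * g x) x = f x * 'D_(e_ i) g x + g x * 'D_(e_ i) f x.
Proof. by move=> [df _] [dg _]; exact: deriveM. Qed.

Lemma C1D f g : C1 f -> C1 g -> C1 (fun x => f x + g x).
Proof.
move=> Cf Cg; split=> [i x|i]; first by case: Cf Cg => df _ [dg _]; exact: derivableD.
rewrite (_ : 'D_(e_ i) _ = fun x => 'D_(e_ i) f x + 'D_(e_ i) g x); last first.
  by apply/funext => x; exact: derive_add.
case: Cf Cg => _ cf [_ cg].
by apply: row_continuousD; [exact: cf|exact: cg].
Qed.

Lemma C1M f g : C1 f -> C1 g -> C1 (fun x => f x * g x).
Proof.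
move=> Cf Cg; split=> [i x|i].
  by case: Cf Cg => df _ [dg _]; exact: derivableM.
have kf := C1_continuous Cf; have kg := C1_continuous Cg.
rewrite (_ : 'D_(e_ i) _ =
  fun x => f x * 'D_(e_ i) g x + g x * 'D_(e_ i) f x); last first.
  by apply/funext => x; exact: derive_mul.
case: Cf Cg => _ cf [_ cg].
by apply: row_continuousD; apply: row_continuousM.
Qed.

Lemma derive_scale c g i x : C1 g ->
  'D_(e_ i) (fun x => c * g x) x = c * 'D_(e_ i) g x.
Proof.
move=> Cg; rewrite (derive_mul _ _ (C1_cst c) Cg).
by rewrite derive_cst mulr0 addr0.
Qed.

Lemma C1Z c g : C1 g -> C1 (fun x => c * g x).
Proof. by apply: C1M; exact: C1_cst. Qed.

Lemma C1N g : C1 g -> C1 (fun x => - g x).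
Proof.
move=> Cg; have -> : (fun x => - g x) = (fun x => -1 * g x).
  by apply/funext => x; rewrite mulN1r.
exact: C1Z.
Qed.

Lemma derive_opp g i x : C1 g ->
  'D_(e_ i) (fun x => - g x) x = - 'D_(e_ i) g x.
Proof.
move=> Cg; have -> : (fun x => - g x) = (fun x => -1 * g x).
  by apply/funext => y; rewrite mulN1r.
by rewrite derive_scale// mulN1r.
Qed.

Lemma C1B f g : C1 f -> C1 g -> C1 (fun x => f x - g x).
Proof. by move=> Cf Cg; exact: (C1D Cf (C1N Cg)). Qed.

Lemma derive_sub f g i x : C1 f -> C1 g ->
  'D_(e_ i) (fun x => f x - g x) x = 'D_(e_ i) f x - 'D_(e_ i) g x.
Proof. by move=> Cf Cg; rewrite (derive_add i x Cf (C1N Cg)) derive_opp. Qed.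

Lemma C1_prod (I : Type) (r : seq I) (P : pred I) (F : I -> V -> R) :
  (forall i, P i -> C1 (F i)) -> C1 (fun x => \prod_(i <- r | P i) F i x).
Proof.
move=> CF; elim: r => [|i r IH].
  have -> : (fun x => \prod_(i <- [::] | P i) F i x) = cst 1.
    by apply/funext => x; rewrite big_nil.
  exact: C1_cst.
have -> : (fun x => \prod_(j <- i :: r | P j) F j x) =
    (fun x => if P i then F i x * \prod_(j <- r | P j) F j x
              else \prod_(j <- r | P j) F j x).
  by apply/funext => x; rewrite big_cons.
by case Pi: (P i); [apply: C1M; [exact: CF|exact: IH]|exact: IH].
Qed.

Lemma translate_continuous (z : V) : continuous (translate z).
Proof. by move=> x; apply: (@continuousD _ _ _ id (cst z)); [exact: cvg_id|exact: cst_continuous]. Qed.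

Lemma derive_translate g z v :
  'D_v (g \o translate z) = 'D_v g \o translate z.
Proof.
apply/funext => x; rewrite /derive /=.
have -> // : (fun h : R => h^-1 *: (((g \o translate z) \o shift x) (h *: v) -
    (g \o translate z) x)) =
  (fun h : R => h^-1 *: ((g \o shift (translate z x)) (h *: v) - g (translate z x))).
by apply/funext => h /=; rewrite /translate addrA.
Qed.

Lemma C1_translate g z : C1 g -> C1 (g \o translate z).
Proof.
move=> [dg cg]; split=> [i x|i].
  rewrite /derivable (_ : (fun h => _) =
    fun h : R => h^-1 *: ((g \o shift (translate z x)) (h *: e_ i) - g (translate z x))).
    exact: dg.
  by apply/funext => h /=; rewrite /translate addrA.
rewrite derive_translate => x; apply: continuous_comp; first exact: translate_continuous.
exact: cg.
Qed.

Lemma coord_continuous_row (j : 'I_d.+1) : continuous (fun x : V => x 0 j).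
Proof. exact: coord_continuous. Qed.

Lemma C1_coord (r r' : R -> R) (j : 'I_d.+1) :
  (forall t : R, is_derive t 1 r (r' t)) -> continuous r' ->
  C1 (fun x : V => r (x 0 j)).
Proof.
move=> dr cr'.
have D i x : is_derive x (e_ i) (fun x : V => r (x 0 j)) (if j == i then r' (x 0 j) else 0).
  case: eqP => [->|/eqP ji].
    have E : (fun h : R => h^-1 *: (((fun x : V => r (x 0 i)) \o shift x) (h *: e_ i) -
        r (x 0 i))) = (fun h : R => h^-1 *: ((r \o shift (x 0 i)) (h *: 1) - r (x 0 i))).
      by apply/funext => h /=; rewrite !mxE !eqxx.
    by case: (dr (x 0 i)) => d1 d2; split; rewrite /derivable /derive E.
  have E : (fun h : R => h^-1 *: (((fun x : V => r (x 0 j)) \o shift x) (h *: e_ i) -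
      r (x 0 j))) = fun=> 0.
    apply/funext => h /=; rewrite !mxE eqxx (negbTE ji)/= mulr0 add0r.
    by rewrite subrr scaler0.
  split; rewrite /derivable /derive E; first exact: is_cvg_cst.
  exact: lim_cst.
split=> [i x|i]; first by case: (D i x).
rewrite (_ : 'D_(e_ i) _ = fun x => if j == i then r' (x 0 j) else 0); last first.
  by apply/funext => x; case: (D i x).
case: (j == i); last exact: cst_continuous.
move=> x;  apply: continuous_comp; [exact: coord_continuous_row|exact: cr'].
Qed.

Definition bounded_support f := exists M, forall x, M <= `|x| -> f x = 0.

(** Compactness gives the modulus on a ball one unit larger than the support. If [x] lies outside
    that ball and [r < 1], then [y] lies outside the support too and both values vanish. *)
Lemma bounded_support_unif_cont f : continuous f -> bounded_support f ->
  forall e, 0 < e -> \forall r \near 0^'+, forall x y, `|x - y| < r -> `|f x - f y| <= e.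
Proof.
move=> cf [M fM] e e0.
have M1 : 0 < `|M| + 1 by rewrite ltr_wpDl.
pose K := closed_ball (0 : V) (`|M| + 1).
have cK : compact K.
  apply: bounded_closed_compact; last exact: closed_ball_closed.
  exists (`|M| + 1); split; first exact: num_real.
  move=> z Mz x; rewrite /K closed_ballE// /closed_ball_ /= sub0r normrN => h.
  exact: le_trans h (ltW Mz).
have : \forall r \near 0^'+, K `<=` [set x | forall y, `|x - y| < r -> `|f x - f y| <= e].
  apply: (compact_near_coveringP K).1 => // x Kx.
  have := cf x => /cvgrPdist_lt/(_ (e / 2)); rewrite divr_gt0// => /(_ isT).
  move=> /nbhs_normP[r /= r0 fr].
  near=> x' s => /= y x'y.
  have xx' : `|x - x'| < r / 2.
    by near: x'; apply: near_row; rewrite divr_gt0.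
  have sr : s < r / 2 by near: s; apply: nbhs_right_lt; rewrite divr_gt0.
  have h1 : `|f x - f x'| < e / 2.
    by apply: fr => /=; apply: lt_trans xx' _; rewrite ltr_pdivrMr// ltr_pMr// ltr1n.
  have h2 : `|f x - f y| < e / 2.
    apply: fr => /=; rewrite -(subrKA x').
    apply: le_lt_trans (ler_normD _ _) _.
    by rewrite [r]splitr ltrD// (lt_trans x'y).
  rewrite -(subrKA (f x)); apply: le_trans (ler_normD _ _) _.
  by rewrite distrC [e]splitr ltW// ltrD.
apply: filterS2 (nbhs_right_lt (@ltr01 R)) => r r1 fr x y xyr.
have [xK|xK] := leP `|x| (`|M| + 1).
  by apply: fr => //; rewrite /K closed_ballE// /closed_ball_ /= sub0r normrN.
have fx : f x = 0 by apply: fM; rewrite (le_trans (ler_norm _))// (le_trans _ (ltW xK))// lerDl.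
have fy : f y = 0.
  apply: fM; apply: le_trans (ler_norm _) _; rewrite leNgt; apply/negP => yM.
  move: xK; rewrite ltNge => /negP; apply.
  rewrite -(subrK y x); apply: le_trans (ler_normD _ _) _; rewrite addrC lerD ?ltW//.
  exact: lt_trans xyr r1.
by rewrite fx fy subrr normr0 ltW.
Unshelve. all: by end_near. Qed.

Lemma bounded_support_bounded f : continuous f -> bounded_support f ->
  exists M, forall x, `|f x| <= M.
Proof.
move=> cf sf.
have [N fN] := sf.
have N1 : 0 < `|N| + 1 by rewrite ltr_wpDl.
pose K := closed_ball (0 : V) (`|N| + 1).
have cK : compact K.
  apply: bounded_closed_compact; last exact: closed_ball_closed.
  exists (`|N| + 1); split; first exact: num_real.
  move=> z Mz x; rewrite /K closed_ballE// /closed_ball_ /= sub0r normrN => h.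
  exact: le_trans h (ltW Mz).
have /compact_bounded[M [_ fM]] := continuous_compact (continuous_subspaceT cf) cK.
exists (`|M| + 1) => x.
have [xK|xK] := leP `|x| (`|N| + 1).
  apply: fM; first by rewrite ltr_pwDr// ler_norm.
  by exists x => //; rewrite /K closed_ballE// /closed_ball_ /= sub0r normrN.
rewrite fN ?normr0 ?addr_ge0//.
by rewrite (le_trans (ler_norm _))// (le_trans _ (ltW xK))// lerDl.
Qed.

Lemma bounded_support_bm f : continuous f -> bounded_support f ->
  bounded_measurable (f : lebT R d -> R).
Proof.
by move=> cf sf; split; [exact: continuous_lebesgue_measurable|exact: bounded_support_bounded].
Qed.

End C1_functions.

Section smooth_step.
Context (R : realType).
Implicit Types s t c : R.

Definition ramp t := Num.max 0 t.

Lemma is_derive_ramp_sq c t :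
  is_derive t 1 (fun s => ramp (s + c) ^+ 2) (2 * ramp (t + c)).
Proof.
have D : (fun h : R => h^-1 *: (((fun s => ramp (s + c) ^+ 2) \o shift t) (h *: 1) -
    ramp (t + c) ^+ 2)) @ 0^' --> 2 * ramp (t + c).
  apply/cvgrPdist_le => e e0; near=> h.
  have h0 : h != 0 by near: h; exact: nbhs_dnbhs_neq.
  have he : `|h| <= e.
    by near: h; apply: dnbhs0_le.
  (* The difference quotient deviates from the claimed derivative by at most [|h|], which is checked
     by cases on the two signs after multiplication by [|h|]. *)
  apply: le_trans he; rewrite /= [h *: 1]mulr1.
  set p := ramp (t + c); set q := ramp (h + t + c).
  rewrite -(ler_pM2l (_ : 0 < `|h|)) ?normr_gt0// -!normrM mulrBr.
  rewrite [h * (h^-1 *: _)]mulrA divff// mul1r.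
  rewrite [leRHS]ger0_norm -?expr2 ?sqr_ge0// /q /p /ramp.
  rewrite /Num.max; case: ifPn; case: ifPn; rewrite -?leNgt => a b;
    rewrite ler_norml; apply/andP; split; nra.
by split; [apply/cvg_ex; exists (2 * ramp (t + c))|exact: cvg_lim D].
Unshelve. all: by end_near. Qed.

(* The integral of a hat function over (0, 1): a C1 function equal to 0 for
   t <= 0 and to 1 for t >= 1. *)
Definition step t :=
  2 * ramp (t + 0) ^+ 2 + (- 4) * ramp (t + (- 2^-1)) ^+ 2 + 2 * ramp (t + (- 1)) ^+ 2.

Definition step' t :=
  2 * (2 * ramp (t + 0)) + (- 4) * (2 * ramp (t + (- 2^-1))) +
  2 * (2 * ramp (t + (- 1))).

Lemma is_derive_step t : is_derive t 1 step (step' t).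
Proof.
have H (a c : R) : is_derive t 1 (fun s => a * ramp (s + c) ^+ 2) (a * (2 * ramp (t + c))).
  have := @is_deriveZ R R R (fun s => ramp (s + c) ^+ 2) a t 1 _ (is_derive_ramp_sq c t).
  exact.
exact: is_deriveD.
Qed.

Lemma ramp_continuous c : continuous (fun t => ramp (t + c)).
Proof.
move=> t; apply: (@continuous_max _ _ (cst 0) (fun t => t + c)).
  exact: cvg_cst.
by apply: cvgD; [exact: cvg_id|exact: cvg_cst].
Qed.

Lemma step'_continuous : continuous step'.
Proof.
have H (k c : R) : continuous (fun t => k * (2 * ramp (t + c))).
  move=> t; exact: (continuousM (@cst_continuous R R k t)
    (continuousM (@cst_continuous R R 2 t) (@ramp_continuous c t))).
by move=> t; exact: (continuousD (continuousD (@H _ _ t) (@H _ _ t)) (@H _ _ t)).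
Qed.

Lemma step_le0 t : t <= 0 -> step t = 0.
Proof.
by move=> t0; rewrite /step /ramp /Num.max; do ! case: ifPn; rewrite -?leNgt => *; nra.
Qed.

Lemma step_ge1 t : 1 <= t -> step t = 1.
Proof.
by move=> t0; rewrite /step /ramp /Num.max; do ! case: ifPn; rewrite -?leNgt => *; nra.
Qed.

Lemma step_ge0 t : 0 <= step t.
Proof.
by rewrite /step /ramp /Num.max; do ! case: ifPn; rewrite -?leNgt => *; nra.
Qed.

Lemma step_le1 t : step t <= 1.
Proof.
by rewrite /step /ramp /Num.max; do ! case: ifPn; rewrite -?leNgt => *; nra.
Qed.

(** Being a difference of consecutive steps, its integer translates telescope to 1 ([sum_hat]);
    products over the coordinates then give a C1 partition of unity in space. *)
Definition hat t := step (t + 1) - step t.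

Lemma hat_ge0 t : 0 <= hat t.
Proof.
rewrite /hat; have [t0|t0] := leP t 0.
  by rewrite (step_le0 t0) subr0 step_ge0.
have -> : step (t + 1) = 1 by apply: step_ge1; lra.
by rewrite subr_ge0 step_le1.
Qed.

Lemma hat_eq0 t : 1 <= `|t| -> hat t = 0.
Proof.
rewrite ler_normr /hat => /orP[t1|t1].
  by rewrite !step_ge1 ?subrr//; lra.
by rewrite !step_le0 ?subrr//; lra.
Qed.

Lemma hat0 : hat 0 = 1.
Proof. by rewrite /hat step_ge1 ?add0r// step_le0// subr0. Qed.

Lemma sum_hat t (n : nat) : 0 <= t -> t <= n%:R ->
  \sum_(k < n.+1) hat (t - k%:R) = 1.
Proof.
move=> t0 tn; rewrite -(big_mkord xpredT (fun k => hat (t - k%:R))).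
rewrite (eq_bigr (fun k => (- step (t - k.+1%:R + 1)) - (- step (t - k%:R + 1)))).
  rewrite telescope_sumr// subr0 step_le0; last by rewrite -natr1; lra.
  by rewrite oppr0 opprK add0r step_ge1// lerDr.
move=> k _; have -> : t - k.+1%:R + 1 = t - k%:R by rewrite -natr1; lra.
by rewrite /hat opprK [RHS]addrC.
Qed.

Lemma is_derive_affine (r r' : R -> R) (k c : R) t :
  (forall t : R, is_derive t 1 r (r' t)) ->
  is_derive t 1 (fun s => r (k * s + c)) (r' (k * t + c) * k).
Proof.
move=> dr; apply: (@is_derive1_comp _ r (fun s => k * s + c)) => //.
have dk : is_derive t 1 (fun s => k * s) k.
  have h := @is_deriveZ R R R id k t 1 1 (is_derive_id _ _).
  by apply: is_derive_eq h _; exact: mulr1.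
have := @is_deriveD R R R (fun s => k * s) (cst c) t 1 k 0 dk (is_derive_cst c t 1).
by rewrite addr0.
Qed.

Lemma affine_continuous (k c : R) : continuous (fun s : R => k * s + c).
Proof.
move=> t; apply: cvgD; last exact: cvg_cst.
by apply: cvgM; [exact: cvg_cst|exact: cvg_id].
Qed.

End smooth_step.
Arguments step {R} t.
Arguments step' {R} t.
Arguments hat {R} t.

Section bumps.
Context (R : realType) (d : nat).
Local Notation V := 'rV[R]_d.+1.

Lemma C1_step_coord (k c : R) (j : 'I_d.+1) :
  C1 (fun x : V => step (k * x 0 j + c)).
Proof.
apply: (@C1_coord _ _ (fun t => step (k * t + c)) (fun t => step' (k * t + c) * k)).
  by move=> t; apply: is_derive_affine; exact: is_derive_step.
have h : continuous (step' \o (fun t => k * t + c)).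
  move=> t; apply: continuous_comp; first exact: affine_continuous.
  exact: step'_continuous.
by move=> t; exact: (continuousM (h t) (@cst_continuous R R k t)).
Qed.

Definition hat_bump (h : R) (p x : V) : R := \prod_i hat ((x 0 i - p 0 i) / h).

Lemma hat_bump_C1 h p : C1 (hat_bump h p).
Proof.
apply: C1_prod => i _.
under eq_fun => x.
  rewrite /hat (_ : _ / h + 1 = h^-1 * x 0 i + (1 - p 0 i / h)); last by lra.
  rewrite (_ : (x 0 i - _) / h = h^-1 * x 0 i + (- (p 0 i / h))); last by lra.
over.
by apply: C1B; exact: C1_step_coord.
Qed.

Lemma hat_bump_ge0 h p x : 0 <= hat_bump h p x.
Proof. by apply: prodr_ge0 => i _; exact: hat_ge0. Qed.

Lemma hat_bump_eq0 h p x : 0 < h -> h <= `|x - p| -> hat_bump h p x = 0.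
Proof.
move=> h0; apply: contra_leP => /eqP b0; apply/row_norm_ltP => // i.
rewrite ltNge; apply/negP => hx; case/negP: b0; apply/eqP.
rewrite /hat_bump (bigD1 i)//= hat_eq0 ?mul0r//.
by rewrite normrM normfV (gtr0_norm h0) ler_pdivlMr// mul1r; move: hx; rewrite !mxE.
Qed.

Lemma hat_bump_center h p : hat_bump h p p = 1.
Proof. by rewrite /hat_bump big1// => i _; rewrite subrr mul0r hat0. Qed.

(** The index range from 0 to 2N is shifted by [N], so the grid is centred at the origin and its
    bumps sum to 1 on the cube of half-side N h. *)
Definition grid_point (h : R) (N : nat) (m : {ffun 'I_d.+1 -> 'I_(N + N).+1}) : V :=
  \row_i (h * ((m i)%:R - N%:R)).

Lemma sum_hat_bump h N x : 0 < h -> `|x| <= N%:R * h ->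
  \sum_(m : {ffun 'I_d.+1 -> 'I_(N + N).+1}) hat_bump h (grid_point h m) x = 1.
Proof.
move=> h0 xN.
rewrite /hat_bump; under eq_bigr do under eq_bigr do rewrite mxE.
pose G (i : 'I_d.+1) (k : 'I_(N + N).+1) := hat ((x 0 i - h * (k%:R - N%:R)) / h).
(* The sum over multi-indices of products is the product over coordinates of one-dimensional sums,
   each equal to 1. *)
rewrite -(bigA_distr_bigA G) big1// => i _.
rewrite -[RHS](@sum_hat _ (x 0 i / h + N%:R) (N + N)).
- apply: eq_bigr => k _; rewrite /G; congr hat.
  by rewrite mulrBl (mulrC h) mulfK ?gt_eqF//; lra.
- have := le_trans (norm_coord_le x i) xN; rewrite ler_norml => /andP[lo _].
  by rewrite -lerBlDr sub0r ler_pdivlMr// mulNr.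
- have := le_trans (norm_coord_le x i) xN; rewrite ler_norml => /andP[_ hi].
  by rewrite natrD lerD2r ler_pdivrMr.
Qed.

End bumps.
Arguments grid_point {R d} h {N} m.
Arguments hat_bump {R d} h p x.

(** * Test functions supported in [Omega] *)

Section compactly_supported.
Context (R : realType) (d : nat) (Omega : set 'rV[R]_d.+1).
Hypothesis oOmega : open Omega.
Local Notation V := 'rV[R]_d.+1.
Local Notation e_ i := (basis_vector R i).
Implicit Types (f g phi psi : V -> R) (x y : V).

Lemma compact_open_margin (K U : set V) : compact K -> open U -> K `<=` U ->
  exists2 r : R, 0 < r & forall x y, K x -> `|y - x| <= r -> U y.
Proof.
move=> cK oU KU.
have : \forall r \near (0 : R)^'+, K `<=` [set x | forall y, `|y - x| <= r -> U y].
  apply: (compact_near_coveringP K).1 => // x Kx.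
  have /nbhs_normP[r /= r0 rU] := open_nbhs_nbhs (conj oU (KU _ Kx)).
  near=> x' s => /= y yx'.
  have xx' : `|x - x'| < r / 2.
    by near: x'; apply: near_row; rewrite divr_gt0.
  have sr : s < r / 2 by near: s; apply: nbhs_right_lt; rewrite divr_gt0.
  apply: rU => /=; rewrite -(subrKA x'); apply: le_lt_trans (ler_normD _ _) _.
  by rewrite [r]splitr ltrD// distrC (le_lt_trans yx').
move=> /(filterI (nbhs_right_gt (0 : R)))/filter_ex[r [/= r0 h]].
by exists r => // x y Kx; exact: h.
Unshelve. all: by end_near. Qed.

Lemma C1c_C1 phi : C1c Omega phi -> C1 phi.
Proof. by case. Qed.

Lemma C1c_continuous phi : C1c Omega phi -> continuous phi.
Proof. by move=> /C1c_C1; exact: C1_continuous. Qed.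

Lemma C1c_out phi x : C1c Omega phi -> ~ Omega x -> phi x = 0.
Proof. by move=> [_ _ [K [_ KO K0]]] Ox; apply: K0 => /KO. Qed.

Lemma C1c_bounded_support phi : C1c Omega phi -> bounded_support phi.
Proof.
move=> [_ _ [K [/compact_bounded[M [_ KM]] _ K0]]].
exists (M + 2) => x Mx; apply: K0 => Kx.
have := KM (M + 1); rewrite ltrDl ltr01 => /(_ isT x Kx) xM.
by have := le_trans Mx xM; lra.
Qed.

Lemma C1c_C0 phi : C1c Omega phi -> C0 Omega phi.
Proof.
by move=> Cphi; split; [exact: C1c_continuous|move=> x; exact: C1c_out].
Qed.

(** A point outside [Omega] has a neighbourhood that avoids the compact support, so the derivative
    vanishes there together with [phi]. *)
Lemma C1c_C0_derive phi i : C1c Omega phi -> C0 Omega ('D_(e_ i) phi).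
Proof.
move=> [_ cphi [K [cK KO K0]]]; split; first exact: cphi.
move=> x Ox.
have oK : open (~` K) by apply: closed_openC; apply: compact_closed => //; exact: norm_hausdorff.
have /nbhs_normP[r /= r0 rK] : nbhs x (~` K) by apply: open_nbhs_nbhs; split => // /KO.
have -> : 'D_(e_ i) phi x = 'D_(e_ i) (cst 0) x.
  apply: near_eq_derive; apply/(@nbhs_normP R _ x); exists r => // y /= xy.
  by apply: K0; exact: rK.
exact: derive_cst.
Qed.

Lemma C1c0 : C1c Omega (fun=> 0).
Proof.
have [? ?] := @C1_cst R d 0; split => //.
by exists set0; split => //; exact: compact0.
Qed.

Lemma C1cD phi psi : C1c Omega phi -> C1c Omega psi ->
  C1c Omega (fun x => phi x + psi x).
Proof.
move=> Cphi Cpsi; have [? ?] := C1D (C1c_C1 Cphi) (C1c_C1 Cpsi).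
case: Cphi Cpsi => _ _ [K [cK KO K0]] [_ _ [L [cL LO L0]]]; split => //.
exists (K `|` L); split; first exact: compactU.
  by move=> x [/KO|/LO].
by move=> x /not_orP[/K0 -> /L0 ->]; rewrite addr0.
Qed.

Lemma C1cM phi g : C1c Omega phi -> C1 g -> C1c Omega (fun x => phi x * g x).
Proof.
move=> Cphi Cg; have [? ?] := C1M (C1c_C1 Cphi) Cg.
case: Cphi => _ _ [K [cK KO K0]]; split => //.
by exists K; split => // x /K0 ->; rewrite mul0r.
Qed.

Lemma C1cMl phi g : C1c Omega phi -> C1 g -> C1c Omega (fun x => g x * phi x).
Proof. by move=> Cphi Cg; under eq_fun do rewrite mulrC; exact: C1cM. Qed.

Lemma C1cZ c phi : C1c Omega phi -> C1c Omega (fun x => c * phi x).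
Proof. by move=> Cphi; apply: C1cMl => //; exact: C1_cst. Qed.

Lemma C1cN phi : C1c Omega phi -> C1c Omega (fun x => - phi x).
Proof.
move=> Cphi; have -> : (fun x => - phi x) = (fun x => -1 * phi x).
  by apply/funext => x; rewrite mulN1r.
exact: C1cZ.
Qed.

Lemma C1cB phi psi : C1c Omega phi -> C1c Omega psi ->
  C1c Omega (fun x => phi x - psi x).
Proof. by move=> Cphi Cpsi; exact: (C1cD Cphi (C1cN Cpsi)). Qed.

Lemma C1c_sum (I : Type) (r : seq I) (P : pred I) (F : I -> V -> R) :
  (forall i, P i -> C1c Omega (F i)) ->
  C1c Omega (fun x => \sum_(i <- r | P i) F i x).
Proof.
move=> CF; elim: r => [|i r IH].
  have -> : (fun x => \sum_(i <- [::] | P i) F i x) = cst 0.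
    by apply/funext => x; rewrite big_nil.
  exact: C1c0.
have -> : (fun x => \sum_(j <- i :: r | P j) F j x) =
    (fun x => if P i then F i x + \sum_(j <- r | P j) F j x
              else \sum_(j <- r | P j) F j x).
  by apply/funext => x; rewrite big_cons.
by case Pi: (P i); [apply: C1cD; [exact: CF|exact: IH]|exact: IH].
Qed.

Lemma C1c_translate phi : C1c Omega phi ->
  exists2 r : R, 0 < r & forall z, `|z| <= r -> C1c Omega (phi \o translate z).
Proof.
move=> Cphi; have [_ _ [K [cK KO K0]]] := Cphi.
have [r r0 rO] := compact_open_margin cK oOmega KO.
exists r => // z zr.
have [? ?] := C1_translate z (C1c_C1 Cphi); split => //.
exists (translate (- z) @` K); split.
- apply: continuous_compact => //; apply: continuous_subspaceT.
  exact: translate_continuous.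
- move=> _ [x Kx <-]; apply: rO Kx _; rewrite /translate.
  by rewrite addrAC subrr add0r normrN.
- move=> x Kx /=; apply: K0 => Kxz; apply: Kx; exists (translate z x) => //.
  by rewrite /translate addrK.
Qed.

Hypothesis bOmega : bounded_set Omega.

Lemma C0_bounded_support phi : C0 Omega phi -> bounded_support phi.
Proof.
move: bOmega => [M [_ OM]] [_ phi0].
exists (M + 2) => x Mx; apply: phi0 => Ox.
have := OM (M + 1); rewrite ltrDl ltr01 => /(_ isT x Ox) xM.
by have := le_trans Mx xM; lra.
Qed.

Lemma C0_bm phi : C0 Omega phi -> bounded_measurable (phi : lebT R d -> R).
Proof.
move=> Cphi; apply: bounded_support_bm; first by case: Cphi.
exact: C0_bounded_support.
Qed.

Lemma C1c_bm phi : C1c Omega phi -> bounded_measurable (phi : lebT R d -> R).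
Proof. by move=> /C1c_C0/C0_bm. Qed.

Lemma C1c_derive_bm phi i : C1c Omega phi ->
  bounded_measurable ('D_(e_ i) phi : lebT R d -> R).
Proof. by move=> /(C1c_C0_derive i)/C0_bm. Qed.

End compactly_supported.

(** * Uniform approximation of C_0 by test functions, and cutoffs *)

Section quasi_interpolation.
Context (R : realType) (d : nat) (Omega : set 'rV[R]_d.+1).
Local Notation V := 'rV[R]_d.+1.
Implicit Types (phi : V -> R) (x y : V).

(* For h = 1/(n+1) the functions [hat_bump h p], p in the grid, form a partition
   of unity; dropping the bumps whose support leaves Omega costs little for a
   function vanishing on the boundary. Being a finite sum of fixed test functions
   with coefficients phi p, it reduces statements on C0 to test functions. *)
Definition quasi_interpolant (h : R) (N : nat) phi x : R :=
  \sum_(m : {ffun 'I_d.+1 -> 'I_(N + N).+1} |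
      `[< forall y, `|y - grid_point h m| <= h -> Omega y >])
    phi (grid_point h m) * hat_bump h (grid_point h m) x.

Lemma hat_bump_C1c h p : 0 < h -> (forall y, `|y - p| <= h -> Omega y) ->
  C1c Omega (hat_bump h p).
Proof.
move=> h0 hO; have [? ?] := @hat_bump_C1 R d h p; split => //.
have E : closed_ball p h = [set y | `|y - p| <= h].
  by rewrite closed_ballE//; apply/seteqP; split=> y; rewrite /closed_ball_/= distrC.
exists (closed_ball p h); split.
- apply: bounded_closed_compact; last exact: closed_ball_closed.
  exists (h + `|p|); split; first exact: num_real.
  move=> z Mz x; rewrite E /= => xp; apply: le_trans (ltW Mz).
  by rewrite -(subrK p x); apply: le_trans (ler_normD _ _) _; exact: lerD.
- by move=> y; rewrite E; exact: hO.
- by move=> x; rewrite E /= => /negP; rewrite -ltNge => /ltW; exact: hat_bump_eq0.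
Qed.

Lemma quasi_interpolant_C1c h N phi : 0 < h ->
  C1c Omega (quasi_interpolant h N phi).
Proof.
move=> h0; apply: C1c_sum => m /asboolP mO; apply: C1cMl; last exact: C1_cst.
exact: hat_bump_C1c.
Qed.

(** Every bump active at [x] has its centre within [h] of [x]. A kept bump errs by at most the
    oscillation of [phi]. The cube of a dropped bump contains a point outside [Omega], where [phi]
    is 0; that point is within [2 * h] of [x], so [phi x] itself is at most [e]. *)
Lemma quasi_interpolant_error h N phi e x : 0 < h -> 0 <= e ->
  (forall y, Omega y -> `|y| <= N%:R * h) -> (forall y, ~ Omega y -> phi y = 0) ->
  (forall y z, `|y - z| < 2 * h -> `|phi y - phi z| <= e) ->
  `|quasi_interpolant h N phi x - phi x| <= e.
Proof.
move=> h0 e0 ON phi0 osc.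
have [Ox|Ox] := pselect (Omega x); last first.
  by rewrite phi0// (C1c_out (quasi_interpolant_C1c N phi h0) Ox) subrr normr0.
have S := sum_hat_bump h0 (ON _ Ox).
rewrite -[phi x]mulr1 -S mulr_sumr /quasi_interpolant big_mkcond/= -sumrB.
apply: le_trans (ler_norm_sum _ _ _) _.
rewrite -[leRHS]mulr1 -S mulr_sumr; apply: ler_sum => m _.
have b0 := hat_bump_ge0 h (grid_point h m) x.
have [hx|xh] := leP h `|x - grid_point h m|.
  by rewrite hat_bump_eq0// !mulr0; case: ifP => _; rewrite subrr normr0.
case: asboolP => [mO|mO].
  rewrite -mulrBl normrM (ger0_norm b0) ler_wpM2r//.
  by apply: osc; rewrite distrC; lra.
rewrite sub0r normrN normrM (ger0_norm b0) ler_wpM2r//.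
have [y [yh Oy]] : exists y, `|y - grid_point h m| <= h /\ ~ Omega y.
  apply: contra_notP mO => /forallNP H y yh; apply: contrapT => Oy; exact: (H y).
rewrite -(subr0 (phi x)) -(phi0 _ Oy); apply: osc.
rewrite -(subrKA (grid_point h m)); apply: le_lt_trans (ler_normD _ _) _.
by rewrite mulr_natl mulr2n ltr_leD// distrC.
Qed.

Hypothesis bOmega : bounded_set Omega.

Definition Omega_radius : nat := xget 0%N [set N : nat | forall x, Omega x -> `|x| <= N%:R].

Lemma Omega_radiusP x : Omega x -> `|x| <= Omega_radius%:R.
Proof.
rewrite /Omega_radius; case: xgetP => [N _ /= /(_ x)//|H].
move: bOmega => [M [_ OM]]; exfalso; apply: (H (Num.truncn (`|M| + 1)).+1) => y Oy.
apply: le_trans (ltW (truncnS_gt _)).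
by apply: OM => //; rewrite ltr_pwDr// ler_norm.
Qed.

(** With mesh 1/(n+1) and n+1 times the radius as number of steps, the grid reaches just far enough
    to cover [Omega] for every [n]. *)
Definition qi (n : nat) phi : V -> R :=
  quasi_interpolant n.+1%:R^-1 (n.+1 * Omega_radius) phi.

Lemma qi_C1c n phi : C1c Omega (qi n phi).
Proof. exact: quasi_interpolant_C1c. Qed.

Lemma qi_mesh x n : Omega x -> `|x| <= (n.+1 * Omega_radius)%:R * n.+1%:R^-1.
Proof. by move=> /Omega_radiusP; rewrite natrM mulrAC mulfV ?mul1r. Qed.

Lemma near_mesh_lt (r : R) : 0 < r -> \forall n \near \oo, 2 * n.+1%:R^-1 < r.
Proof.
move=> r0; have r2 : 0 < r / 2 by rewrite divr_gt0.
have := near_infty_natSinv_lt (PosNum r2).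
by apply: filterS => n /=; rewrite ltr_pdivlMr// mulrC.
Qed.

Lemma qi_unif_cvg phi : C0 Omega phi -> forall e, 0 < e ->
  \forall n \near \oo, forall x, `|qi n phi x - phi x| <= e.
Proof.
move=> C0phi e e0; have [cphi phi0] := C0phi.
have := bounded_support_unif_cont cphi (C0_bounded_support bOmega C0phi) e0.
move=> /(filterI (nbhs_right_gt (0 : R)))/filter_ex[r [/= r0 h]].
apply: filterS (near_mesh_lt r0) => n nr x.
apply: quasi_interpolant_error => //; first exact: ltW.
  by move=> y; exact: qi_mesh.
by move=> y z yz; apply: h; exact: lt_trans yz nr.
Qed.

(** The constant 1 does not vanish on the boundary, so the effect of the dropped bumps is visible:
    what remains is a partial sum of a partition of unity, with values in [0,1], equal to 1 away
    from the boundary. *)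
Definition cutoff n : V -> R := qi n (fun=> 1).

Lemma cutoff_C1c n : C1c Omega (cutoff n).
Proof. exact: qi_C1c. Qed.

Lemma cutoff_ge0 n x : 0 <= cutoff n x.
Proof. by apply: sumr_ge0 => m _; rewrite mul1r hat_bump_ge0. Qed.

Lemma cutoff_le1 n x : cutoff n x <= 1.
Proof.
have [Ox|Ox] := pselect (Omega x); last first.
  by rewrite (C1c_out (cutoff_C1c n) Ox).
rewrite -(sum_hat_bump (_ : 0 < n.+1%:R^-1) (qi_mesh n Ox))// /cutoff /qi.
rewrite /quasi_interpolant big_mkcond/=; apply: ler_sum => m _.
by case: ifP => _; rewrite ?mul1r ?hat_bump_ge0.
Qed.

(** The cube of a bump active at [x] lies within twice the mesh size of [x], so under the hypothesis
    no such bump was dropped. *)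
Lemma cutoff_eq1 n x : (forall y, `|y - x| < 2 * n.+1%:R^-1 -> Omega y) ->
  cutoff n x = 1.
Proof.
move=> xO.
have h0 : 0 < n.+1%:R^-1 :> R by rewrite invr_gt0.
have Ox : Omega x by apply: xO; rewrite subrr normr0 mulr_gt0.
rewrite -(sum_hat_bump h0 (qi_mesh n Ox)) /cutoff /qi.
rewrite /quasi_interpolant big_mkcond/=; apply: eq_bigr => m _.
case: asboolP => [_|mO]; first by rewrite mul1r.
apply/esym; apply: hat_bump_eq0 => //; rewrite leNgt; apply/negP => xm; apply: mO => y ym.
apply: xO; rewrite -(subrKA (grid_point n.+1%:R^-1 m)).
by apply: le_lt_trans (ler_normD _ _) _; rewrite mulr_natl mulr2n ler_ltD// distrC.
Qed.

Hypothesis oOmega : open Omega.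

Lemma cutoff_near1 (K : set V) : compact K -> K `<=` Omega ->
  \forall n \near \oo, forall x, K x -> cutoff n x = 1.
Proof.
move=> cK KO; have [r r0 rO] := compact_open_margin cK oOmega KO.
apply: filterS (near_mesh_lt r0) => n nr x Kx.
apply: cutoff_eq1 => y /lt_trans/(_ nr)/ltW; exact: rO.
Qed.

Lemma cutoff_cvg x : cutoff n x @[n --> \oo] --> (\1_Omega x : R).
Proof.
have [Ox|Ox] := pselect (Omega x).
  rewrite indicE mem_set//=.
  have := @cutoff_near1 [set x] (@compact_set1 _ x) (fun _ => fun e => ltac:(by rewrite e)).
  move=> H; apply: cvg_near_cst; apply: filterS H => n; exact.
rewrite indicE memNset//=; apply: cvg_near_cst; apply: nearW => n.
exact: (C1c_out (cutoff_C1c n) Ox).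
Qed.

End quasi_interpolation.

(** * Approximation of sets by C1 functions *)

Section bounded_fubini.
Context d1 d2 (T1 : measurableType d1) (T2 : measurableType d2) (R : realType).
Context (m1 : {sigma_finite_measure set T1 -> \bar R})
        (m2 : {sigma_finite_measure set T2 -> \bar R}).

Lemma Rintegral_indicM d (T : measurableType d) (mu : {measure set T -> \bar R})
    (D : set T) (f : T -> R) :
  \int[mu]_x (\1_D x * f x) = \int[mu]_(x in D) f x.
Proof.
rewrite [RHS]Rintegral_mkcond; apply: eq_Rintegral => x _.
by rewrite indicE /patch; case: (x \in D); rewrite ?mul1r ?mul0r.
Qed.

Lemma bm_pair1 (F : T1 * T2 -> R) x : bounded_measurable F ->
  bounded_measurable (fun y => F (x, y)).
Proof.
move=> [mF [M FM]]; split; last by exists M.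
exact: (measurableT_comp mF (pair1_measurable x)).
Qed.

Lemma bm_pair2 (F : T1 * T2 -> R) y : bounded_measurable F ->
  bounded_measurable (fun x => F (x, y)).
Proof.
move=> [mF [M FM]]; split; last by exists M.
exact: (measurableT_comp mF (pair2_measurable y)).
Qed.

Lemma bm_fst (g : T1 -> R) : bounded_measurable g ->
  bounded_measurable (fun p : T1 * T2 => g p.1).
Proof.
move=> [mg [M gM]]; split; last by exists M.
exact: (measurableT_comp mg measurable_fst).
Qed.

Lemma bm_snd (g : T2 -> R) : bounded_measurable g ->
  bounded_measurable (fun p : T1 * T2 => g p.2).
Proof.
move=> [mg [M gM]]; split; last by exists M.
exact: (measurableT_comp mg measurable_snd).
Qed.

Context (D1 : set T1) (D2 : set T2) (mD1 : measurable D1) (mD2 : measurable D2)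
  (fD1 : (m1 D1 < +oo)%E) (fD2 : (m2 D2 < +oo)%E).

Lemma bm_Fubini (F : T1 * T2 -> R) : bounded_measurable F ->
  \int[m1]_(x in D1) (\int[m2]_(y in D2) F (x, y)) =
  \int[m2]_(y in D2) (\int[m1]_(x in D1) F (x, y)).
Proof.
(* The indicators turn integrals over [D1] and [D2] into integrals over the whole spaces, for which
   Fubini's theorem is stated. *)
move=> bF; pose f p := \1_D1 p.1 * (\1_D2 p.2 * F p).
have bf : bounded_measurable f.
  apply: bmM; first by apply: bm_fst; exact: bm_indic.
  by apply: bmM => //; apply: bm_snd; exact: bm_indic.
have E1 (G : T1 * T2 -> R) x : bounded_measurable G ->
    (\int[m2]_y (\1_D1 x * (\1_D2 y * G (x, y)))%:E =
     (\1_D1 x * \int[m2]_(y in D2) G (x, y))%:E)%E.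
  move=> bG; rewrite -bm_RintegralZ//; last exact: bm_pair1.
  have -> : (\int[m2]_y (\1_D1 x * (\1_D2 y * G (x, y)))%:E =
             \int[m2]_(y in D2) (\1_D1 x * G (x, y))%:E)%E.
    rewrite [RHS]integral_mkcond; apply: eq_integral => y _.
    by rewrite /patch (indicE _ D2); case: (y \in D2); rewrite ?mul1r ?mul0r ?mulr0.
  rewrite /Rintegral fineK//; apply: integrable_fin_num => //.
  apply: bm_integrable => //; apply: bmM; [exact: bm_cst|exact: bm_pair1].
have E2 (G : T1 * T2 -> R) y : bounded_measurable G ->
    (\int[m1]_x (\1_D1 x * (\1_D2 y * G (x, y)))%:E =
     (\1_D2 y * \int[m1]_(x in D1) G (x, y))%:E)%E.
  move=> bG; rewrite -bm_RintegralZ//; last exact: bm_pair2.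
  have -> : (\int[m1]_x (\1_D1 x * (\1_D2 y * G (x, y)))%:E =
             \int[m1]_(x in D1) (\1_D2 y * G (x, y))%:E)%E.
    rewrite [RHS]integral_mkcond; apply: eq_integral => x _.
    by rewrite /patch (indicE _ D1); case: (x \in D1); rewrite ?mul1r ?mul0r ?mulr0.
  rewrite /Rintegral fineK//; apply: integrable_fin_num => //.
  apply: bm_integrable => //; apply: bmM; [exact: bm_cst|exact: bm_pair2].
have intf : (m1 \x m2)%E.-integrable setT (EFin \o f).
  apply/integrable12ltyP; first by apply/measurable_EFinP; case: bf.
  have bnF := bm_norm bF.
  have [_ [M FM]] := bF.
  have -> : (\int[m1]_x \int[m2]_y `|(EFin \o f) (x, y)| =
             \int[m1]_x (\1_D1 x * \int[m2]_(y in D2) `|F (x, y)|)%:E)%E.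
    apply: eq_integral => x _; rewrite -(E1 (fun p => `|F p|) x bnF); apply: eq_integral => y _.
    by rewrite /f /= !normrM !indicE; case: (x \in D1); case: (y \in D2); rewrite /= ?normr0 ?normr1.
  apply: (@le_lt_trans _ _ (\int[m1]_x (\1_D1 x * (M * fine (m2 D2)))%:E)%E).
    apply: ge0_le_integral => //=.
    - by move=> x _; rewrite lee_fin mulr_ge0// Rintegral_ge0.
    - have -> : (fun x => (\1_D1 x * \int[m2]_(y in D2) `|F (x, y)|)%:E) =
        (fun x => \int[m2]_y (\1_D1 x * (\1_D2 y * `|F (x, y)|))%:E)%E.
        by apply/funext => x; rewrite (E1 (fun p => `|F p|) x bnF).
      apply: (@measurable_fun_fubini_tonelli_F _ _ T1 T2 R m2
        (fun p => (\1_D1 p.1 * (\1_D2 p.2 * `|F p|))%:E)).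
        apply/measurable_EFinP; apply: measurable_funM.
          by have [] := bm_fst (bm_indic R mD1).
        apply: measurable_funM; first by have [] := bm_snd (bm_indic R mD2).
        by case: bnF.
      by move=> p; rewrite lee_fin !mulr_ge0.
    - apply/measurable_EFinP; apply: measurable_funM.
        exact: measurable_indic.
      exact: measurable_cst.
    - move=> x _; rewrite lee_fin ler_wpM2l//.
      have := @bm_normr_Rintegral_le _ _ _ m2 D2 mD2 fD2 (fun y => `|F (x, y)|) M.
      move=> /(_ (bm_pair1 x bnF)) H; apply: le_trans (ler_norm _) _; apply: H.
      by move=> y _; rewrite normr_id.
  have -> : (\int[m1]_x (\1_D1 x * (M * fine (m2 D2)))%:E =
      \int[m1]_(x in D1) (M * fine (m2 D2))%:E)%E.
    rewrite [RHS]integral_mkcond; apply: eq_integral => x _.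
    by rewrite /patch indicE; case: (x \in D1); rewrite ?mul1r ?mul0r.
  exact: (integrable_lty mD1 (bm_integrable mD1 fD1 (bm_cst _ _))).
have := Fubini intf.
have -> : (\int[m1]_x \int[m2]_y (EFin \o f) (x, y) =
    \int[m1]_x (\1_D1 x * \int[m2]_(y in D2) F (x, y))%:E)%E.
  by apply: eq_integral => x _; rewrite -(E1 F x bF).
have -> : (\int[m2]_y \int[m1]_x (EFin \o f) (x, y) =
    \int[m2]_y (\1_D2 y * \int[m1]_(x in D1) F (x, y))%:E)%E.
  by apply: eq_integral => y _; rewrite -(E2 F y bF).
by move=> /(congr1 fine) H; rewrite -[LHS]Rintegral_indicM -[RHS]Rintegral_indicM.
Qed.

Lemma bm_measurable_Rintegral (F : T1 * T2 -> R) : bounded_measurable F ->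
  measurable_fun [set: T1] (fun x => \int[m2]_(y in D2) F (x, y)).
Proof.
move=> bF; have [mF [M FM]] := bF.
(* Tonelli's measurability statement asks for a nonnegative integrand, so [F] is shifted by a
   constant whose integral is subtracted at the end. *)
pose G p := \1_D2 p.2 * (F p + `|M|).
have bFM : bounded_measurable (fun p => F p + `|M|) by apply: bmD => //; exact: bm_cst.
have G0 p : 0 <= F p + `|M|.
  have := FM p; rewrite ler_norml => /andP[h _].
  by have := ler_norm M; lra.
have bG : bounded_measurable G.
  by apply: bmM => //; apply: bm_snd; exact: bm_indic.
have mG : measurable_fun [set: T1] (fun x => \int[m2]_y (G (x, y))%:E)%E.
  apply: (@measurable_fun_fubini_tonelli_F _ _ T1 T2 R m2 (EFin \o G)).
    by apply/measurable_EFinP; case: bG.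
  by move=> p; rewrite lee_fin mulr_ge0.
have -> : (fun x => \int[m2]_(y in D2) F (x, y)) =
    (fun x => fine (\int[m2]_y (G (x, y))%:E)%E - `|M| * fine (m2 D2)).
  apply/funext => x.
  have -> : fine (\int[m2]_y (G (x, y))%:E)%E = \int[m2]_(y in D2) (F (x, y) + `|M|).
    by rewrite -[RHS]Rintegral_indicM.
  rewrite bm_RintegralD//; [|exact: bm_pair1|exact: bm_cst].
  by rewrite Rintegral_cst// addrK.
by apply: measurable_funB => //; apply: measurableT_comp.
Qed.

End bounded_fubini.

Section approximation.
Context (R : realType) (d : nat).
Local Notation V := 'rV[R]_d.+1.
Local Notation lebV := (lebT R d).

(** Since [step] vanishes at 0, the first factor is 0 on the lower face and the second is 1 on the
    upper one: for each point the value is that of the half-open box once [m] is large. *)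
Definition smooth_box (m : nat) (a b x : V) : R :=
  \prod_i (step (m%:R * x 0 i + (- (m%:R * a 0 i))) *
           (1 - step (m%:R * x 0 i + (- (m%:R * b 0 i))))).

Lemma smooth_box_C1 m a b : C1 (smooth_box m a b).
Proof.
apply: C1_prod => i _; apply: C1M; first exact: C1_step_coord.
by apply: C1B; [exact: C1_cst|exact: C1_step_coord].
Qed.

Lemma smooth_box_01 m a b x : 0 <= smooth_box m a b x <= 1.
Proof.
apply/andP; split.
  by apply: prodr_ge0 => i _; rewrite mulr_ge0 ?step_ge0// subr_ge0 step_le1.
apply: prodr_ile1 => i _; rewrite mulr_ge0 ?step_ge0 ?subr_ge0 ?step_le1//=.
by rewrite mulr_ile1 ?step_ge0 ?step_le1 ?subr_ge0 ?step_le1// lerBlDr lerDl step_ge0.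
Qed.

Lemma step_shift_cvg (t c : R) :
  \forall m \near \oo, step (m%:R * t + (- (m%:R * c))) = (c < t)%R%:R.
Proof.
have [tc|ct] := leP t c.
  apply: nearW => m; apply: step_le0; rewrite -mulrBr.
  by rewrite mulr_ge0_le0// subr_le0.
have tc0 : 0 < (t - c)^-1 by rewrite invr_gt0 subr_gt0.
near=> m; apply: step_ge1; rewrite -mulrBr -ler_pdivrMr ?subr_gt0// mul1r.
near: m; exact: nbhs_infty_ger.
Unshelve. all: by end_near. Qed.

Lemma smooth_box_cvg a b x :
  \forall m \near \oo, smooth_box m a b x = \1_(box a b) x.
Proof.
have : \forall m \near \oo, forall i : 'I_d.+1,
    step (m%:R * x 0 i + (- (m%:R * a 0 i))) = (a 0%R i < x 0%R i)%R%:R /\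
    step (m%:R * x 0 i + (- (m%:R * b 0 i))) = (b 0%R i < x 0%R i)%R%:R.
  by apply: filter_forall => i; apply: filterI; exact: step_shift_cvg.
apply: filterS => m H; rewrite /smooth_box indicE.
rewrite (eq_bigr (fun i => (a 0%R i < x 0%R i <= b 0%R i)%R%:R)); last first.
  move=> i _; case: (H i) => -> ->; rewrite leNgt.
  by case: (a 0 i < x 0 i); case: (b 0 i < x 0 i); rewrite /= ?subrr ?subr0 ?mulr0 ?mulr1 ?mul0r.
have [bx|bx] := boolP (x \in box a b).
  by apply: big1 => i _; move: bx; rewrite inE => /(_ i) ->.
have [i ni] : exists i, ~~ (a 0 i < x 0 i <= b 0 i).
  apply: contrapT => H'; move/negP: bx; apply; rewrite inE => i.
  by apply: contrapT => /negP ni; apply: H'; exists i.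
by rewrite (bigD1 i)//= (negbTE ni) mul0r.
Qed.

(** A nearly optimal cover in the infimum that defines the outer measure has a union [W] exceeding
    [Z] by at most [e]; the finite subunions lie in [W] and exhaust [Z]. *)
Lemma finite_union_approx (Z : set V) (e : R) : measurable (Z : set lebV) ->
  (leb Z < +oo)%E -> 0 < e ->
  exists (ab : (V * V)^nat) (N : nat),
    let U := \big[setU/set0]_(n < N) box (ab n).1 (ab n).2 in
    (leb (U `\` Z) <= e%:E)%E /\ (leb (Z `\` U) <= e%:E)%E.
Proof.
move=> mZ fZ e0.
have fZ' : leb_outer Z \is a fin_num by rewrite ge0_fin_numE ?leb_outer_ge0.
have [_ [ab Zab <-] lt] := lb_ereal_inf_adherent e0 fZ'.
pose B n : set V := box (ab n).1 (ab n).2.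
have mB n : measurable (B n : set lebV) by exact: box_measurable.
pose W := \bigcup_n B n.
have mW : measurable (W : set lebV) by exact: bigcupT_measurable.
have WZ : (leb (W `\` Z) <= e%:E)%E.
  have : (leb W <= leb Z + e%:E)%E.
    apply: le_trans (ltW lt); apply: le_trans (outer_measure_sigma_subadditive (lebesgue_outer R d) B) _.
    by apply: lee_nneseries => [n _ _|n _]; [exact: leb_outer_ge0|exact: leb_box_le].
  have -> : leb W = (leb (W `\` Z) + leb Z)%E.
    have WZE : W `&` Z = Z by exact/setIidr.
    by have := measureDI leb mW mZ; rewrite WZE.
  by rewrite addeC leeD2lE.
pose U N := \big[setU/set0]_(n < N) B n.
have mU N : measurable (U N : set lebV) by exact: bigsetU_measurable.
have cU : leb (Z `\` U N) @[N --> \oo] --> 0%E.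
  have -> : 0%E = leb (\bigcap_N (Z `\` U N)).
    rewrite (_ : \bigcap_N _ = set0) ?measure0//.
    rewrite -subset0 => x H; have [Zx _] := H 0 I.
    have [n _ Bx] := Zab _ Zx.
    have [_] := H n.+1 I; apply; rewrite /U big_ord_recr/=; right; exact: Bx.
  apply: nonincreasing_cvg_mu => //.
  - by apply: le_lt_trans fZ; apply: le_measure; rewrite ?inE//; exact: measurableD.
  - by move=> i; exact: measurableD.
  - by apply: bigcapT_measurable => i; exact: measurableD.
  - apply/nonincreasing_seqP => n; apply/subsetPset; apply: setDS.
    by rewrite /U big_ord_recr/=; exact: subsetUl.
have [N UN] : exists N, (leb (Z `\` U N) <= e%:E)%E.
  have [fin /cvgr0_norm_le/(_ _ e0) le] := (fine_cvgP _ _).1 cU.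
  have [N [/= finN leN]] := filter_ex (filterI fin le); exists N.
  by rewrite -(fineK finN) lee_fin (le_trans (ler_norm _)).
have UW : U N `<=` W.
  by rewrite /U -bigcup_mkord => x [n _ Bx]; exists n.
exists ab, N; split; last exact: UN.
by apply: le_trans WZ; apply: le_leb_outer; exact: setSD UW.
Qed.

Context (Omega : set V) (mOmega : measurable (Omega : set lebV))
  (fOmega : (leb Omega < +oo)%E).

Lemma sub_lty (A : set V) : A `<=` Omega -> (leb A < +oo)%E.
Proof. by move=> AO; apply: le_lt_trans fOmega; exact: le_leb_outer. Qed.

Lemma C1_indic_approx (Z : set V) (e : R) : measurable (Z : set lebV) ->
  Z `<=` Omega -> 0 < e ->
  exists g : V -> R, [/\ C1 g, forall x, 0 <= g x <= 1 &
    \int[leb]_(x in Omega) `|g x - \1_Z x| <= e].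
Proof.
move=> mZ ZO e0.
have e3 : 0 < e / 3 by rewrite divr_gt0.
have [ab [N /= []]] := finite_union_approx mZ (sub_lty ZO) e3.
set U := \big[setU/set0]_(n < N) _ => UZ ZU.
have mU : measurable (U : set lebV).
  by apply: bigsetU_measurable => n _; exact: box_measurable.
have UE : U = \bigcup_(n in `I_N) box (ab n).1 (ab n).2 by rewrite bigcup_mkord.
(* The product of complements is the smooth counterpart of a union and keeps the values in [0,1]. Of
   the three thirds of [e], one is spent on the distance to [\1_U] and two on the symmetric
   difference of [U] and [Z]. *)
pose g m x : R := 1 - \prod_(n < N) (1 - smooth_box m (ab n).1 (ab n).2 x).
have Cg m : C1 (g m).
  apply: C1B; first exact: C1_cst.
  by apply: C1_prod => n _; apply: C1B; [exact: C1_cst|exact: smooth_box_C1].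
have sb m n x : 0 <= 1 - smooth_box m (ab n).1 (ab n).2 x <= 1.
  by have /andP[? ?] := smooth_box_01 m (ab n).1 (ab n).2 x; apply/andP; split; lra.
have g01 m x : 0 <= g m x <= 1.
  apply/andP; split.
    by rewrite subr_ge0 prodr_ile1// => n _; exact: sb.
  by rewrite lerBlDr lerDl prodr_ge0// => n _; case/andP: (sb m n x).
have gU x : \forall m \near \oo, g m x = \1_U x.
  have : \forall m \near \oo, forall n : 'I_N,
      smooth_box m (ab n).1 (ab n).2 x = \1_(box (ab n).1 (ab n).2) x.
    by apply: filter_forall => n; exact: smooth_box_cvg.
  apply: filterS => m H; rewrite /g.
  rewrite (eq_bigr (fun n : 'I_N => 1 - \1_(box (ab n).1 (ab n).2) x)); last first.
    by move=> n _; rewrite H.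
  have [xU|xU] := pselect (U x).
    rewrite [RHS]indicE mem_set//=; move: xU; rewrite UE => -[n /= nN bx].
    by rewrite (bigD1 (Ordinal nN))//= indicE mem_set//= subrr mul0r subr0.
  rewrite [RHS]indicE memNset//=; rewrite big1 ?subrr// => n _.
  rewrite indicE memNset ?subr0// => bx; apply: xU.
  by rewrite UE; exists n => //=.
have mg m : measurable_fun [set: lebV] (g m).
  by apply: continuous_lebesgue_measurable; exact: C1_continuous.
have bmg m : bounded_measurable (g m : lebV -> R).
  split => //; exists 1 => x; have /andP[? ?] := g01 m x.
  by rewrite ger0_norm.
have bU : bounded_measurable (\1_U : lebV -> R) by exact: bm_indic.
have bZ : bounded_measurable (\1_Z : lebV -> R) by exact: bm_indic.
have cg : \int[leb]_(x in Omega) `|g m x - \1_U x| @[m --> \oo] --> \int[leb]_(x in Omega) (0 : R).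
  apply: (@bm_dominated_cvg _ lebV R leb Omega mOmega fOmega
    (fun m x => `|g m x - \1_U x|) (fun=> 0) 1).
  - by move=> m; case: (bm_norm (bmB (bmg m) bU)).
  - exact: measurable_cst.
  - move=> m x; rewrite normr_id; have /andP[? ?] := g01 m x.
    rewrite indicE; case: (x \in U) => /=; rewrite ler_norml; apply/andP; split; lra.
  - move=> x _; apply: cvg_near_cst; apply: filterS (gU x) => m ->.
    by rewrite subrr normr0.
rewrite Rintegral_cst// mul0r in cg.
have [m gm] : exists m, \int[leb]_(x in Omega) `|g m x - \1_U x| <= e / 3.
  have /cvgr0_norm_le/(_ _ e3)/filter_ex[m h] := cg.
  by exists m; exact: le_trans (ler_norm _) h.
have UZd : \int[leb]_(x in Omega) `|\1_U x - \1_Z x| <= e / 3 + e / 3.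
  have H (A B : set V) : measurable (A : set lebV) -> measurable (B : set lebV) ->
      (leb (A `\` B) <= (e / 3)%:E)%E ->
      \int[leb]_(x in Omega) \1_(A `\` B) x <= e / 3.
    move=> mA mB AB; rewrite /Rintegral integral_indic//; last exact: measurableD.
    rewrite -lee_fin fineK; last first.
      rewrite ge0_fin_numE//; apply: sub_lty; exact: subIsetr.
    by apply: le_trans AB; apply: le_leb_outer; exact: subIsetl.
  have := lerD (H _ _ mU mZ UZ) (H _ _ mZ mU ZU).
  have b1 : bounded_measurable (\1_(U `\` Z) : lebV -> R) by apply: bm_indic; exact: measurableD.
  have b2 : bounded_measurable (\1_(Z `\` U) : lebV -> R) by apply: bm_indic; exact: measurableD.
  rewrite -(bm_RintegralD mOmega fOmega b1 b2); apply: le_trans.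
  apply: (bm_le_Rintegral mOmega fOmega (bm_norm (bmB bU bZ)) (bmD b1 b2)) => x _.
  rewrite !indicE !in_setD.
  by case: (x \in U); case: (x \in Z); rewrite /= ?subrr ?normr0 ?subr0 ?sub0r ?normrN ?normr1 ?addr0 ?add0r.
exists (g m); split => //.
apply: (@le_trans _ _ (\int[leb]_(x in Omega) (`|g m x - \1_U x| + `|\1_U x - \1_Z x|))).
  apply: (bm_le_Rintegral mOmega fOmega (bm_norm (bmB (bmg m) bZ))
    (bmD (bm_norm (bmB (bmg m) bU)) (bm_norm (bmB bU bZ)))) => x _.
  by rewrite -(subrKA (\1_U x)); exact: ler_normD.
rewrite (bm_RintegralD mOmega fOmega (bm_norm (bmB (bmg m) bU)) (bm_norm (bmB bU bZ))).
by apply: le_trans (lerD gm UZd) _; lra.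
Qed.

End approximation.

(** * Differentiation under the integral sign *)

Section parametric_integrals.
Context (R : realType) (d : nat).
Local Notation V := 'rV[R]_d.+1.
Local Notation lebV := (lebT R d).
Local Notation e_ i := (basis_vector R i).
Context (Z : set V) (mZ : measurable (Z : set lebV)) (fZ : (leb Z < +oo)%E).
Context (s : V -> V) (cs : continuous s).

Lemma shifted_bm g x : continuous g -> bounded_support g ->
  bounded_measurable (fun y : lebV => g (x + s y)).
Proof.
move=> cg sg; split; last first.
  by have [M gM] := bounded_support_bounded cg sg; exists M.
apply: (@continuous_lebesgue_measurable R d (fun y => g (x + s y))) => y.
apply: continuous_comp; last exact: cg.
apply: (@continuousD _ _ _ (cst x) s); [exact: cst_continuous|exact: cs].
Qed.

Lemma basis_vector_norm i (c : R) : `|c *: e_ i : V| <= `|c|.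
Proof.
apply/row_norm_leP => // j; rewrite !mxE eqxx/= normrM ler_piMr//.
by case: (j == i); rewrite ?normr1 ?normr0.
Qed.

(** By the mean value theorem the difference quotient is the derivative at a point at most [|h|]
    away, and uniform continuity makes it converge uniformly in [y]. The map [s] will be the
    identity for translated test functions and the reflection for averages of sets. *)
Lemma C1_param g : C1 g -> bounded_support g ->
  (forall i, bounded_support ('D_(e_ i) g)) ->
  let H x := \int[leb]_(y in Z) g (x + s y) in
  (forall i x, is_derive x (e_ i) H (\int[leb]_(y in Z) 'D_(e_ i) g (x + s y))) /\
  C1 H.
Proof.
move=> Cg sg sDg H.
have cg := C1_continuous Cg; have [dg cDg] := Cg.
pose m := fine (leb Z).
have m0 : 0 <= m by rewrite fine_ge0.
have bDg i x : bounded_measurable (fun y : lebV => 'D_(e_ i) g (x + s y)).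
  exact: (shifted_bm x (cDg i) (sDg i)).
have bg x : bounded_measurable (fun y : lebV => g (x + s y)) by exact: (shifted_bm x cg sg).
have osc i e : 0 < e -> exists2 r : R, 0 < r &
    forall x y, `|x - y| < r -> `|'D_(e_ i) g x - 'D_(e_ i) g y| * m <= e.
  move=> e0; have em : 0 < e / (m + 1) by rewrite divr_gt0// ltr_wpDl.
  have := bounded_support_unif_cont (cDg i) (sDg i) em.
  move=> /(filterI (nbhs_right_gt (0 : R)))/filter_ex[r [/= r0 h]].
  exists r => // x y xy; apply: (@le_trans _ _ (e / (m + 1) * m)).
    by rewrite ler_wpM2r// h.
  by rewrite mulrAC ler_pdivrMr ?ltr_wpDl// ler_pM2l// lerDl.
(* Phrased with a product instead of the bound [e / m], so that null sets [Z] are included. *)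
have mle (f : V -> R) e : bounded_measurable (f : lebV -> R) ->
    (forall y, `|f y| * m <= e) -> `|\int[leb]_(y in Z) f y| <= e.
  move=> bf fe; have [m00|m00] := eqVneq m 0.
    have [M fM] : exists M, forall y, Z y -> `|f y| <= M by case: bf => _ [M fM]; exists M.
    have := bm_normr_Rintegral_le mZ fZ bf fM.
    rewrite -/m m00 mulr0 => /le_trans; apply.
    by have := fe 0; rewrite m00 mulr0.
  have mp : 0 < m by rewrite lt0r m00.
  have := bm_normr_Rintegral_le mZ fZ bf (M := e / m) _.
  rewrite -/m divfK//; apply => y _; by rewrite ler_pdivlMr.
have D i x : is_derive x (e_ i) H (\int[leb]_(y in Z) 'D_(e_ i) g (x + s y)).
  have cv : (fun h : R => h^-1 *: ((H \o shift x) (h *: e_ i) - H x)) @ 0^' -->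
      \int[leb]_(y in Z) 'D_(e_ i) g (x + s y).
    apply/cvgrPdist_le => e e0; have [r r0 rD] := osc i e e0.
    near=> h.
    have hr : `|h| < r by near: h; exact: dnbhs0_lt.
    have h0 : h != 0 by near: h; exact: nbhs_dnbhs_neq.
    rewrite /H /= -(bm_RintegralB mZ fZ (bg _) (bg _)).
    rewrite [h^-1 *: _](_ : _ = \int[leb]_(y in Z)
      (h^-1 * (g (h *: e_ i + x + s y) - g (x + s y)))); last first.
      by rewrite (bm_RintegralZ mZ fZ _ (bmB (bg _) (bg _))).
    rewrite -(bm_RintegralB mZ fZ (bDg _ _) (bmM (bm_cst _ _) (bmB (bg _) (bg _)))).
    apply: mle.
      exact: (bmB (bDg _ _) (bmM (bm_cst _ _) (bmB (bg _) (bg _)))).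
    move=> y /=.
    have [c ch E] := @MVT_line R d g (x + s y) (e_ i) h (fun _ => dg _ _).
    rewrite (_ : h *: e_ i + x + s y = x + s y + h *: e_ i); last by rewrite -addrA addrC.
    rewrite E mulKf//; apply: rD.
    rewrite opprD addrA subrr sub0r normrN.
    exact: le_lt_trans (le_trans (basis_vector_norm i c) ch) hr.
  split; last exact: cvg_lim cv.
  by apply/cvg_ex; eexists; exact: cv.
split; first exact: D.
split=> [i x|i]; first by case: (D i x).
have -> : 'D_(e_ i) H = fun x => \int[leb]_(y in Z) 'D_(e_ i) g (x + s y).
  by apply/funext => x; case: (D i x).
apply: row_continuousP => x e e0; have [r r0 rD] := osc i e e0.
exists r => // x' xx'; rewrite -(bm_RintegralB mZ fZ (bDg _ _) (bDg _ _)).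
apply: mle; first exact: (bmB (bDg _ _) (bDg _ _)).
move=> y /=; apply: rD.
by rewrite opprD addrACA subrr addr0.
Unshelve. all: by end_near. Qed.

End parametric_integrals.

(** * Perimeter *)

Section perimeter_basics.
Context (R : realType) (d : nat) (Omega : set 'rV[R]_d.+1).
Local Notation V := 'rV[R]_d.+1.
Local Notation lebV := (lebT R d).
Local Notation e_ i := (basis_vector R i).
Hypotheses (oOmega : open Omega) (bOmega : bounded_set Omega).

Lemma domain_measurable : measurable (Omega : set lebV).
Proof. exact: lebesgue_open_measurable. Qed.
Let mOmega := domain_measurable.

Lemma domain_lty : (leb Omega < +oo)%E.
Proof. exact: leb_bounded_lty. Qed.
Let fOmega := domain_lty.

Lemma lebesgue_subset_lty Z : lebesgue_subset Omega Z -> (leb Z < +oo)%E.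
Proof. by move=> [_ ZO]; exact: sub_lty fOmega _ ZO. Qed.

Lemma lebesgue_subset_bm Z : lebesgue_subset Omega Z ->
  bounded_measurable (\1_Z : lebV -> R).
Proof. by move=> [mZ _]; exact: bm_indic. Qed.

Lemma Rintegral_domain (f : V -> R) : (forall x, ~ Omega x -> f x = 0) ->
  \int[leb]_(x in Omega) f x = \int[leb]_x f x.
Proof.
move=> f0; rewrite [LHS]Rintegral_mkcond; apply: eq_Rintegral => x _.
rewrite /patch; case: ifPn => // xO.
by rewrite f0// => Ox; rewrite mem_set in xO.
Qed.

Lemma Rintegral_subset (Z : set V) (f : V -> R) : Z `<=` Omega ->
  \int[leb]_(x in Omega) (\1_Z x * f x) = \int[leb]_(x in Z) f x.
Proof.
move=> ZO; rewrite Rintegral_domain ?Rintegral_indicM// => x Ox.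
by rewrite indicE memNset ?mul0r// => /ZO.
Qed.

Definition test_field (phi : V -> V) :=
  (forall i, C1c Omega (fun x => phi x 0 i)) /\ (forall x, enorm (phi x) <= 1).

Lemma C0_sum (I : Type) (r : seq I) (F : I -> V -> R) :
  (forall i, C0 Omega (F i)) -> C0 Omega (fun x => \sum_(i <- r) F i x).
Proof.
move=> CF; elim: r => [|i r [IHc IH0]].
  have -> : (fun x => \sum_(i <- [::]) F i x) = cst 0.
    by apply/funext => x; rewrite big_nil.
  by split => //; exact: cst_continuous.
have -> : (fun x => \sum_(j <- i :: r) F j x) =
    (fun x => F i x + \sum_(j <- r) F j x).
  by apply/funext => x; rewrite big_cons.
have [ci i0] := CF i; split; first exact: row_continuousD.
by move=> x Ox; rewrite i0// IH0// addr0.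
Qed.

Lemma divergence_C0 (phi : V -> V) : (forall i, C1c Omega (fun x => phi x 0 i)) ->
  C0 Omega (divergence phi).
Proof. by move=> Cphi; apply: C0_sum => i; exact: C1c_C0_derive. Qed.

Lemma divergence_bm (phi : V -> V) : (forall i, C1c Omega (fun x => phi x 0 i)) ->
  bounded_measurable (divergence phi : lebV -> R).
Proof. by move=> /divergence_C0; exact: C0_bm. Qed.

Lemma integral_test Z phi : lebesgue_subset Omega Z -> test_field phi ->
  (\int[leb]_(x in Omega) (\1_Z x * divergence phi x)%:E)%E =
  (\int[leb]_(x in Z) divergence phi x)%:E.
Proof.
move=> sZ [Cphi _]; have [mZ ZO] := sZ.
rewrite -(Rintegral_subset _ ZO) /Rintegral fineK//.
apply: integrable_fin_num => //.
exact: (bm_integrable mOmega fOmega (bmM (lebesgue_subset_bm sZ) (divergence_bm Cphi))).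
Qed.

(** The form in which the supremum is used: real inequalities for one test field at a time, each of
    which passes to L1 limits. *)
Lemma perimeter_leP Z M : lebesgue_subset Omega Z ->
  (perimeter Omega Z <= M%:E)%E <->
  (forall phi, test_field phi -> \int[leb]_(x in Z) divergence phi x <= M).
Proof.
move=> sZ; split=> [PM phi tphi|H].
  rewrite -lee_fin -integral_test//; apply: le_trans PM.
  by apply: ereal_sup_ubound; exists phi.
apply: ge_ereal_sup => _ [phi tphi <-].
by rewrite (integral_test sZ tphi) lee_fin; exact: H.
Qed.

Lemma test_field0 : test_field (fun=> 0 : V).
Proof.
split=> [i|x].
  by have -> : (fun x : V => (0 : V) 0 i) = (fun=> 0 : R);
    [apply/funext => x; rewrite mxE|exact: C1c0].
by rewrite /enorm big1 ?sqrtr0// => i _; rewrite mxE expr0n.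
Qed.

Lemma divergence0 x : divergence (fun=> 0 : V) x = 0 :> R.
Proof.
apply: big1 => i _; have -> : (fun x : V => (0 : V) 0 i) = (fun=> 0 : R).
  by apply/funext => y; rewrite mxE.
exact: derive_cst.
Qed.

Lemma perimeter_ge0 Z : (0 <= perimeter Omega Z)%E.
Proof.
apply: ereal_sup_ubound; exists (fun=> 0); first exact: test_field0.
rewrite integral0_eq// => x _; by rewrite divergence0 mulr0.
Qed.

Lemma coord_field_test g i : C1c Omega g -> (forall x, `|g x| <= 1) ->
  test_field (fun y => g y *: e_ i) /\
  divergence (fun y => g y *: e_ i) = 'D_(e_ i) g.
Proof.
move=> Cg g1.
have E (j : 'I_d.+1) : (fun x => (g x *: e_ i) 0 j) = (fun x => g x * (j == i)%:R).
  by apply/funext => x; rewrite !mxE eqxx.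
split; last first.
  apply/funext => x; rewrite /divergence (bigD1 i)//= big1 ?addr0.
    by rewrite E eqxx; under eq_fun do rewrite mulr1.
  move=> j /negbTE ji; rewrite E ji.
  have -> : (fun x => g x * false%:R) = cst 0 by apply/funext => y; rewrite mulr0.
  exact: derive_cst.
split=> [j|x].
  by rewrite E; apply: C1cM => //; exact: C1_cst.
rewrite /enorm (bigD1 i)//= big1 ?addr0.
  by rewrite !mxE !eqxx mulr1 sqrtr_sqr.
by move=> j /negbTE ji; rewrite !mxE eqxx ji mulr0 expr0n.
Qed.

(** The fields [g] and [- g] in direction [i] bound the integral from both sides. *)
Lemma perimeter_derive Z P g i : lebesgue_subset Omega Z ->
  (perimeter Omega Z <= P%:E)%E -> C1c Omega g -> (forall x, `|g x| <= 1) ->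
  `|\int[leb]_(x in Z) 'D_(e_ i) g x| <= P.
Proof.
move=> sZ PZ Cg g1; have [mZ ZO] := sZ; have fZ := lebesgue_subset_lty sZ.
have bD := C1c_derive_bm bOmega i Cg.
have H := (perimeter_leP P sZ).1 PZ.
have [t1 d1] := coord_field_test i Cg g1.
have Ng1 x : `|- g x| <= 1 by rewrite normrN.
have [t2 d2] := coord_field_test i (C1cN Cg) Ng1.
have := H _ t1; rewrite d1 => h1.
have := H _ t2; rewrite d2.
rewrite (_ : \int[leb]_(x in Z) _ = - \int[leb]_(x in Z) 'D_(e_ i) g x); last first.
  rewrite -(bm_RintegralN mZ fZ bD); apply: eq_Rintegral => x _.
  exact: (derive_opp i x (C1c_C1 Cg)).
by move=> h2; rewrite ler_norml h1 andbT lerNl.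
Qed.

(** For small [x] the integral of [psi (x + y)] over [y] in [Omega] equals that of [psi], by
    translation invariance and the margin of the support. Its derivative at [x = 0], taken under the
    integral sign, is therefore 0. *)
Lemma integral_derive0 psi i : C1c Omega psi ->
  \int[leb]_(x in Omega) 'D_(e_ i) psi x = 0.
Proof.
move=> Cpsi.
have sD j : bounded_support ('D_(e_ j) psi).
  exact/(C0_bounded_support bOmega)/C1c_C0_derive.
have [D _] := @C1_param R d Omega mOmega fOmega id (fun x => @cvg_id _ (nbhs x)) psi
  (C1c_C1 Cpsi) (C1c_bounded_support Cpsi) sD.
have [r r0 tr] := C1c_translate oOmega Cpsi.
have [_] := D i 0.
rewrite (_ : 'D_(e_ i) _ 0 = 0).
  by move=> ->; apply: eq_Rintegral => x _; rewrite add0r.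
transitivity ('D_(e_ i) (cst (\int[leb]_x psi x) : V -> R) 0); last exact: derive_cst.
apply: near_eq_derive; apply/(@nbhs_normP R _ (0 : V)); exists r => // x /=.
rewrite sub0r normrN => xr.
have intpsi : leb.-integrable [set: lebV] (EFin \o psi).
  rewrite (_ : EFin \o psi = (EFin \o psi) \_ Omega); last first.
    apply/funext => y; rewrite /patch; case: ifPn => // yO /=.
    by rewrite (C1c_out Cpsi)// => Oy; rewrite mem_set in yO.
  apply/(integrable_mkcond _ mOmega).
  exact: (bm_integrable mOmega fOmega (C1c_bm bOmega Cpsi)).
rewrite -(Rintegral_translate x intpsi) -Rintegral_domain.
  by apply: eq_Rintegral => y _; rewrite /translate addrC.
by move=> y Oy; exact: (C1c_out (tr x (ltW xr)) Oy).
Qed.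

(** The gradient in [z] of the translated integral is an integral of derivatives of a translated
    test function, which is again admissible; hence each component is at most [P], and
    [C1_increment_le] concludes. *)
Lemma perimeter_translate Z P g r z : lebesgue_subset Omega Z ->
  (perimeter Omega Z <= P%:E)%E -> C1c Omega g -> (forall x, `|g x| <= 1) ->
  (forall w, `|w| <= r -> C1c Omega (g \o translate w)) -> `|z| <= r ->
  `|\int[leb]_(y in Z) g (y + z) - \int[leb]_(y in Z) g y| <= P * d.+1%:R * `|z|.
Proof.
move=> sZ PZ Cg g1 tr zr; have [mZ ZO] := sZ; have fZ := lebesgue_subset_lty sZ.
have sD j : bounded_support ('D_(e_ j) g).
  exact/(C0_bounded_support bOmega)/C1c_C0_derive.
have [D _] := @C1_param R d Z mZ fZ id (fun x => @cvg_id _ (nbhs x)) g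
  (C1c_C1 Cg) (C1c_bounded_support Cg) sD.
have HE x : \int[leb]_(y in Z) g (y + x) = \int[leb]_(y in Z) g (x + id y).
  by apply: eq_Rintegral => y _; rewrite addrC.
have -> : \int[leb]_(y in Z) g y = \int[leb]_(y in Z) g (0 + id y).
  by apply: eq_Rintegral => y _; rewrite add0r.
rewrite HE -[in leRHS](subr0 z).
apply: (@C1_increment_le R d (fun x => \int[leb]_(y in Z) g (x + id y))).
  by move=> i x; case: (D i x).
move=> i w; rewrite !subr0 => wz.
case: (D i w) => _ ->.
have -> : \int[leb]_(y in Z) 'D_(e_ i) g (w + id y) =
    \int[leb]_(y in Z) 'D_(e_ i) (g \o translate w) y.
  apply: eq_Rintegral => y _ /=.
  by rewrite [RHS](congr1 (@^~ y) (derive_translate g w (e_ i))) /= /translate addrC.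
by apply: perimeter_derive PZ _ _ => //; [apply: tr; exact: le_trans wz zr|move=> x; exact: g1].
Qed.

End perimeter_basics.

(** * Averages of sets of finite perimeter *)

Section kernel.
Context (R : realType) (d : nat).
Local Notation V := 'rV[R]_d.+1.
Local Notation lebV := (lebT R d).

(** This symmetry makes [hat] even, hence the averaging kernel invariant under reflection. *)
Lemma step_sym (t : R) : step (1 - t) = 1 - step t.
Proof.
have mid1 (s : R) : 0 <= s -> s <= 2^-1 -> step s = 2 * s ^+ 2.
  move=> s0 s1; rewrite /step /ramp.
  rewrite (_ : Num.max 0 (s + 0) = s); last by rewrite addr0 max_r.
  rewrite (_ : Num.max 0 (s + (- 2^-1)) = 0); last by rewrite max_l//; lra.
  by rewrite (_ : Num.max 0 (s + (- 1)) = 0) ?max_l//; [ring|lra].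
have mid2 (s : R) : 2^-1 <= s -> s <= 1 -> step s = 1 - 2 * (1 - s) ^+ 2.
  move=> s0 s1; rewrite /step /ramp.
  rewrite (_ : Num.max 0 (s + 0) = s); last by rewrite addr0 max_r//; lra.
  rewrite (_ : Num.max 0 (s + (- 2^-1)) = s - 2^-1); last by rewrite max_r//; lra.
  by rewrite (_ : Num.max 0 (s + (- 1)) = 0) ?max_l//; [field|lra].
have [t0|t0] := leP t 0; first by rewrite (step_le0 t0) step_ge1; lra.
have [t1|t1] := leP 1 t; first by rewrite (step_ge1 t1) step_le0; lra.
have [t2|t2] := leP t 2^-1.
  by rewrite (mid1 t) ?mid2; try lra; ring.
by rewrite (mid2 t) ?mid1; lra.
Qed.

Lemma hatN (t : R) : hat (- t) = hat t.
Proof.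
have := step_sym t; have := step_sym (- t).
rewrite /hat opprK (addrC 1 t) (addrC (- t) 1) => -> ->.
by ring.
Qed.

Lemma hat_bumpN h (x : V) : hat_bump h 0 (- x) = hat_bump h 0 x.
Proof.
by apply: eq_bigr => i _; rewrite !mxE !subr0 mulNr hatN.
Qed.

Lemma hat_continuous : continuous (@hat R).
Proof.
have cs : continuous (@step R).
  move=> t; apply/differentiable_continuous/derivable1_diffP.
  by case: (is_derive_step t).
have cs1 : continuous (fun t : R => step (t + 1)).
  move=> t; apply: (@continuous_comp _ _ _ (fun t : R => t + 1) step); last exact: cs.
  by apply: cvgD; [exact: cvg_id|exact: cvg_cst].
by move=> t; exact: (continuousB (cs1 t) (cs t)).
Qed.

Lemma hat_bump_bounded_support h p : 0 < h -> bounded_support (hat_bump h p : V -> R).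
Proof.
move=> h0; exists (h + `|p|) => x hx; apply: hat_bump_eq0 => //.
rewrite -(lerD2r `|p|); apply: le_trans hx _.
by have := ler_normD (x - p) p; rewrite subrK.
Qed.

Lemma hat_bump_bounded h p : 0 < h -> exists M, forall x : V, `|hat_bump h p x| <= M.
Proof.
move=> h0; apply: bounded_support_bounded; last exact: hat_bump_bounded_support.
exact/C1_continuous/hat_bump_C1.
Qed.

(** Measurability is asked of the coordinates of [X] only, since that is what the product of two
    Lebesgue sigma-algebras gives directly for sums and differences. *)
Lemma coord_prod_measurable dd (T : measurableType dd) (X : T -> V) h (p : V) :
  (forall i, measurable_fun [set: T] (fun t => X t 0 i)) ->
  measurable_fun [set: T] (fun t => hat_bump h p (X t)).
Proof.
move=> mX; rewrite /hat_bump; apply: measurable_prod => i _.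
apply: (@measurableT_comp _ _ _ _ _ _ (@hat R) _ (fun t => (X t 0 i - p 0 i) / h)).
  exact: continuous_measurable_fun hat_continuous.
apply: measurable_funM; last exact: measurable_cst.
by apply: measurable_funB => //; exact: measurable_cst.
Qed.

Lemma coord_prod_bm dd (T : measurableType dd) (X : T -> V) h (p : V) : 0 < h ->
  (forall i, measurable_fun [set: T] (fun t => X t 0 i)) ->
  bounded_measurable (fun t => hat_bump h p (X t)).
Proof.
move=> h0 mX; split; first exact: coord_prod_measurable.
by have [M H] := hat_bump_bounded p h0; exists M.
Qed.

Lemma measurable_pair_coord1 i :
  measurable_fun [set: lebV * lebV] (fun q : lebV * lebV => (q.1 : V) 0 i).
Proof. exact: (measurableT_comp (measurable_coord i) measurable_fst). Qed.

Lemma measurable_pair_coord2 i :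
  measurable_fun [set: lebV * lebV] (fun q : lebV * lebV => (q.2 : V) 0 i).
Proof. exact: (measurableT_comp (measurable_coord i) measurable_snd). Qed.

Lemma bump_sub_bm h (p : V) : 0 < h ->
  bounded_measurable (fun q : lebV * lebV => hat_bump h p ((q.1 : V) - (q.2 : V))).
Proof.
move=> h0; apply: coord_prod_bm => // i.
under eq_fun do rewrite !mxE.
by apply: measurable_funB; [exact: measurable_pair_coord1|exact: measurable_pair_coord2].
Qed.

Lemma bump_add_bm h (p : V) : 0 < h ->
  bounded_measurable (fun q : lebV * lebV => hat_bump h p ((q.2 : V) + (q.1 : V))).
Proof.
move=> h0; apply: coord_prod_bm => // i.
under eq_fun do rewrite !mxE.
by apply: measurable_funD; [exact: measurable_pair_coord2|exact: measurable_pair_coord1].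
Qed.

Definition nball (h : R) : set V := [set z | `|z| < h].

Lemma nball_measurable h : measurable (nball h : set lebV).
Proof.
apply: lebesgue_open_measurable.
rewrite (_ : nball h = (fun x : V => `|x|) @^-1` [set t | t < h])//.
by apply: open_comp; [move=> x _; exact: norm_continuous|exact: open_lt].
Qed.

Lemma nball_lty h : (leb (nball h) < +oo)%E.
Proof.
apply: leb_bounded_lty; exists h; split; first exact: num_real.
by move=> r hr x /= xh; apply: ltW; exact: lt_trans xh hr.
Qed.

End kernel.

Section mollification.
Context (R : realType) (d : nat) (Omega : set 'rV[R]_d.+1).
Local Notation V := 'rV[R]_d.+1.
Local Notation lebV := (lebT R d).
Local Notation e_ i := (basis_vector R i).
Hypotheses (oOmega : open Omega) (bOmega : bounded_set Omega).
Let mOmega := domain_measurable oOmega.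
Let fOmega := domain_lty bOmega.
Implicit Types (Z : set V) (h : R).

Definition mollify h Z x : R := \int[leb]_(y in Z) hat_bump h 0 (x - y).
Definition kernel_mass h : R := \int[leb]_(z in nball h) (hat_bump h (0 : V) z).
(** If the kernel mass were 0 this would be 0 by the convention for division; [kernel_mass0]
    disposes of that case. *)
Definition average h Z x := mollify h Z x / kernel_mass h.

Lemma mollify_C1 h Z : 0 < h -> lebesgue_subset Omega Z -> C1 (mollify h Z).
Proof.
move=> h0 sZ; have [mZ ZO] := sZ; have fZ := lebesgue_subset_lty bOmega sZ.
have sD i : bounded_support ('D_(e_ i) (hat_bump h (0 : V))).
  have C : C1c (nball (2 * h)) (hat_bump h (0 : V)).
    apply: hat_bump_C1c => // y; rewrite subr0 => yh.
    by rewrite /nball /=; lra.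
  have [_ D0] := C1c_C0_derive i C; exists (2 * h) => x xh; apply: D0.
  by rewrite /nball /=; apply/negP; rewrite -leNgt.
have [_] := @C1_param R d Z mZ fZ (fun y => - y) (@opp_continuous V) (hat_bump h 0)
  (@hat_bump_C1 _ _ _ _) (@hat_bump_bounded_support _ _ _ _ h0) sD.
exact.
Qed.

Lemma average_C1 h Z : 0 < h -> lebesgue_subset Omega Z -> C1 (average h Z).
Proof. by move=> h0 sZ; apply: C1M; [exact: mollify_C1|exact: C1_cst]. Qed.

Lemma kernel_mass_ge0 h : 0 <= kernel_mass h.
Proof. by apply: Rintegral_ge0 => x _; exact: hat_bump_ge0. Qed.

Lemma bump_bm h (p : V) : 0 < h -> bounded_measurable (hat_bump h p : lebV -> R).
Proof.
move=> h0; apply: bounded_support_bm; last exact: hat_bump_bounded_support.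
exact/C1_continuous/hat_bump_C1.
Qed.

Lemma bump_patch h (f : V -> R) : 0 < h ->
  (fun x : V => hat_bump h 0 x * f x) =
  (fun x => hat_bump h 0 x * f x) \_ (nball h).
Proof.
move=> h0; apply/funext => x; rewrite /patch; case: ifPn => // xh.
rewrite hat_bump_eq0 ?mul0r// subr0 leNgt; apply/negP => hx.
by rewrite mem_set in xh.
Qed.

Lemma bump_integrable h (f : V -> R) : 0 < h ->
  bounded_measurable (f : lebV -> R) ->
  leb.-integrable [set: lebV] (EFin \o (fun x => hat_bump h 0 x * f x)).
Proof.
move=> h0 bf; rewrite (bump_patch f h0).
have -> : EFin \o ((fun x : V => hat_bump h 0 x * f x) \_ (nball h)) =
    (EFin \o (fun x => hat_bump h 0 x * f x)) \_ (nball h).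
  by apply/funext => x; rewrite /patch /=; case: ifP.
apply/(integrable_mkcond _ (nball_measurable h)).
have bbf : bounded_measurable ((fun x => hat_bump h 0 x * f x) : lebV -> R).
  exact: (bmM (bump_bm 0 h0) bf).
exact: (bm_integrable (nball_measurable h) (nball_lty d h) bbf).
Qed.

Lemma bump_Rintegral h (f : V -> R) : 0 < h ->
  \int[leb]_(x in nball h) (hat_bump h 0 x * f x) =
  \int[leb]_x (hat_bump h 0 x * f x).
Proof. by move=> h0; rewrite [in RHS](bump_patch f h0) -Rintegral_mkcond. Qed.

Lemma mollify_ge0 h Z x : 0 <= mollify h Z x.
Proof. by apply: Rintegral_ge0 => y _; exact: hat_bump_ge0. Qed.

(** After reflection and translation of the kernel both sides integrate the same nonnegative
    function, over [Z] and over the whole space. *)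
Lemma mollify_le h Z x : 0 < h -> lebesgue_subset Omega Z ->
  mollify h Z x <= kernel_mass h.
Proof.
move=> h0 sZ; have [mZ ZO] := sZ.
have b1 : bounded_measurable (cst 1 : lebV -> R) by exact: bm_cst.
have E1 : kernel_mass h = \int[leb]_y (hat_bump h 0 (translate (- x) y) * 1).
  rewrite (@Rintegral_translate R d (- x) (fun y => hat_bump h 0 y * 1)) ?bump_integrable//.
  by rewrite -(bump_Rintegral (cst 1) h0); apply: eq_Rintegral => y _; rewrite mulr1.
have I1 : leb.-integrable [set: lebV]
    (EFin \o (fun y => hat_bump h 0 (translate (- x) y) * 1)).
  exact: (@integrable_translate R d (- x) (fun y => hat_bump h 0 y * 1) (bump_integrable h0 b1)).
have E2 : mollify h Z x = \int[leb]_(y in Z) (hat_bump h 0 (translate (- x) y) * 1).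
  by apply: eq_Rintegral => y _; rewrite mulr1 -hat_bumpN opprB.
rewrite E1 E2 /Rintegral fine_le//.
- apply: (integrable_fin_num mZ); exact: integrableS I1.
- exact: (integrable_fin_num _ I1).
- apply: ge0_subset_integral; [exact: mZ|exact: measurableT|
    exact: (measurable_int _ I1)| |exact: subsetT].
  by move=> y _; rewrite lee_fin mulr1; exact: hat_bump_ge0.
Qed.

Lemma average_01 h Z x : 0 < h -> lebesgue_subset Omega Z ->
  0 <= average h Z x <= 1.
Proof.
move=> h0 sZ; apply/andP; split.
  by rewrite /average; apply: divr_ge0; [exact: mollify_ge0|exact: kernel_mass_ge0].
have [c0|c0] := eqVneq (kernel_mass h) 0.
  by rewrite /average c0 invr0 mulr0.
have cp : 0 < kernel_mass h by rewrite lt0r c0; exact: kernel_mass_ge0.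
rewrite /average ler_pdivrMr// mul1r; exact: mollify_le.
Qed.

Lemma average_bm h Z : 0 < h -> lebesgue_subset Omega Z ->
  bounded_measurable (average h Z : lebV -> R).
Proof.
move=> h0 sZ; split.
  exact/continuous_lebesgue_measurable/C1_continuous/average_C1.
exists 1 => x; have /andP[? ?] := average_01 x h0 sZ.
by rewrite ger0_norm.
Qed.

(** The kernel is at least 1/2 near its centre, so zero mass makes a ball null, and countably many
    translates of it cover the space. *)
Lemma kernel_mass0 h : 0 < h -> kernel_mass h = 0 -> leb [set: V] = 0%E.
Proof.
move=> h0 c0.
have cb : continuous (hat_bump h (0 : V)) by exact/C1_continuous/hat_bump_C1.
have half : (0 : R) < 2^-1 by rewrite invr_gt0.
have /nbhs_normP[r /= r0 rb] : \forall x \near (0 : V), 2^-1 <= hat_bump h (0 : V) x.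
  have := cb 0 => /cvgrPdist_le/(_ _ half); apply: filterS => x.
  by rewrite hat_bump_center ler_norml => /andP[_]; rewrite lerBlDr -lerBlDl; lra.
apply: (leb_null_ball r0).
pose B := nball r : set V.
have fB : leb B \is a fin_num by rewrite ge0_fin_numE ?nball_lty.
have bb := bump_bm (0 : V) h0.
have b1 : bounded_measurable (cst 1 : lebV -> R) by exact: bm_cst.
have : \int[leb]_(x in B) (2^-1 : R) <= kernel_mass h.
  rewrite (_ : kernel_mass h = \int[leb]_x (hat_bump h (0 : V) x * 1)).
    have I1 := bump_integrable h0 b1.
    have Ic : leb.-integrable (B : set lebV) (EFin \o (fun=> 2^-1 : R)).
      exact: (bm_integrable (nball_measurable r) (nball_lty d r) (bm_cst _ _)).
    have IB : leb.-integrable (B : set lebV) (EFin \o (fun x => hat_bump h 0 x * 1)).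
      by apply: integrableS I1 => //; exact: nball_measurable.
    apply: (@le_trans _ _ (\int[leb]_(x in B) (hat_bump h 0 x * 1))).
      apply: (le_Rintegral (nball_measurable r) Ic IB) => x xB.
      by rewrite mulr1; apply: rb; rewrite /= sub0r normrN.
    rewrite /Rintegral fine_le//.
    - exact: (integrable_fin_num (nball_measurable r) IB).
    - exact: (integrable_fin_num _ I1).
    - apply: ge0_subset_integral; [exact: nball_measurable|exact: measurableT|
        exact: (measurable_int _ I1)| |exact: subsetT].
      by move=> y _; rewrite lee_fin mulr1; exact: hat_bump_ge0.
  by rewrite -(bump_Rintegral (cst 1) h0); apply: eq_Rintegral => y _; rewrite mulr1.
rewrite c0 Rintegral_cst; last exact: nball_measurable.
rewrite pmulr_rle0// => B0.
rewrite -/(nball r) -/B -(fineK fB); congr EFin; apply/eqP; rewrite eq_le B0/=.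
apply: fine_ge0; exact: leb_outer_ge0.
Qed.

(** Joint measurability is obtained from the quasi-interpolants of [G], finite sums of products of
    functions of single coordinates, which converge to [G] uniformly. *)
Lemma C0_add_bm G : C0 Omega G ->
  bounded_measurable (fun q : lebV * lebV => G ((q.2 : V) + (q.1 : V))).
Proof.
move=> CG; split; last first.
  have [M GM] := bounded_support_bounded CG.1 (C0_bounded_support bOmega CG).
  by exists M.
have mq n : measurable_fun [set: lebV * lebV]
    (fun q : lebV * lebV => qi Omega n G ((q.2 : V) + (q.1 : V))).
  have [] // := @bm_sum _ (lebV * lebV)%type R _ (index_enum _) (fun m :
      {ffun 'I_d.+1 -> 'I_(n.+1 * Omega_radius Omega + n.+1 * Omega_radius Omega).+1} =>
      `[< forall y, `|y - grid_point n.+1%:R^-1 m| <= n.+1%:R^-1 -> Omega y >])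
    (fun m q => G (grid_point n.+1%:R^-1 m) *
      hat_bump n.+1%:R^-1 (grid_point n.+1%:R^-1 m) ((q.2 : V) + (q.1 : V))).
  move=> m _; apply: bmM; first exact: bm_cst.
  by apply: bump_add_bm; rewrite invr_gt0.
apply: (measurable_fun_cvg mq) => q _.
apply/cvgrPdist_le => e e0.
by apply: filterS (qi_unif_cvg bOmega CG e0) => n H; rewrite distrC.
Qed.

(** Fubini and the substitution z = x - y move the averaging from the set to the function [G], where
    translation can be controlled by the perimeter. *)
Lemma mollify_dual h Z G : 0 < h -> lebesgue_subset Omega Z -> C0 Omega G ->
  \int[leb]_(x in Omega) (mollify h Z x * G x) =
  \int[leb]_(z in nball h) (hat_bump h 0 z * \int[leb]_(y in Z) G (y + z)).
Proof.
move=> h0 sZ CG; have [mZ ZO] := sZ; have fZ := lebesgue_subset_lty bOmega sZ.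
have mB := @nball_measurable R d h; have fB := @nball_lty R d h.
have bG := C0_bm bOmega CG.
have bG2 := C0_add_bm CG.
have bs := bump_sub_bm (0 : V) h0.
have bG1 : bounded_measurable (fun q : lebV * lebV => G (q.1 : V)) by exact: bm_fst.
have bb1 : bounded_measurable (fun q : lebV * lebV => hat_bump h 0 (q.1 : V)).
  by apply: bm_fst; exact: bump_bm.
transitivity (\int[leb]_(x in Omega) (\int[leb]_(y in Z) (hat_bump h 0 (x - y) * G x))).
  apply: eq_Rintegral => x _; rewrite /mollify.
  rewrite mulrC -(bm_RintegralZ mZ fZ _ (bm_pair1 x bs)).
  by apply: eq_Rintegral => y _; rewrite mulrC.
rewrite (@bm_Fubini _ _ lebV lebV R (@lebs R d) (@lebs R d) Omega Z mOmega mZ fOmega fZ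
  (fun q => hat_bump h 0 ((q.1 : V) - (q.2 : V)) * G q.1) (bmM bs bG1)).
transitivity (\int[leb]_(y in Z) (\int[leb]_(z in nball h) (hat_bump h 0 z * G (y + z)))).
  apply: eq_Rintegral => y _ /=.
  have bGy : bounded_measurable ((fun z => G (y + z)) : lebV -> R).
    exact: (bm_pair2 y bG2).
  transitivity (\int[leb]_x (hat_bump h 0 (x - y) * G x)).
    by apply: Rintegral_domain => x Ox; rewrite CG.2// mulr0.
  rewrite (bump_Rintegral _ h0).
  rewrite -[RHS](@Rintegral_translate R d (- y) (fun z => hat_bump h 0 z * G (y + z))).
    by apply: eq_Rintegral => x _; rewrite /translate /= (addrC y) subrK.
  exact: bump_integrable.
rewrite -(@bm_Fubini _ _ lebV lebV R (@lebs R d) (@lebs R d) (nball h) Z mB mZ fB fZ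
  (fun q => hat_bump h 0 (q.1 : V) * G ((q.2 : V) + (q.1 : V))) (bmM bb1 bG2)).
apply: eq_Rintegral => z _ /=.
by rewrite -(bm_RintegralZ mZ fZ _ (bm_pair1 z bG2)).
Qed.

End mollification.

Section averaging.
Context (R : realType) (d : nat) (Omega : set 'rV[R]_d.+1).
Local Notation V := 'rV[R]_d.+1.
Local Notation lebV := (lebT R d).
Hypotheses (oOmega : open Omega) (bOmega : bounded_set Omega).
Let mOmega := domain_measurable oOmega.
Let fOmega := domain_lty bOmega.
Implicit Types (Z : set V) (h : R).

(** By duality the left side is a mean of the translated integrals with nonnegative weights of total
    mass 1, so it inherits their common bound. *)
Lemma average_dual_le h Z G M : 0 < h -> lebesgue_subset Omega Z -> C0 Omega G ->
  kernel_mass d h != 0 ->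
  (forall z, `|z| < h -> \int[leb]_(y in Z) G (y + z) <= M) ->
  \int[leb]_(x in Omega) (average h Z x * G x) <= M.
Proof.
move=> h0 sZ CG c0 IM; have [mZ ZO] := sZ; have fZ := lebesgue_subset_lty bOmega sZ.
have cp : 0 < kernel_mass (R := R) d h by rewrite lt0r c0; exact: kernel_mass_ge0.
have bm : bounded_measurable ((fun x => mollify h Z x * G x) : lebV -> R).
  apply: bmM; last exact: (C0_bm bOmega CG).
  have bm1 : bounded_measurable ((fun x => average h Z x * kernel_mass d h) : lebV -> R).
    exact: (bmM (average_bm bOmega h0 sZ) (bm_cst _ _)).
  rewrite (_ : mollify h Z = fun x => average h Z x * kernel_mass d h)//.
  by apply/funext => x; rewrite /average divfK.
rewrite (_ : \int[leb]_(x in Omega) _ =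
    (kernel_mass d h)^-1 * \int[leb]_(x in Omega) (mollify h Z x * G x)); last first.
  rewrite -(bm_RintegralZ mOmega fOmega _ bm); apply: eq_Rintegral => x _.
  by rewrite /average mulrA (mulrC (kernel_mass d h)^-1).
rewrite mulrC ler_pdivrMr// (mollify_dual oOmega bOmega h0 sZ CG).
have bG2 := C0_add_bm bOmega CG.
have bI : bounded_measurable ((fun z => \int[leb]_(y in Z) G (y + z)) : lebV -> R).
  split.
    exact: (@bm_measurable_Rintegral _ _ lebV lebV R (@lebs R d) Z mZ fZ _ bG2).
  have [_ [N GN]] := bG2; exists (N * fine (leb Z)) => z.
  apply: (bm_normr_Rintegral_le mZ fZ (bm_pair1 z bG2)) => y _.
  exact: GN (z, y).
rewrite (_ : M * _ = \int[leb]_(z in nball h) (hat_bump h (0 : V) z * M)); last first.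
  rewrite mulrC /kernel_mass -(RintegralZr M (nball_measurable h))//.
  exact: (bm_integrable (nball_measurable h) (nball_lty d h) (bump_bm (0 : V) h0)).
apply: (bm_le_Rintegral (nball_measurable h) (nball_lty d h)
  (bmM (bump_bm (0 : V) h0) bI) (bmM (bump_bm (0 : V) h0) (bm_cst _ M))) => z zh.
by rewrite ler_wpM2l ?hat_bump_ge0// IM.
Qed.

Lemma average_dual_dist h Z G M : 0 < h -> lebesgue_subset Omega Z -> C0 Omega G ->
  0 <= M ->
  (forall z, `|z| < h ->
    `|\int[leb]_(y in Z) G (y + z) - \int[leb]_(y in Z) G y| <= M) ->
  \int[leb]_(x in Omega) ((\1_Z x - average h Z x) * G x) <= M.
Proof.
move=> h0 sZ CG M0 IM; have [mZ ZO] := sZ; have fZ := lebesgue_subset_lty bOmega sZ.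
have bG := C0_bm bOmega CG.
have bA := average_bm bOmega h0 sZ.
have bZ := lebesgue_subset_bm sZ.
(* Without kernel mass [Omega] is null and the integral is 0. *)
have [c0|c0] := eqVneq (kernel_mass (R := R) d h) 0.
  have T0 := kernel_mass0 h0 c0.
  have O0 : leb Omega = 0%E.
    by apply/eqP; rewrite eq_le leb_outer_ge0 andbT -T0; exact: le_leb_outer.
  apply: le_trans M0; apply: le_trans (ler_norm _) _.
  have [_ [N NP]] := bmM (bmB bZ bA) bG.
  have := bm_normr_Rintegral_le mOmega fOmega (bmM (bmB bZ bA) bG) (fun x _ => NP x).
  by rewrite O0 mulr0.
have CNG : C0 Omega (fun x => - G x).
  case: CG => cG G0; split; last by move=> x Ox; rewrite G0// oppr0.
  by move=> x; exact: (continuousN (cG x)).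
(* The mean bound is applied to [- G], with the integral of [G] over [Z] moved into the constant. *)
have := @average_dual_le h Z (fun x => - G x) (M - \int[leb]_(y in Z) G y) h0 sZ CNG c0.
have bGz z : bounded_measurable ((fun y => G (y + z)) : lebV -> R).
  by have := bm_pair1 (z : lebV) (C0_add_bm bOmega CG).
have H z : `|z| < h -> \int[leb]_(y in Z) - G (y + z) <= M - \int[leb]_(y in Z) G y.
  move=> zh; rewrite (bm_RintegralN mZ fZ (bGz z)).
  have := IM z zh; rewrite ler_norml => /andP[]; lra.
move=> /(_ H).
rewrite (_ : \int[leb]_(x in Omega) (average h Z x * - G x) =
    - \int[leb]_(x in Omega) (average h Z x * G x)); last first.
  rewrite -(bm_RintegralN mOmega fOmega (bmM bA bG)).
  by apply: eq_Rintegral => x _; rewrite mulrN.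
rewrite (_ : \int[leb]_(x in Omega) ((\1_Z x - average h Z x) * G x) =
    \int[leb]_(x in Z) G x - \int[leb]_(x in Omega) (average h Z x * G x)); last first.
  rewrite -(Rintegral_subset _ ZO) -(bm_RintegralB mOmega fOmega (bmM bZ bG) (bmM bA bG)).
  by apply: eq_Rintegral => x _; rewrite mulrBl.
by move=> ?; lra.
Qed.

Lemma bm_dist h Z : 0 < h -> lebesgue_subset Omega Z ->
  bounded_measurable ((fun x => `|\1_Z x - average h Z x|) : lebV -> R).
Proof.
move=> h0 sZ; apply: bm_norm; apply: bmB; first exact: lebesgue_subset_bm sZ.
exact: (average_bm bOmega h0 sZ).
Qed.

Lemma indic_average_le1 h Z x : 0 < h -> lebesgue_subset Omega Z ->
  `|\1_Z x - average h Z x| <= 1.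
Proof.
move=> h0 sZ; have /andP[? ?] := average_01 x h0 sZ.
by rewrite indicE; case: (x \in Z); rewrite ler_norml /=; apply/andP; split; lra.
Qed.

(* The sign of [\1_Z - average] is [2 * \1_Z - 1]; approximating [\1_Z] by a C1
   function turns duality with test functions into an L1 bound. *)
Lemma average_dist_cutoff eta r h Z P : C1c Omega eta ->
  (forall x, 0 <= eta x <= 1) ->
  (forall w, `|w| <= r -> C1c Omega (eta \o translate w)) ->
  lebesgue_subset Omega Z -> (perimeter Omega Z <= P%:E)%E -> 0 < h -> h <= r ->
  \int[leb]_(x in Omega) (eta x * `|\1_Z x - average h Z x|) <= P * d.+1%:R * h.
Proof.
move=> Ceta eta01 tr sZ PZ h0 hr; have [mZ ZO] := sZ.
have P0 : 0 <= P by rewrite -lee_fin; apply: le_trans PZ; exact: perimeter_ge0.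
have beta := C1c_bm bOmega Ceta.
have bA := average_bm bOmega h0 sZ.
have bZ := lebesgue_subset_bm sZ.
apply/ler_addgt0Pr => e e0.
(* The sign function is replaced by [2 * g - 1], so the error of [g] enters twice. *)
have e2 : 0 < e / 2 by rewrite divr_gt0.
have [g [Cg g01 gZ]] := C1_indic_approx mOmega fOmega mZ ZO e2.
have bg : bounded_measurable (g : lebV -> R).
  split; first exact/continuous_lebesgue_measurable/C1_continuous.
  by exists 1 => x; have /andP[? ?] := g01 x; rewrite ger0_norm.
pose k x := 2 * g x - 1.
have Ck : C1 k by apply: C1B; [exact: C1Z|exact: C1_cst].
pose G x := eta x * k x.
have CG : C1c Omega G by exact: C1cM.
have G1 x : `|G x| <= 1.
  have /andP[? ?] := eta01 x; have /andP[? ?] := g01 x.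
  rewrite normrM (ger0_norm (_ : 0 <= eta x))// mulr_ile1// /k ler_norml.
  by apply/andP; split; lra.
have trG w : `|w| <= r -> C1c Omega (G \o translate w).
  by move=> wr; apply: (C1cM (tr w wr)); exact: C1_translate.
have GM z : `|z| < h ->
    `|\int[leb]_(y in Z) G (y + z) - \int[leb]_(y in Z) G y| <= P * d.+1%:R * h.
  move=> zh; apply: le_trans (perimeter_translate oOmega bOmega sZ PZ CG G1 trG _) _.
    by rewrite (le_trans (ltW zh)).
  by rewrite ler_wpM2l ?mulr_ge0// ltW.
have Pn0 : 0 <= P * d.+1%:R * h by rewrite !mulr_ge0// ltW.
have I1 := average_dual_dist h0 sZ (C1c_C0 CG) Pn0 GM.
have bG := C1c_bm bOmega CG.
have bd := bmM (bmB bZ bA) bG.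
have b2 : bounded_measurable ((fun x => 2 * `|g x - \1_Z x|) : lebV -> R).
  exact: (bmM (bm_cst _ _) (bm_norm (bmB bg bZ))).
apply: (@le_trans _ _ (\int[leb]_(x in Omega)
    ((\1_Z x - average h Z x) * G x + 2 * `|g x - \1_Z x|))).
  apply: (bm_le_Rintegral mOmega fOmega (bmM beta (bm_dist h0 sZ)) (bmD bd b2)) => x _.
  have /andP[E0 E1] := eta01 x.
  have A1 := indic_average_le1 x h0 sZ.
  have /andP[a0 a1] := average_01 x h0 sZ.
  have -> : `|\1_Z x - average h Z x| = (\1_Z x - average h Z x) * (2 * \1_Z x - 1).
    rewrite indicE; case: (x \in Z) => /=.
      by rewrite ger0_norm ?subr_ge0//; lra.
    by rewrite sub0r normrN ger0_norm//; lra.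
  rewrite -lerBlDl.
  have -> : eta x * ((\1_Z x - average h Z x) * (2 * \1_Z x - 1)) -
      (\1_Z x - average h Z x) * G x =
    - (2 * (eta x * ((\1_Z x - average h Z x) * (g x - \1_Z x)))).
    by rewrite /G /k; ring.
  rewrite -mulrN; apply: ler_wpM2l => //.
  apply: le_trans (ler_norm _) _; rewrite normrN !normrM (ger0_norm E0).
  rewrite mulrA ler_piMl// mulr_ile1//.
rewrite (bm_RintegralD mOmega fOmega bd b2); apply: lerD => //.
rewrite (bm_RintegralZ mOmega fOmega _ (bm_norm (bmB bg bZ))).
by move: gZ; lra.
Qed.

Lemma cutoff_bm n : bounded_measurable (cutoff Omega n : lebV -> R).
Proof. exact: (C1c_bm bOmega (@cutoff_C1c _ _ Omega n)). Qed.

Lemma cutoff_integral_cvg :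
  \int[leb]_(x in Omega) (1 - cutoff Omega n x) @[n --> \oo] --> (0 : R).
Proof.
have b1 : bounded_measurable (cst 1 : lebV -> R) by exact: bm_cst.
rewrite [X in _ --> X](_ : 0 = \int[leb]_(x in Omega) (cst 0 x)); last first.
  by rewrite Rintegral_cst// mul0r.
apply: (@bm_dominated_cvg _ lebV R leb Omega mOmega fOmega
  (fun n x => 1 - cutoff Omega n x) (cst 0) 1).
- by move=> n; case: (bmB b1 (cutoff_bm n)).
- exact: measurable_cst.
- move=> n x; have h0 := cutoff_ge0 Omega n x; have h1 := cutoff_le1 bOmega n x.
  by rewrite ger0_norm; lra.
- move=> x Ox; have := @cutoff_cvg R d Omega bOmega oOmega x.
  rewrite indicE mem_set//= => H.
  have := @cvgB _ _ _ _ _ _ _ (1 : R) _ (@cvg_cst _ _ _ _ _) H.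
  rewrite subrr; exact.
Qed.

(** A fixed cutoff leaves a boundary layer of integral at most [e / 2], where the crude bound 1 on
    the integrand is enough; under the cutoff the error is linear in [h], with a constant depending
    on [Z] through [P] alone. *)
Lemma average_unif P e : 0 < e -> exists2 r : R, 0 < r &
  forall h Z, 0 < h -> h <= r -> lebesgue_subset Omega Z ->
    (perimeter Omega Z <= P%:E)%E ->
    \int[leb]_(x in Omega) `|\1_Z x - average h Z x| <= e.
Proof.
move=> e0; have e2 : 0 < e / 2 by rewrite divr_gt0.
have /cvgr0_norm_le/(_ _ e2)/filter_ex[n /= en] := cutoff_integral_cvg.
have [r0 r00 tr] := C1c_translate oOmega (@cutoff_C1c _ _ Omega n).
have q0 : 0 < `|P| * d.+1%:R + 1 by rewrite ltr_wpDl// mulr_ge0.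
(* [r0] keeps translates of the cutoff admissible, the quotient bounds the interior error by
   [e / 2]. The summand 1 prevents division by 0, and no sign of [P] is assumed. *)
exists (Num.min r0 (e / 2 / (`|P| * d.+1%:R + 1))).
  by rewrite lt_min r00 divr_gt0.
move=> h Z h0; rewrite le_min => /andP[hr hP] sZ PZ.
have b1 : bounded_measurable (cst 1 : lebV -> R) by exact: bm_cst.
have bd := bm_dist h0 sZ.
have c01 x : 0 <= cutoff Omega n x <= 1 by rewrite cutoff_ge0 cutoff_le1.
have := average_dist_cutoff (@cutoff_C1c _ _ Omega n) c01 tr sZ PZ h0 hr.
move=> I1; apply: (@le_trans _ _ (\int[leb]_(x in Omega)
   (cutoff Omega n x * `|\1_Z x - average h Z x| + (1 - cutoff Omega n x)))).
  apply: (bm_le_Rintegral mOmega fOmega bd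
    (bmD (bmM (cutoff_bm n) bd) (bmB b1 (cutoff_bm n)))) => x _.
  have /andP[c0 c1] := c01 x; have A1 := indic_average_le1 x h0 sZ.
  rewrite -lerBlDl -[X in X - _]mul1r -mulrBl.
  by rewrite ler_piMr// subr_ge0.
rewrite (bm_RintegralD mOmega fOmega (bmM (cutoff_bm n) bd) (bmB b1 (cutoff_bm n))).
rewrite [e]splitr; apply: lerD; last exact: le_trans (ler_norm _) en.
apply: le_trans I1 _; apply: (@le_trans _ _ ((`|P| * d.+1%:R + 1) * h)).
  apply: ler_wpM2r; first exact: ltW.
  by apply: ler_wpDr => //; apply: ler_wpM2r => //; exact: ler_norm.
by move: hP; rewrite ler_pdivlMr// mulrC.
Qed.

End averaging.

(** * Submodularity of the perimeter *)

Section submodularity.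
Context (R : realType) (d : nat) (Omega : set 'rV[R]_d.+1).
Local Notation V := 'rV[R]_d.+1.
Local Notation lebV := (lebT R d).
Local Notation e_ i := (basis_vector R i).
Hypotheses (oOmega : open Omega) (bOmega : bounded_set Omega).
Let mOmega := domain_measurable oOmega.
Let fOmega := domain_lty bOmega.
Implicit Types (A B Z : set V) (h : R) (phi psi : V -> V).

Lemma enorm_le1 (x : V) : (enorm x <= 1) = (\sum_i x 0 i ^+ 2 <= 1).
Proof.
rewrite /enorm -[X in _ <= X]sqrtr1 ler_sqrt ?ler01// .
Qed.

(** The polynomial expression of a union is 1-Lipschitz in each argument on [0,1]; one argument is
    changed at a time. *)
Lemma indicator_union_defect (u w u' w' : R) : 0 <= u <= 1 -> 0 <= w' <= 1 ->
  `|u + w - u * w - (u' + w' - u' * w')| <= `|u - u'| + `|w - w'|.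
Proof.
move=> /andP[u0 u1] /andP[w0 w1].
have -> : u + w - u * w - (u' + w' - u' * w') =
  (u - u') * (1 - w') + (w - w') * (1 - u) by ring.
apply: le_trans (ler_normD _ _) _; rewrite !normrM.
by apply: lerD; rewrite ler_piMr// ger0_norm ?subr_ge0// gerBl.
Qed.

Lemma indicator_inter_defect (u w u' w' : R) : 0 <= u <= 1 -> 0 <= w' <= 1 ->
  `|u * w - u' * w'| <= `|u - u'| + `|w - w'|.
Proof.
move=> /andP[u0 u1] /andP[w0 w1].
have -> : u * w - u' * w' = (u - u') * w' + (w - w') * u by ring.
apply: le_trans (ler_normD _ _) _; rewrite !normrM.
by apply: lerD; rewrite ler_piMr// ger0_norm.
Qed.

Lemma indic01 A x : 0 <= (\1_A x : R) <= 1.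
Proof. by rewrite indicE; case: (x \in A); rewrite /= ?ler01 ?lexx. Qed.

Lemma indic_setU A B x : \1_(A `|` B) x = \1_A x + \1_B x - \1_A x * \1_B x :> R.
Proof.
rewrite !indicE in_setU.
by case: (x \in A); case: (x \in B); rewrite /= ?mulr1 ?mulr0 ?mul0r ?addr0 ?subr0 ?addrK ?add0r.
Qed.

Lemma indic_setI A B x : \1_(A `&` B) x = \1_A x * \1_B x :> R.
Proof.
rewrite !indicE in_setI.
by case: (x \in A); case: (x \in B); rewrite /= ?mulr1 ?mulr0 ?mul0r.
Qed.

(** It suffices that the square is convex in each coordinate, since the unit ball is described by a
    sum of squares. *)
Lemma enorm_convex (x y : V) (t : R) : 0 <= t <= 1 -> enorm x <= 1 -> enorm y <= 1 ->
  enorm ((1 - t) *: x + t *: y) <= 1.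
Proof.
move=> /andP[t0 t1]; rewrite !enorm_le1 => hx hy.
apply: (@le_trans _ _ (\sum_i ((1 - t) * x 0 i ^+ 2 + t * y 0 i ^+ 2))).
  apply: ler_sum => i _; rewrite !mxE.
  have := sqr_ge0 (x 0 i - y 0 i); have : 0 <= t * (1 - t) by rewrite mulr_ge0// subr_ge0.
  by nra.
rewrite big_split/= -!mulr_sumr.
have t1' : 0 <= 1 - t by rewrite subr_ge0.
by have := ler_wpM2l t1' hx; have := ler_wpM2l t0 hy; lra.
Qed.

Definition blend (w : V -> R) phi psi x : V := (1 - w x) *: phi x + w x *: psi x.

Lemma blend_coord w phi psi i :
  (fun x => blend w phi psi x 0 i) = (fun x => (1 - w x) * phi x 0 i + w x * psi x 0 i).
Proof. by apply/funext => x; rewrite !mxE. Qed.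

Lemma blend_test w phi psi : C1 w -> (forall x, 0 <= w x <= 1) ->
  test_field Omega phi -> test_field Omega psi -> test_field Omega (blend w phi psi).
Proof.
move=> Cw w01 [Cphi phi1] [Cpsi psi1]; split=> [i|x]; last exact: enorm_convex.
rewrite blend_coord.
exact: (C1cD (C1cMl (Cphi i) (C1B (C1_cst d (1 : R)) Cw)) (C1cMl (Cpsi i) Cw)).
Qed.

Lemma divergence_blend w phi psi x : C1 w ->
  (forall i, C1 (fun x => phi x 0 i)) -> (forall i, C1 (fun x => psi x 0 i)) ->
  divergence (blend w phi psi) x =
  (1 - w x) * divergence phi x + w x * divergence psi x +
  \sum_i (psi x 0 i - phi x 0 i) * 'D_(e_ i) w x.
Proof.
move=> Cw Cphi Cpsi; rewrite /divergence !mulr_sumr -!big_split/=.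
apply: eq_bigr => i _; rewrite blend_coord.
have C1w : C1 (fun x => 1 - w x) by exact: (C1B (C1_cst d (1 : R)) Cw).
rewrite (derive_add i x (C1M C1w (Cphi i)) (C1M Cw (Cpsi i))).
rewrite (derive_mul i x C1w (Cphi i)) (derive_mul i x Cw (Cpsi i)).
rewrite (derive_sub i x (C1_cst d (1 : R)) Cw) (derive_cst (1 : R) x (e_ i)).
by ring.
Qed.

Definition translation_margin phi (r : R) :=
  forall i (w : V), `|w| <= r -> C1c Omega ((fun x => phi x 0 i) \o translate w).

Lemma translation_margin_near phi : (forall i, C1c Omega (fun x => phi x 0 i)) ->
  \forall r \near (0 : R)^'+, translation_margin phi r.
Proof.
move=> Cphi; apply: filter_forall => i.
have [r0 r00 tr] := C1c_translate oOmega (Cphi i).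
by apply: filterS (nbhs_right_le r00) => r rr0 w wr; apply: tr; exact: le_trans wr rr0.
Qed.

(** Within the margin the translates of [phi] are test fields too, so each translated integral is at
    most [P]. *)
Lemma average_divergence_le h Z P phi : 0 < h -> lebesgue_subset Omega Z ->
  (perimeter Omega Z <= P%:E)%E -> test_field Omega phi ->
  kernel_mass (R := R) d h != 0 -> translation_margin phi h ->
  \int[leb]_(x in Omega) (average h Z x * divergence phi x) <= P.
Proof.
move=> h0 sZ PZ tphi c0 tr; have [Cphi phi1] := tphi.
apply: (average_dual_le oOmega bOmega h0 sZ (divergence_C0 Cphi) c0) => z zh.
have tz : test_field Omega (phi \o translate z).
  by split=> [i|x]; [exact: tr (ltW zh)|exact: phi1].
have := (perimeter_leP oOmega bOmega P sZ).1 PZ _ tz; apply: le_trans.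
rewrite le_eqVlt; apply/orP; left; apply/eqP; apply: eq_Rintegral => y _.
apply: eq_bigr => i _.
by rewrite [RHS](congr1 (@^~ y) (derive_translate (fun x => phi x 0 i) z (e_ i))).
Qed.

Lemma blend_margin w phi psi r : C1 w -> translation_margin phi r ->
  translation_margin psi r -> translation_margin (blend w phi psi) r.
Proof.
move=> Cw tphi tpsi i v vr; rewrite blend_coord.
have Cwv := C1_translate v Cw.
have -> : (fun x => (1 - w x) * phi x 0 i + w x * psi x 0 i) \o translate v =
  (fun x => (1 - (w \o translate v) x) * ((fun x => phi x 0 i) \o translate v) x +
            (w \o translate v) x * ((fun x => psi x 0 i) \o translate v) x) by [].
exact: (C1cD (C1cMl (tphi i v vr) (C1B (C1_cst d (1 : R)) Cwv))
  (C1cMl (tpsi i v vr) Cwv)).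
Qed.

Lemma lebesgue_subsetU A B : lebesgue_subset Omega A -> lebesgue_subset Omega B ->
  lebesgue_subset Omega (A `|` B).
Proof.
by move=> [mA AO] [mB BO]; split; [exact: measurableU|move=> x [/AO|/BO]].
Qed.

Lemma lebesgue_subsetI A B : lebesgue_subset Omega A -> lebesgue_subset Omega B ->
  lebesgue_subset Omega (A `&` B).
Proof.
by move=> [mA AO] [mB BO]; split; [exact: measurableI|move=> x [/AO]].
Qed.

(* With U, W smooth approximations of the two indicator functions, the fields
   (1 - W) phi + W psi and (1 - U) phi + U psi are admissible, and
   U div((1-W) phi + W psi) + W div((1-U) phi + U psi)
     = (U + W - U W) div phi + U W div psi + div(U W (psi - phi)). *)
Lemma submodular_test A B (a b : R) phi psi :
  lebesgue_subset Omega A -> lebesgue_subset Omega B ->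
  (perimeter Omega A <= a%:E)%E -> (perimeter Omega B <= b%:E)%E ->
  test_field Omega phi -> test_field Omega psi ->
  \int[leb]_(x in A `|` B) divergence phi x +
  \int[leb]_(x in A `&` B) divergence psi x <= a + b.
Proof.
move=> sA sB PA PB tphi tpsi.
have [Cphi _] := tphi; have [Cpsi _] := tpsi.
have bphi := divergence_bm bOmega Cphi; have bpsi := divergence_bm bOmega Cpsi.
have a0 : 0 <= a by rewrite -lee_fin; apply: le_trans PA; exact: perimeter_ge0.
have b0 : 0 <= b by rewrite -lee_fin; apply: le_trans PB; exact: perimeter_ge0.
have sU := lebesgue_subsetU sA sB; have sI := lebesgue_subsetI sA sB.
have bA := lebesgue_subset_bm sA; have bB := lebesgue_subset_bm sB.
have bU := lebesgue_subset_bm sU; have bI := lebesgue_subset_bm sI.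
have [C C0 [Cf Cg]] : exists2 C : R, 0 < C &
    (forall x, `|divergence phi x| <= C) /\ (forall x, `|divergence psi x| <= C).
  have [_ [C1 H1]] := bphi; have [_ [C2 H2]] := bpsi.
  exists (`|C1| + `|C2| + 1); first by rewrite ltr_wpDl// addr_ge0.
  split=> x; [apply: le_trans (H1 x) _|apply: le_trans (H2 x) _];
    apply: le_trans (ler_norm _) _; have := normr_ge0 C1; have := normr_ge0 C2; lra.
apply/ler_addgt0Pr => e e0.
(* The two L1 errors, for [A] and for [B], are added and multiplied by [2 * C] in the end. *)
have e4 : 0 < e / (4 * C) by rewrite divr_gt0// mulr_gt0.
have [ra ra0 Ha] := average_unif oOmega bOmega a e4.
have [rb rb0 Hb] := average_unif oOmega bOmega b e4.
have : \forall h \near (0 : R)^'+, [/\ 0 < h, h <= ra, h <= rb,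
    translation_margin phi h & translation_margin psi h].
  near=> h; split; near: h.
  - exact: nbhs_right_gt.
  - exact: nbhs_right_le.
  - exact: nbhs_right_le.
  - exact: translation_margin_near.
  - exact: translation_margin_near.
move=> /filter_ex[h [h0 ha hb trphi trpsi]].
have {}Ha := Ha h A h0 ha sA PA; have {}Hb := Hb h B h0 hb sB PB.
rewrite -(Rintegral_subset _ sU.2) -(Rintegral_subset _ sI.2).
have [c0|c0] := eqVneq (kernel_mass (R := R) d h) 0.
  have T0 := kernel_mass0 h0 c0.
  have O0 : leb Omega = 0%E.
    by apply/eqP; rewrite eq_le leb_outer_ge0 andbT -T0; exact: le_leb_outer.
  have Z0 (f : V -> R) : bounded_measurable (f : lebV -> R) ->
      \int[leb]_(x in Omega) f x <= 0.
    move=> bf; have [_ [N NP]] := bf.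
    apply: le_trans (ler_norm _) _.
    by have := bm_normr_Rintegral_le mOmega fOmega bf (fun x _ => NP x); rewrite O0 mulr0.
  have := lerD (Z0 _ (bmM bU bphi)) (Z0 _ (bmM bI bpsi)).
  by move=> H; apply: le_trans H _; rewrite addr0 !addr_ge0// ltW.
pose U := average h A; pose W := average h B.
have CU : C1 U by exact: (average_C1 bOmega).
have CW : C1 W by exact: (average_C1 bOmega).
have U01 x : 0 <= U x <= 1 by exact: (average_01 x h0 sA).
have W01 x : 0 <= W x <= 1 by exact: (average_01 x h0 sB).
have bmU : bounded_measurable (U : lebV -> R) by exact: (average_bm bOmega h0 sA).
have bmW : bounded_measurable (W : lebV -> R) by exact: (average_bm bOmega h0 sB).
have t1 := blend_test CW W01 tphi tpsi.
have t2 := blend_test CU U01 tphi tpsi.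
have I1 := average_divergence_le h0 sA PA t1 c0 (blend_margin CW trphi trpsi).
have I2 := average_divergence_le h0 sB PB t2 c0 (blend_margin CU trphi trpsi).
have bt1 := divergence_bm bOmega t1.1; have bt2 := divergence_bm bOmega t2.1.
have CUW : C1 (fun x => U x * W x) by exact: C1M.
pose chi i x := (psi x 0 i - phi x 0 i) * (U x * W x).
have Cchi i : C1c Omega (chi i) by exact: (C1cM (C1cB (Cpsi i) (Cphi i)) CUW).
(* The product of the two averages times the difference of the fields is compactly supported in
   [Omega], so its divergence does not contribute. *)
have I3 : \int[leb]_(x in Omega) (\sum_i 'D_(e_ i) (chi i) x) = 0.
  rewrite (bm_Rintegral_sum mOmega fOmega).
    by apply: big1 => i _; exact: (integral_derive0 oOmega bOmega i (Cchi i)).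
  by move=> i _; exact: (C1c_derive_bm bOmega i (Cchi i)).
have bchi : bounded_measurable ((fun x => \sum_i 'D_(e_ i) (chi i) x) : lebV -> R).
  by apply: bm_sum => i _; exact: (C1c_derive_bm bOmega i (Cchi i)).
have ident x : U x * divergence (blend W phi psi) x + W x * divergence (blend U phi psi) x =
    (U x + W x - U x * W x) * divergence phi x + U x * W x * divergence psi x
    + \sum_i 'D_(e_ i) (chi i) x.
  have Cp i : C1 (fun x => phi x 0 i) := C1c_C1 (Cphi i).
  have Cq i : C1 (fun x => psi x 0 i) := C1c_C1 (Cpsi i).
  rewrite !divergence_blend//.
  have -> : \sum_i 'D_(e_ i) (chi i) x =
      U x * W x * divergence psi x - U x * W x * divergence phi x +
      U x * (\sum_i (psi x 0 i - phi x 0 i) * 'D_(e_ i) W x) +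
      W x * (\sum_i (psi x 0 i - phi x 0 i) * 'D_(e_ i) U x).
    rewrite /divergence !mulr_sumr -sumrB -!big_split/=; apply: eq_bigr => i _.
    rewrite (derive_mul i x (C1B (Cq i) (Cp i)) CUW) (derive_mul i x CU CW).
    rewrite (derive_sub i x (Cq i) (Cp i)).
    move: ('D_(e_ i) _ x) ('D_(e_ i) _ x) ('D_(e_ i) _ x) ('D_(e_ i) _ x).
    move: (U x) (W x) (psi x 0 i) (phi x 0 i) => u w p q D1 D2 D3 D4.
    by ring.
  move: (divergence phi x) (divergence psi x) (\sum_i _) (\sum_i _) (U x) (W x).
  by move=> *; ring.
have bl : bounded_measurable ((fun x => U x * divergence (blend W phi psi) x +
    W x * divergence (blend U phi psi) x) : lebV -> R).
  exact: (bmD (bmM bmU bt1) (bmM bmW bt2)).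
have bda : bounded_measurable ((fun x => `|\1_A x - U x|) : lebV -> R).
  exact: (bm_norm (bmB bA bmU)).
have bdb : bounded_measurable ((fun x => `|\1_B x - W x|) : lebV -> R).
  exact: (bm_norm (bmB bB bmW)).
have bC : bounded_measurable ((fun x => 2 * C * (`|\1_A x - U x| + `|\1_B x - W x|)) : lebV -> R).
  exact: (bmM (bm_cst _ _) (bmD bda bdb)).
rewrite -(bm_RintegralD mOmega fOmega (bmM bU bphi) (bmM bI bpsi)).
apply: (@le_trans _ _ (\int[leb]_(x in Omega)
   ((U x * divergence (blend W phi psi) x + W x * divergence (blend U phi psi) x)
    - \sum_i 'D_(e_ i) (chi i) x
    + 2 * C * (`|\1_A x - U x| + `|\1_B x - W x|)))).
  apply: (bm_le_Rintegral mOmega fOmega (bmD (bmM bU bphi) (bmM bI bpsi))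
    (bmD (bmB bl bchi) bC)) => x _.
  rewrite ident addrK.
  have d1 := indicator_union_defect (\1_B x) (U x) (indic01 A x) (W01 x).
  have d2 := indicator_inter_defect (\1_B x) (U x) (indic01 A x) (W01 x).
  rewrite -indic_setU in d1; rewrite -indic_setI in d2.
  rewrite -lerBlDl opprD addrACA -!mulrBl.
  apply: le_trans (ler_norm _) _; apply: le_trans (ler_normD _ _) _; rewrite !normrM.
  rewrite -mulrA mulr_natl mulr2n (mulrC C).
  by apply: lerD; apply: ler_pM.
rewrite (bm_RintegralD mOmega fOmega (bmB bl bchi) bC).
rewrite (bm_RintegralB mOmega fOmega bl bchi) I3 subr0.
rewrite (bm_RintegralD mOmega fOmega (bmM bmU bt1) (bmM bmW bt2)).
apply: lerD; first exact: lerD I1 I2.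
rewrite (bm_RintegralZ mOmega fOmega _ (bmD bda bdb)) (bm_RintegralD mOmega fOmega bda bdb).
rewrite mulrC -ler_pdivlMr ?mulr_gt0//; apply: le_trans (lerD Ha Hb) _.
rewrite le_eqVlt; apply/orP; left; apply/eqP; field; rewrite gt_eqF//.
Unshelve. all: by end_near. Qed.

End submodularity.

(** * Compactness in L1 *)

Section diagonal_extraction.
Context (R : realType).

Lemma increasing_seq_ge (f : nat -> nat) n : increasing_seq f -> (n <= f n)%N.
Proof.
move=> fi; elim: n => // n IH; apply: leq_ltn_trans IH _.
by have := (increasing_seqP f).2 fi n; rewrite ltEnat.
Qed.

Lemma diagonal_subsequence (x : nat -> nat -> R) :
  (forall n, exists C, forall j, `|x n j| <= C) ->
  exists g : nat -> nat, increasing_seq g /\ forall n, cvgn (x n \o g).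
Proof.
move=> bx.
(* A total extraction, the identity on unbounded sequences, so that choice gives a function usable
   in the recursion [G]. *)
have exsub (u : nat -> R) : exists f : nat -> nat, increasing_seq f /\
    ((exists C, forall j, `|u j| <= C) -> cvgn (u \o f)).
  have [[C uC]|nb] := pselect (exists C, forall j, `|u j| <= C); last first.
    by exists id; split.
  have [|f fi cf] := @bolzano_weierstrass R u.
    by exists C; split; [exact: num_real|move=> M CM j _; exact: le_trans (uC j) (ltW CM)].
  by exists f.
have [sub subP] := choice exsub.
pose fix G n := if n is m.+1 then G m \o sub (x m.+1 \o G m) else sub (x 0%N).
have Gi n : increasing_seq (G n).
  elim: n => [|n IH] /=; first exact: (subP _).1.
  by move=> i j /=; rewrite IH; exact: (subP _).1.
have Gcvg n : cvgn (x n \o G n).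
  case: n => [|n] /=; first by apply: (subP _).2; exact: bx.
  apply: (subP (x n.+1 \o G n)).2.
  by have [C xC] := bx n.+1; exists C => j; exact: xC.
have GS n k : exists h : nat -> nat, increasing_seq h /\ G (n + k)%N = G n \o h.
  elim: k => [|k [h [hi E]]]; first by exists id; rewrite addn0.
  exists (h \o sub (x (n + k).+1 \o G (n + k)%N)); split.
    by move=> i j /=; rewrite hi; exact: (subP _).1.
  by rewrite addnS /= E.
exists (fun j => G j j); split.
  apply/increasing_seqP => j /=; rewrite ltEnat /=.
  have s1 : (j < sub (x j.+1 \o G j) j.+1)%N.
    exact: (increasing_seq_ge j.+1 (subP (x j.+1 \o G j)).1).
  have := Gi j (sub (x j.+1 \o G j) j.+1) j; rewrite !leEnat => E.
  by rewrite ltnNge E -ltnNge.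
move=> n; have /cvg_ex[l cl] := Gcvg n.
apply/cvg_ex; exists l; apply/cvgrPdist_le => e e0.
have /cvgrPdist_le/(_ e e0)[N _ HN] := cl.
near=> j.
have nj : (n <= j)%N by near: j; exact: nbhs_infty_ge.
have Nj : (N <= j)%N by near: j; exact: nbhs_infty_ge.
(* From index [n] on, the diagonal runs through values of [G n] at positions [h j], and [h j] is at
   least [j]. *)
have [h [hi E]] := GS n (j - n)%N.
rewrite /= -[in G j j](subnKC nj) E /= subnKC//.
by apply: HN => /=; exact: leq_trans Nj (increasing_seq_ge j hi).
Unshelve. all: by end_near. Qed.

Lemma increasing_seq_cvgnr (f : nat -> nat) : increasing_seq f -> f @ \oo --> \oo.
Proof.
move=> fi A [N _ NA]; exists N => // n Nn; apply: NA => /=.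
exact: leq_trans Nn (increasing_seq_ge n fi).
Qed.

End diagonal_extraction.

(** * The L1 metric on measurable subsets of [Omega] *)

Section L1_distance.
Context (R : realType) (d : nat) (Omega : set 'rV[R]_d.+1).
Local Notation V := 'rV[R]_d.+1.
Local Notation lebV := (lebT R d).
Hypotheses (oOmega : open Omega) (bOmega : bounded_set Omega).
Let mOmega := domain_measurable oOmega.
Let fOmega := domain_lty bOmega.
Implicit Types (A B C Z : set V).
Local Notation sub := (lebesgue_subset Omega).

(** The measure of the symmetric difference, as a real number; written as an integral so that
    triangle inequality and continuity of integrals are pointwise estimates. *)
Definition ldist A B : R := \int[leb]_(x in Omega) `|\1_A x - \1_B x|.

Lemma ldist_bm A B : sub A -> sub B ->
  bounded_measurable ((fun x => `|\1_A x - \1_B x|) : lebV -> R).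
Proof.
move=> sA sB.
exact: (bm_norm (bmB (lebesgue_subset_bm sA) (lebesgue_subset_bm sB))).
Qed.

Lemma ldistE A B : sub A -> sub B ->
  (\int[leb]_(x in Omega) `|\1_A x - \1_B x|%:E)%E = (ldist A B)%:E.
Proof.
move=> sA sB; rewrite /ldist /Rintegral fineK//.
apply: integrable_fin_num => //; exact: (bm_integrable mOmega fOmega (ldist_bm sA sB)).
Qed.

Lemma ldist_ge0 A B : 0 <= ldist A B.
Proof. exact: Rintegral_ge0. Qed.

Lemma ldistC A B : ldist A B = ldist B A.
Proof. by apply: eq_Rintegral => x _; rewrite distrC. Qed.

Lemma ldist_triangle B A C : sub A -> sub B -> sub C ->
  ldist A C <= ldist A B + ldist B C.
Proof.
move=> sA sB sC.
rewrite /ldist -(bm_RintegralD mOmega fOmega (ldist_bm sA sB) (ldist_bm sB sC)).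
apply: (bm_le_Rintegral mOmega fOmega (ldist_bm sA sC)
  (bmD (ldist_bm sA sB) (ldist_bm sB sC))) => x _.
by rewrite -(subrKA (\1_B x)); exact: ler_normD.
Qed.

Lemma ldist_integral A B (f : V -> R) K : sub A -> sub B ->
  bounded_measurable (f : lebV -> R) -> (forall x, `|f x| <= K) ->
  `|\int[leb]_(x in A) f x - \int[leb]_(x in B) f x| <= K * ldist A B.
Proof.
move=> sA sB bf fK.
have bA := lebesgue_subset_bm sA; have bB := lebesgue_subset_bm sB.
rewrite -(Rintegral_subset f sA.2) -(Rintegral_subset f sB.2).
rewrite -(bm_RintegralB mOmega fOmega (bmM bA bf) (bmM bB bf)).
apply: le_trans (bm_le_normr_Rintegral mOmega fOmega (bmB (bmM bA bf) (bmM bB bf))) _.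
rewrite /ldist -(bm_RintegralZ mOmega fOmega _ (ldist_bm sA sB)).
apply: (bm_le_Rintegral mOmega fOmega (bm_norm (bmB (bmM bA bf) (bmM bB bf)))
  (bmM (bm_cst _ K) (ldist_bm sA sB))) => x _.
by rewrite -mulrBl normrM mulrC ler_wpM2r.
Qed.

Lemma sub_setD A B : sub A -> sub B -> sub (A `\` B).
Proof.
by move=> [mA AO] [mB BO]; split; [exact: measurableD|move=> x [/AO]].
Qed.

Lemma leb_fineK A : sub A -> (fine (leb A))%:E = leb A.
Proof.
by move=> sA; rewrite fineK// ge0_fin_numE; [exact: lebesgue_subset_lty sA|exact: leb_outer_ge0].
Qed.

Lemma indic_integral A : sub A -> \int[leb]_(x in Omega) (\1_A x : R) = fine (leb A).
Proof.
move=> [mA AO]; rewrite /Rintegral integral_indic//.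
by congr (fine (leb _)); exact/setIidl.
Qed.

Lemma ldist_setD A B : sub A -> sub B ->
  ldist A B = fine (leb (A `\` B)) + fine (leb (B `\` A)).
Proof.
move=> sA sB; have sAB := sub_setD sA sB; have sBA := sub_setD sB sA.
rewrite -(indic_integral sAB) -(indic_integral sBA).
rewrite -(bm_RintegralD mOmega fOmega (lebesgue_subset_bm sAB) (lebesgue_subset_bm sBA)).
apply: eq_Rintegral => x _; rewrite !indicE !in_setD.
by case: (x \in A); case: (x \in B); rewrite /= ?subrr ?normr0 ?subr0 ?sub0r ?normrN ?normr1 ?addr0 ?add0r.
Qed.

Lemma ldist_ae_equal A B : sub A -> sub B -> ae_equal A B <-> ldist A B = 0.
Proof.
move=> sA sB; rewrite (ldist_setD sA sB).
have sAB := sub_setD sA sB; have sBA := sub_setD sB sA.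
have f1 : 0 <= fine (leb (A `\` B)) by apply: fine_ge0; exact: leb_outer_ge0.
have f2 : 0 <= fine (leb (B `\` A)) by apply: fine_ge0; exact: leb_outer_ge0.
split=> [[]|/eqP].
  by rewrite /ae_subset /null => -> ->; rewrite addr0.
rewrite paddr_eq0// => /andP[/eqP h1 /eqP h2]; split; rewrite /ae_subset /null.
  by rewrite -(leb_fineK sAB) h1.
by rewrite -(leb_fineK sBA) h2.
Qed.

Lemma ldist_setI A B C : sub A -> sub B -> sub C ->
  ldist (A `&` C) (B `&` C) <= ldist A B.
Proof.
move=> sA sB sC; apply: (bm_le_Rintegral mOmega fOmega
  (ldist_bm (lebesgue_subsetI sA sC) (lebesgue_subsetI sB sC)) (ldist_bm sA sB)) => x _.
rewrite !indic_setI -mulrBl normrM ler_piMr// indicE.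
by case: (x \in C); rewrite /= ?normr1 ?normr0.
Qed.

Lemma ldist_setU A B C : sub A -> sub B -> sub C ->
  ldist (A `|` C) (B `|` C) <= ldist A B.
Proof.
move=> sA sB sC; apply: (bm_le_Rintegral mOmega fOmega
  (ldist_bm (lebesgue_subsetU sA sC) (lebesgue_subsetU sB sC)) (ldist_bm sA sB)) => x _.
rewrite !indicE !in_setU.
by case: (x \in A); case: (x \in B); case: (x \in C); rewrite /= ?subrr ?normr0 ?subr0 ?sub0r ?normrN ?normr1.
Qed.

Lemma integral_cvg (Z_ : nat -> set V) Z f : (forall j, sub (Z_ j)) -> sub Z ->
  ldist (Z_ j) Z @[j --> \oo] --> 0 -> bounded_measurable (f : lebV -> R) ->
  \int[leb]_(x in Z_ j) f x @[j --> \oo] --> \int[leb]_(x in Z) f x.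
Proof.
move=> sZ_ sZ cZ bf; have [_ [K fK]] := bf.
apply/cvgrPdist_le => e e0.
have K0 : 0 < `|K| + 1 by rewrite ltr_wpDl.
have eK : 0 < e / (`|K| + 1) by rewrite divr_gt0.
have /cvgr0_norm_le/(_ _ eK) := cZ; apply: filterS => j h.
rewrite distrC; apply: le_trans (ldist_integral (sZ_ j) sZ bf fK) _.
rewrite ler_pdivlMr// in h; rewrite ger0_norm ?ldist_ge0// in h.
apply: le_trans h; rewrite mulrC ler_wpM2l ?ldist_ge0//.
by rewrite (le_trans (ler_norm K))// lerDl.
Qed.

Lemma cvg_le_limit (u v : nat -> R) l m : u @ \oo --> l -> v @ \oo --> m ->
  (forall j, u j <= v j) -> l <= m.
Proof.
move=> cu cv uv; rewrite -(cvg_lim _ cu)// -(cvg_lim _ cv)//.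
apply: ler_lim; [by apply/cvg_ex; exists l|by apply/cvg_ex; exists m|exact: nearW].
Qed.

(** The perimeter is a supremum of L1-continuous functionals. *)
Lemma perimeter_lsc (Z_ : nat -> set V) Z (M_ : nat -> R) M :
  (forall j, sub (Z_ j)) -> sub Z -> ldist (Z_ j) Z @[j --> \oo] --> 0 ->
  (forall j, (perimeter Omega (Z_ j) <= (M_ j)%:E)%E) -> M_ @ \oo --> M ->
  (perimeter Omega Z <= M%:E)%E.
Proof.
move=> sZ_ sZ cZ PZ cM; apply/(perimeter_leP oOmega bOmega M sZ) => phi tphi.
have c1 := integral_cvg sZ_ sZ cZ (divergence_bm bOmega tphi.1).
apply: (cvg_le_limit c1 cM) => j.
exact: (perimeter_leP oOmega bOmega (M_ j) (sZ_ j)).1 (PZ j) _ tphi.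
Qed.

(** Borel-Cantelli: along a subsequence with summable distances almost every point lies in finitely
    many of the consecutive symmetric differences, so its membership is eventually constant. *)
Lemma ldist_complete (A_ : nat -> set V) : (forall j, sub (A_ j)) ->
  (forall e, 0 < e -> exists N, forall i j, (N <= i)%N -> (N <= j)%N ->
     ldist (A_ i) (A_ j) <= e) ->
  exists2 Z, sub Z & ldist (A_ j) Z @[j --> \oo] --> 0.
Proof.
move=> sA cA.
have p0 k : 0 < 1 / (2 ^ k.+1)%:R :> R by rewrite divr_gt0// ltr0n expn_gt0.
have [N NP] := choice (fun k => cA _ (p0 k)).
(* Partial sums make both [n i] and [n i.+1] at least [N i], which bounds the distance of
   consecutive members of the subsequence. *)
pose n i := (\sum_(k < i.+1) N k)%N.
have nN i : (N i <= n i)%N by rewrite /n big_ord_recr leq_addl.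
have nS i : (N i <= n i.+1)%N.
  by apply: leq_trans (nN i) _; rewrite /n [leqRHS]big_ord_recr leq_addr.
pose B i := A_ (n i).
have sB i : sub (B i) by exact: sA.
pose D i := (B i `\` B i.+1) `|` (B i.+1 `\` B i).
have sD i : sub (D i) by apply: lebesgue_subsetU; exact: sub_setD.
have lD i : (leb (D i) <= (1 / (2 ^ i.+1)%:R)%:E)%E.
  apply: le_trans (outer_measureU2 (lebesgue_outer R d) _ _) _.
  rewrite -[leLHS]/(leb (B i `\` B i.+1) + leb (B i.+1 `\` B i))%E.
  rewrite -(leb_fineK (sub_setD (sB i) (sB i.+1))) -(leb_fineK (sub_setD (sB i.+1) (sB i))).
  rewrite -EFinD lee_fin -(ldist_setD (sB i) (sB i.+1)).
  exact: NP.
have D0 : leb (lim_sup_set D) = 0%E.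
  apply: lim_sup_set_cvg0 => [i|]; first exact: (sD i).1.
  apply: (@le_lt_trans _ _ (\sum_(i <oo) (1 / (2 ^ i.+1)%:R)%:E)%E).
    by apply: lee_nneseries => [i _ _|i _]; [exact: leb_outer_ge0|exact: lD].
  exact: le_lt_trans (epsilon_trick0 xpredT (@ler01 R)) (ltry _).
(* The inferior limit of the sets; taking it set-theoretically ensures that the L1 limit is again an
   indicator. *)
pose Z := \bigcup_i \bigcap_(k in [set k | (i <= k)%N]) B k.
have sZ : sub Z.
  split.
    apply: bigcupT_measurable => i; apply: bigcap_measurable; first by exists i => /=.
    by move=> k _; exact: (sB k).1.
  by move=> x [i _ H]; apply: (sB i).2; exact: H i (leqnn i).
exists Z => //.
have cB : ldist (B i) Z @[i --> \oo] --> 0.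
  rewrite [X in _ --> X](_ : 0 = \int[leb]_(x in Omega) (cst 0 x)); last first.
    by rewrite Rintegral_cst// mul0r.
  apply: (@Rintegral_dominated_cvg _ lebV R leb Omega mOmega
    (fun i x => `|\1_(B i) x - \1_Z x|) (cst 0) (cst 1%:E)).
  - by move=> i; apply: measurable_funTS; case: (ldist_bm (sB i) sZ).
  - exact: measurable_cst.
  - exact: (bm_integrable mOmega fOmega (bm_cst _ 1)).
  - move=> i; apply: aeW => x _; rewrite normr_id lee_fin !indicE.
    by case: (x \in B i); case: (x \in Z); rewrite /= ?subrr ?normr0 ?subr0 ?sub0r ?normrN ?normr1.
  exists (lim_sup_set D); split => //.
    by apply: bigcap_measurable => [|k _]; [exists 0%N|apply: bigcup_measurable => j _; exact: (sD j).1].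
  move=> x /= nx; apply: contrapT => ns; apply: nx => Ox.
  have [m mP] : exists m, forall k, (m <= k)%N -> ~ D k x.
    apply: contrapT => H; apply: ns => m _; apply: contrapT => H2; apply: H; exists m => k mk Dk.
    by apply: H2; exists k.
  have same k : (m <= k)%N -> B k x <-> B k.+1 x.
    move=> mk; have := mP k mk; rewrite /D => nD; split => h; apply: contrapT => h'.
      by apply: nD; left.
    by apply: nD; right.
  have const k : (m <= k)%N -> B k x <-> B m x.
    move=> mk; rewrite -(subnKC mk); elim: (k - m)%N => [|p IH]; first by rewrite addn0.
    by rewrite addnS -(same _ (leq_addr _ _)).
  apply: cvg_near_cst; exists m => // k /= mk.
  have E : \1_(B k) x = \1_Z x :> R.
    rewrite !indicE; congr (_ _)%:R; apply/idP/idP; rewrite !inE => h.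
      by exists m => // j /= mj; apply/(const j mj)/(const k mk).
    have [i _ H] := h; apply/(const k mk)/(const (maxn i m) (leq_maxr _ _)).
    by apply: H => /=; exact: leq_maxl.
  by rewrite E subrr normr0.
apply/cvgrPdist_le => e e0.
have e2 : 0 < e / 2 by rewrite divr_gt0.
have [M MP] := cA _ e2.
have /cvgr0_norm_le/(_ _ e2) cB2 := cB.
have pe : \forall i \near \oo, 1 / (2 ^ i.+1)%:R <= e / 2.
  have := near_infty_natSinv_lt (PosNum e2); apply: filterS => i /= h.
  apply: le_trans (ltW h); rewrite div1r lef_pV2 ?posrE ?ltr0n ?expn_gt0//.
  by rewrite ler_nat ltnW// ltn_expl.
have [i [iB ip]] := filter_ex (filterI cB2 pe).
exists (N i) => // j /= Nj.
rewrite sub0r normrN ger0_norm ?ldist_ge0//.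
apply: le_trans (ldist_triangle (sA j) (sB i) sZ) _; rewrite [e]splitr lerD//.
  by apply: le_trans ip; apply: NP => //; exact: nN.
exact: le_trans (ler_norm _) iB.
Qed.

End L1_distance.

Section compactness.
Context (R : realType) (d : nat) (Omega : set 'rV[R]_d.+1).
Local Notation V := 'rV[R]_d.+1.
Local Notation lebV := (lebT R d).
Hypotheses (oOmega : open Omega) (bOmega : bounded_set Omega).
Let mOmega := domain_measurable oOmega.
Let fOmega := domain_lty bOmega.
Implicit Types (A B C Z : set V).
Local Notation sub := (lebesgue_subset Omega).

Lemma real_cauchy_cvg (u : nat -> R) :
  (forall e, 0 < e -> exists N, forall i j, (N <= i)%N -> (N <= j)%N ->
    `|u i - u j| <= e) -> cvgn u.
Proof.
move=> H; apply/cauchy_cvgP/cauchy_ballP => e e0.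
have e2 : 0 < e / 2 by rewrite divr_gt0.
have [N NP] := H _ e2.
pose T := u @` [set n | (N <= n)%N].
exists (T, T) => /=; first by split; exists N => // n Nn; exists n.
move=> _ [[i Ni <-] [j Nj <-]]; rewrite /ball /=.
by apply: le_lt_trans (NP i j Ni Nj) _; rewrite ltr_pdivrMr// ltr_pMr// ltr1n.
Qed.

Lemma real_dist_four (a b a' b' l t : R) : `|a - a'| <= t / 3 -> `|b - b'| <= t / 3 ->
  `|l - a'| <= t / 6 -> `|l - b'| <= t / 6 -> `|a - b| <= t.
Proof.
rewrite !ler_norml => /andP[? ?] /andP[? ?] /andP[? ?] /andP[? ?].
by apply/andP; split; lra.
Qed.

(** The modulus of the kernel times the volume of [Omega] serves all sets [Z] at once; this
    equicontinuity extends convergence from rational points to all points. *)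
Lemma mollify_unif_cont h e : 0 < h -> 0 < e -> exists2 r : R, 0 < r &
  forall Z x y, sub Z -> `|x - y| < r -> `|mollify h Z x - mollify h Z y| <= e.
Proof.
move=> h0 e0.
have K0 : 0 < fine (leb Omega) + 1.
  by rewrite ltr_wpDl// fine_ge0//; exact: leb_outer_ge0.
have eK : 0 < e / (fine (leb Omega) + 1) by rewrite divr_gt0.
have cb : continuous (hat_bump h (0 : V)) by exact/C1_continuous/hat_bump_C1.
have := bounded_support_unif_cont cb (hat_bump_bounded_support (0 : V) h0) eK.
move=> /(filterI (nbhs_right_gt (0 : R)))/filter_ex[r [/= r0 osc]].
exists r => // Z x y sZ xy; have [mZ ZO] := sZ.
have fZ := lebesgue_subset_lty bOmega sZ.
have bx x' : bounded_measurable ((fun y' => hat_bump h 0 (x' - y')) : lebV -> R).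
  by have := bm_pair1 (x' : lebV) (bump_sub_bm (0 : V) h0).
rewrite /mollify -(bm_RintegralB mZ fZ (bx x) (bx y)).
apply: (@le_trans _ _ (e / (fine (leb Omega) + 1) * fine (leb Z))).
  apply: (bm_normr_Rintegral_le mZ fZ (bmB (bx x) (bx y))) => y' _.
  by apply: osc; rewrite opprB addrA subrK.
rewrite mulrAC ler_pdivrMr// ler_pM2l//.
apply: (@le_trans _ _ (fine (leb Omega))); last by rewrite lerDl.
apply: fine_le; rewrite ?ge0_fin_numE//; try exact: leb_outer_ge0.
exact: le_leb_outer.
Qed.

(** For a radius from [average_unif] the averages converge pointwise, by equicontinuity, and hence
    in L1 by dominated convergence. Two sets of large index are then joined through their averages
    and the limit [w], in four steps of length [e / 4]. *)
Lemma BV_cauchy (Z_ : nat -> set V) P : (forall j, sub (Z_ j)) ->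
  (forall j, (perimeter Omega (Z_ j) <= P%:E)%E) ->
  (forall m (q : 'rV[rat]_d.+1),
    cvgn (fun j => mollify m.+1%:R^-1 (Z_ j) (map_mx ratr q))) ->
  exists2 Z, sub Z & ldist Omega (Z_ j) Z @[j --> \oo] --> 0.
Proof.
move=> sZ PZ cZ; apply: (ldist_complete oOmega bOmega sZ) => e e0.
have e4 : 0 < e / 4 by rewrite divr_gt0.
have [r r0 rP] := average_unif oOmega bOmega P e4.
have /filter_ex[m /= mr] := near_infty_natSinv_lt (PosNum r0).
set h := m.+1%:R^-1 in mr.
have h0 : 0 < h by rewrite invr_gt0.
have cmol x : cvgn (fun j => mollify h (Z_ j) x).
  apply: real_cauchy_cvg => t t0; have t3 : 0 < t / 3 by rewrite divr_gt0.
  have [s s0 osc] := mollify_unif_cont h0 t3.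
  have [p [q [bx byx]]] := box_rat_nbhs x s0.
  have qx : `|x - map_mx ratr q| < s.
    rewrite distrC; apply: byx => i; have := bx i.
    by rewrite lexx andbT => /andP[]; exact: lt_le_trans.
  have := cZ m q; rewrite -/h => /cvg_ex[l cl].
  have t6 : 0 < t / 6 by rewrite divr_gt0.
  have /cvgrPdist_le/(_ _ t6)[N _ NP] := cl.
  exists N => i j Ni Nj.
  have h1 := osc _ _ _ (sZ i) qx; have h2 := osc _ _ _ (sZ j) qx.
  have h3 := NP i Ni; have h4 := NP j Nj.
  exact: real_dist_four h1 h2 h3 h4.
pose u j x := average h (Z_ j) x.
have cu x : cvgn (u ^~ x) by apply: is_cvgM => //; exact: is_cvg_cst.
pose w x := limn (u ^~ x).
have bu j : bounded_measurable (u j : lebV -> R) by exact: (average_bm bOmega h0 (sZ j)).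
have mw : measurable_fun [set: lebV] w.
  apply: (measurable_fun_cvg (fun j => (bu j).1)) => x _; exact: cu.
have u01 j x : 0 <= u j x <= 1 by exact: (average_01 x h0 (sZ j)).
have w01 x : 0 <= w x <= 1.
  apply/andP; split; [apply: limr_ge|apply: limr_le]; try exact: cu;
    by apply: nearW => j; case/andP: (u01 j x).
have bw : bounded_measurable (w : lebV -> R).
  by split => //; exists 1 => x; have /andP[? ?] := w01 x; rewrite ger0_norm.
have bd j : bounded_measurable ((fun x => `|u j x - w x|) : lebV -> R).
  exact: (bm_norm (bmB (bu j) bw)).
have c0 : \int[leb]_(x in Omega) `|u j x - w x| @[j --> \oo] --> (0 : R).
  rewrite [X in _ --> X](_ : 0 = \int[leb]_(x in Omega) (cst 0 x)); last first.
    by rewrite Rintegral_cst// mul0r.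
  apply: (@bm_dominated_cvg _ lebV R leb Omega mOmega fOmega
    (fun j x => `|u j x - w x|) (cst 0) 1).
  - by move=> j; case: (bd j).
  - exact: measurable_cst.
  - move=> j x; rewrite normr_id ler_norml.
    by have /andP[? ?] := u01 j x; have /andP[? ?] := w01 x; apply/andP; split; lra.
  - move=> x _; apply/norm_cvg0P; apply/subr_cvg0; exact: cu.
have /cvgr0_norm_le/(_ _ e4)[N _ NP] := c0.
exists N => i j Ni Nj.
have bdi k : bounded_measurable ((fun x => `|\1_(Z_ k) x - u k x|) : lebV -> R).
  exact: (bm_norm (bmB (lebesgue_subset_bm (sZ k)) (bu k))).
apply: (@le_trans _ _ (\int[leb]_(x in Omega)
  ((`|\1_(Z_ i) x - u i x| + `|u i x - w x|) + (`|u j x - w x| + `|\1_(Z_ j) x - u j x|)))).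
  apply: (bm_le_Rintegral mOmega fOmega (ldist_bm (sZ i) (sZ j))
    (bmD (bmD (bdi i) (bd i)) (bmD (bd j) (bdi j)))) => x _.
  rewrite (_ : \1_(Z_ i) x - \1_(Z_ j) x = ((\1_(Z_ i) x - u i x) + (u i x - w x)) -
    ((u j x - w x) + (\1_(Z_ j) x - u j x))); last by ring.
  by apply: le_trans (ler_normB _ _) _; apply: lerD; exact: ler_normD.
rewrite (bm_RintegralD mOmega fOmega (bmD (bdi i) (bd i)) (bmD (bd j) (bdi j))).
rewrite (bm_RintegralD mOmega fOmega (bdi i) (bd i)).
rewrite (bm_RintegralD mOmega fOmega (bd j) (bdi j)).
have A k := rP h (Z_ k) h0 (ltW mr) (sZ k) (PZ k).
have Bk k : (N <= k)%N -> \int[leb]_(x in Omega) `|u k x - w x| <= e / 4.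
  by move=> Nk; apply: le_trans (ler_norm _) (NP k Nk).
rewrite (_ : e = (e / 4 + e / 4) + (e / 4 + e / 4)); last by lra.
by apply: lerD; apply: lerD; [exact: A|exact: Bk|exact: Bk|exact: A].
Qed.

(** One diagonal extraction over the countably many triples (sequence, radius, rational point)
    serves all sequences simultaneously; in Helly's argument the sequences are indexed by times. *)
Theorem BV_compact (Z_ : nat -> nat -> set V) (P : nat -> R) :
  (forall k j, sub (Z_ k j)) ->
  (forall k j, (perimeter Omega (Z_ k j) <= (P k)%:E)%E) ->
  exists g : nat -> nat, increasing_seq g /\
    forall k, exists2 Z, sub Z & ldist Omega (Z_ k (g j)) Z @[j --> \oo] --> 0.
Proof.
move=> sZ PZ.
pose x (n j : nat) : R :=
  if (unpickle n : option (nat * (nat * 'rV[rat]_d.+1))) is Some (k, (m, q))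
  then mollify m.+1%:R^-1 (Z_ k j) (map_mx ratr q) else 0.
have [n|g [gi cg]] := diagonal_subsequence (x := x).
  rewrite /x; case: unpickle => [[k [m q]]|]; last by exists 0 => j; rewrite normr0.
  exists (kernel_mass d m.+1%:R^-1) => j; rewrite ger0_norm ?mollify_ge0//.
  by apply: (mollify_le _ _ (sZ k j)); rewrite invr_gt0.
exists g; split => // k; apply: (@BV_cauchy (fun j => Z_ k (g j)) (P k)) => //.
move=> m q; have := cg (pickle (k, (m, q))).
by rewrite /x pickleK.
Qed.

End compactness.

(** * Weak* convergence *)

Section derivative_measures.
Context (R : realType) (d : nat) (Omega : set 'rV[R]_d.+1).
Local Notation V := 'rV[R]_d.+1.
Local Notation borelV := (borelT R d).
Local Notation e_ i := (basis_vector R i).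
Hypotheses (oOmega : open Omega) (bOmega : bounded_set Omega).
Implicit Types (Z : set V) (nu : {charge set borelV -> \bar R}) (phi : V -> R).
Local Notation sub := (lebesgue_subset Omega).

Lemma borel_open (U : set V) : open U -> measurable (U : set borelV).
Proof. by move=> oU; apply: sub_sigma_algebra. Qed.

Lemma continuous_borel_measurable phi : continuous phi ->
  measurable_fun [set: borelV] (phi : borelV -> R).
Proof.
move=> cf; apply: (measurability _ (RGenOpens.measurableE R)).
move=> _ [_ [a [b ->]] <-]; rewrite setTI; apply: borel_open.
by apply: open_comp => // x _; exact: cf.
Qed.

Lemma C0_borel_bm phi : C0 Omega phi -> bounded_measurable (phi : borelV -> R).
Proof.
move=> C0phi; split; first exact: continuous_borel_measurable C0phi.1.
exact: bounded_support_bounded C0phi.1 (C0_bounded_support bOmega C0phi).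
Qed.

Definition hahn_of nu := projT2 (cid (projT2 (cid (Hahn_decomposition nu)))).

Lemma charge_integralE nu phi : charge_integral Omega nu phi =
  \int[jordan_pos (hahn_of nu)]_(x in Omega) phi x -
  \int[jordan_neg (hahn_of nu)]_(x in Omega) phi x.
Proof. by []. Qed.

Lemma finite_measure_lty (mu : {finite_measure set borelV -> \bar R}) (A : set V) :
  measurable (A : set borelV) -> (mu A < +oo)%E.
Proof. by move=> mA; rewrite -ge0_fin_numE// fin_num_measure. Qed.

Let mO : measurable (Omega : set borelV). Proof. exact: borel_open. Qed.
Let fpos nu := @finite_measure_lty (jordan_pos (hahn_of nu)) Omega mO.
Let fneg nu := @finite_measure_lty (jordan_neg (hahn_of nu)) Omega mO.

Lemma charge_integralD nu phi psi : C0 Omega phi -> C0 Omega psi ->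
  charge_integral Omega nu (fun x => phi x + psi x) =
  charge_integral Omega nu phi + charge_integral Omega nu psi.
Proof.
move=> /C0_borel_bm b1 /C0_borel_bm b2; rewrite !charge_integralE.
rewrite (bm_RintegralD mO (fpos nu) b1 b2) (bm_RintegralD mO (fneg nu) b1 b2).
by rewrite opprD addrACA.
Qed.

Lemma charge_integralZ nu phi c : C0 Omega phi ->
  charge_integral Omega nu (fun x => c * phi x) = c * charge_integral Omega nu phi.
Proof.
move=> /C0_borel_bm b1; rewrite !charge_integralE.
rewrite (bm_RintegralZ mO (fpos nu) c b1) (bm_RintegralZ mO (fneg nu) c b1).
by rewrite mulrBr.
Qed.

(** A crude bound by the total mass of [nu]. It makes the integral continuous under uniform
    approximation, which is how the bound by the perimeter is extended to C_0. *)
Lemma charge_integral_bounded nu : exists2 K, 0 <= K & forall phi M,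
  C0 Omega phi -> (forall x, `|phi x| <= M) -> `|charge_integral Omega nu phi| <= K * M.
Proof.
exists (fine (jordan_pos (hahn_of nu) Omega) + fine (jordan_neg (hahn_of nu) Omega)).
  by rewrite addr_ge0// fine_ge0.
move=> phi M /C0_borel_bm b phiM; rewrite charge_integralE mulrC mulrDr.
apply: le_trans (ler_normB _ _) _; apply: lerD.
  exact: (bm_normr_Rintegral_le mO (fpos nu) b (fun x _ => phiM x)).
exact: (bm_normr_Rintegral_le mO (fneg nu) b (fun x _ => phiM x)).
Qed.

Lemma C0Z c phi : C0 Omega phi -> C0 Omega (fun x => c * phi x).
Proof.
move=> [cp p0]; split; last by move=> x Ox; rewrite p0// mulr0.
by apply: row_continuousM => //; exact: cst_continuous.
Qed.

Lemma C0D phi psi : C0 Omega phi -> C0 Omega psi -> C0 Omega (fun x => phi x + psi x).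
Proof.
move=> [cp p0] [cq q0]; split; last by move=> x Ox; rewrite p0// q0// addr0.
exact: row_continuousD.
Qed.

Lemma C0B phi psi : C0 Omega phi -> C0 Omega psi -> C0 Omega (fun x => phi x - psi x).
Proof.
move=> Cp Cq; have := C0D Cp (C0Z (-1) Cq).
by under [in X in X -> _]eq_fun do rewrite mulN1r.
Qed.

Lemma charge_integralB nu phi psi : C0 Omega phi -> C0 Omega psi ->
  charge_integral Omega nu (fun x => phi x - psi x) =
  charge_integral Omega nu phi - charge_integral Omega nu psi.
Proof.
move=> Cp Cq.
have -> : (fun x => phi x - psi x) = (fun x => phi x + -1 * psi x).
  by apply/funext => x; rewrite mulN1r.
by rewrite (charge_integralD _ Cp (C0Z _ Cq)) charge_integralZ// mulN1r.
Qed.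

Lemma distr_partialE i Z nu phi : sub Z -> distr_partial Omega i \1_Z nu ->
  C1c Omega phi -> charge_integral Omega nu phi = - \int[leb]_(x in Z) 'D_(e_ i) phi x.
Proof.
move=> sZ dnu Cphi; have := dnu _ Cphi.
by rewrite (Rintegral_subset _ sZ.2) => ->; rewrite opprK.
Qed.

Lemma charge_integral_C1c_le i Z P nu phi M : sub Z ->
  (perimeter Omega Z <= P%:E)%E -> distr_partial Omega i \1_Z nu ->
  C1c Omega phi -> 0 < M -> (forall x, `|phi x| <= M) ->
  `|charge_integral Omega nu phi| <= P * M.
Proof.
move=> sZ PZ dnu Cphi M0 phiM.
have M1 x : `|M^-1 * phi x| <= 1.
  by rewrite normrM gtr0_norm ?invr_gt0// ler_pdivrMl// mulr1.
have C' := C1cZ M^-1 Cphi.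
have := perimeter_derive oOmega bOmega i sZ PZ C' M1.
rewrite -[leLHS]normrN -(distr_partialE sZ dnu C').
rewrite (charge_integralZ _ _ (C1c_C0 Cphi)) normrM gtr0_norm ?invr_gt0//.
by rewrite ler_pdivrMl// mulrC.
Qed.

(** Unlike the mass of [nu], the constant [P] is uniform along a sequence of sets. For an
    approximation error e/(K+P+1) the two corrections, weighted by [K] and [P], add up to less than
    [e]. *)
Lemma charge_integral_C0_le i Z P nu phi M : sub Z ->
  (perimeter Omega Z <= P%:E)%E -> distr_partial Omega i \1_Z nu ->
  C0 Omega phi -> (forall x, `|phi x| <= M) ->
  `|charge_integral Omega nu phi| <= P * M.
Proof.
move=> sZ PZ dnu Cphi phiM.
have P0 : 0 <= P by rewrite -lee_fin; apply: le_trans PZ; exact: perimeter_ge0.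
have M0 : 0 <= M by exact: le_trans (phiM 0).
have [K K0 HK] := charge_integral_bounded nu.
apply/ler_addgt0Pr => e e0.
have KP : 0 < K + P + 1 by rewrite ltr_wpDl// addr_ge0.
have eK : 0 < e / (K + P + 1) by rewrite divr_gt0.
have /filter_ex[n /= qn] := qi_unif_cvg bOmega Cphi eK.
have Cq := @qi_C1c _ _ Omega n phi.
have h1 : `|charge_integral Omega nu (fun x => qi Omega n phi x - phi x)| <=
    K * (e / (K + P + 1)).
  by apply: HK => //; exact: C0B (C1c_C0 Cq) Cphi.
rewrite (charge_integralB _ (C1c_C0 Cq) Cphi) in h1.
have M1 x : `|qi Omega n phi x| <= M + e / (K + P + 1).
  rewrite -(subrK (phi x) (qi Omega n phi x)).
  by apply: le_trans (ler_normD _ _) _; rewrite addrC lerD.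
have Mp : 0 < M + e / (K + P + 1) by rewrite ltr_wpDl.
have h2 := charge_integral_C1c_le sZ PZ dnu Cq Mp M1.
have h3 : `|charge_integral Omega nu phi| <= K * (e / (K + P + 1)) + P * (M + e / (K + P + 1)).
  rewrite -(subKr (charge_integral Omega nu (qi Omega n phi)) (charge_integral Omega nu phi)).
  by apply: le_trans (ler_normB _ _) _; rewrite addrC lerD.
apply: le_trans h3 _; rewrite mulrDr addrCA lerD2l -mulrDl.
rewrite mulrA ler_pdivrMr// mulrC ler_pM2l//; lra.
Qed.

(** On test functions the derivative is an L1-continuous functional of the set. The uniform
    perimeter bound makes replacing [phi] by its quasi-interpolant cost at most [e / 3], for every
    index and for the limit. *)
Lemma weakstar_of_ldist (Z_ : nat -> set V) Z P :
  (forall j, finite_perimeter Omega (Z_ j)) -> finite_perimeter Omega Z ->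
  (forall j, (perimeter Omega (Z_ j) <= P%:E)%E) ->
  ldist Omega (Z_ j) Z @[j --> \oo] --> 0 ->
  weakstar_SBV Omega Z_ Z.
Proof.
move=> fpZ_ fpZ PZ cZ.
have sZ_ j : sub (Z_ j) by case: (fpZ_ j).
have sZ : sub Z by case: fpZ.
have PZ' : (perimeter Omega Z <= P%:E)%E.
  by apply: (perimeter_lsc oOmega bOmega (M_ := fun=> P) sZ_ sZ cZ PZ); exact: cvg_cst.
have P0 : 0 <= P by rewrite -lee_fin; apply: le_trans PZ'; exact: perimeter_ge0.
split; first by split.
  have -> : (fun j => \int[leb]_(x in Omega) `|\1_(Z_ j) x - \1_Z x|%:E)%E =
      (fun j => (ldist Omega (Z_ j) Z)%:E).
    by apply/funext => j; rewrite (ldistE oOmega bOmega (sZ_ j) sZ).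
  by apply: cvg_EFin => //; exact: nearW.
move=> i nu_ nu dnu_ dnu phi Cphi; apply/cvgrPdist_le => e e0.
have P1 : 0 < P + 1 by rewrite ltr_wpDl.
have e3 : 0 < e / 3 / (P + 1) by rewrite !divr_gt0.
have /filter_ex[n /= qn] := qi_unif_cvg bOmega Cphi e3.
have Cq := @qi_C1c _ _ Omega n phi.
have near_ci nu' Z' : sub Z' -> (perimeter Omega Z' <= P%:E)%E ->
    distr_partial Omega i \1_Z' nu' ->
    `|charge_integral Omega nu' (qi Omega n phi) - charge_integral Omega nu' phi| <= e / 3.
  move=> s' P' dnu'; rewrite -(charge_integralB _ (C1c_C0 Cq) Cphi).
  apply: le_trans (charge_integral_C0_le s' P' dnu' (C0B (C1c_C0 Cq) Cphi) qn) _.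
  rewrite mulrA ler_pdivrMr// mulrC ler_pM2l ?divr_gt0//; lra.
have cq : charge_integral Omega (nu_ j) (qi Omega n phi) @[j --> \oo] -->
    charge_integral Omega nu (qi Omega n phi).
  rewrite (distr_partialE sZ dnu Cq).
  have -> : (fun j => charge_integral Omega (nu_ j) (qi Omega n phi)) =
      (fun j => - \int[leb]_(x in Z_ j) 'D_(e_ i) (qi Omega n phi) x).
    by apply/funext => j; rewrite (distr_partialE (sZ_ j) (dnu_ j) Cq).
  apply: cvgN; exact: (integral_cvg oOmega bOmega sZ_ sZ cZ (C1c_derive_bm bOmega i Cq)).
have e33 : 0 < e / 3 by rewrite divr_gt0.
move/cvgrPdist_le : cq => /(_ _ e33); apply: filterS => j h.
have h1 := near_ci _ _ sZ PZ' dnu; have h2 := near_ci _ _ (sZ_ j) (PZ j) (dnu_ j).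
move: h h1 h2; move: (charge_integral _ _ _) (charge_integral _ _ _)
  (charge_integral _ _ _) (charge_integral _ _ _) => a b c c'.
rewrite !ler_norml => /andP[? ?] /andP[? ?] /andP[? ?]; apply/andP; split; lra.
Qed.

End derivative_measures.

(** * Monotone functions of time *)

Section monotone_functions.
Context (R : realType).
Implicit Types (m : R -> R) (T : R).

(** The retraction of the line onto [0,T]; composition with it makes functions that are monotone on
    [0,T] monotone everywhere. *)
Definition clamp T (t : R) : R := Num.min (Num.max 0 t) T.

Lemma clamp_bounds T t : 0 < T -> 0 <= clamp T t <= T.
Proof.
move=> T0; rewrite /clamp le_min ge_min (ltW T0) lexx orbT !andbT.
by rewrite le_max lexx.
Qed.

Lemma clamp_id T t : 0 <= t <= T -> clamp T t = t.
Proof. by move=> /andP[t0 tT]; rewrite /clamp max_r// min_l. Qed.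

Lemma clamp_le T s t : s <= t -> clamp T s <= clamp T t.
Proof.
move=> st; rewrite /clamp le_min !ge_min lexx orbT andbT; apply/orP; left.
by rewrite ge_max !le_max lexx/= st orbT.
Qed.

Lemma monotone_measurable m T : 0 < T ->
  (forall s t, 0 <= s -> s <= t -> t <= T -> m t <= m s) ->
  measurable_fun `]0, T[%classic m.
Proof.
move=> T0 dm.
apply: (@eq_measurable_fun _ _ _ _ _ (m \o clamp T)).
  by move=> t; rewrite inE/= in_itv/= => /andP[? ?]; rewrite clamp_id// !ltW.
apply: nonincreasing_measurable => // s t st /=.
have /andP[s0 sT] := clamp_bounds s T0; have /andP[t0 tT] := clamp_bounds t T0.
by apply: dm => //; exact: clamp_le.
Qed.

(** A monotone function has one-sided limits, which differ at countably many points only; where they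
    agree, the value lies between them. The modulus is stated on [0,T] to allow comparison times at
    the ends. *)
Lemma monotone_continuity m T : 0 < T ->
  (forall s t, 0 <= s -> s <= t -> t <= T -> m t <= m s) ->
  exists2 N : set R, countable N & forall t, 0 < t < T -> ~ N t -> forall e, 0 < e ->
    exists2 r, 0 < r & forall s, 0 <= s <= T -> `|s - t| < r -> `|m s - m t| <= e.
Proof.
move=> T0 dm.
pose F t := - m (clamp T t).
have ndF s t : s <= t -> F s <= F t.
  move=> st; have /andP[s0 sT] := clamp_bounds s T0.
  have /andP[t0 tT] := clamp_bounds t T0.
  by rewrite lerN2; apply: dm => //; exact: clamp_le.
have ndF0 : {in `[0, T] &, nondecreasing_fun F} by move=> s t _ _; exact: ndF.
exists [set x | x \in (`]0, T[) /\ discontinuity F x].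
  exact: discontinuity_countable ndF0.
move=> t tI /= /not_andP[|]; first by rewrite in_itv/= tI.
move=> nd e e0.
have cl : cvg (F x @[x --> t^'-]).
  apply: nondecreasing_at_left_is_cvgr; apply: nearW => x.
    by move=> ? ? _ _; exact: ndF.
  exists (F t) => _ [s + <-]; rewrite /= in_itv/= => /andP[_ /ltW]; exact: ndF.
have cr : cvg (F x @[x --> t^'+]).
  apply: nondecreasing_at_right_is_cvgr; apply: nearW => x.
    by move=> ? ? _ _; exact: ndF.
  exists (F t) => _ [s + <-]; rewrite /= in_itv/= => /andP[/ltW + _]; exact: ndF.
have E : lim (F x @[x --> t^'-]) = lim (F x @[x --> t^'+]).
  by apply/eqP/negPn/negP => h; apply: nd; split.
set l := lim _ in E.
have l1 : F t <= lim (F x @[x --> t^'+]).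
  apply: limr_ge => //; near=> s; exact/ndF/ltW.
have l2 : l <= F t.
  apply: limr_le => //; near=> s; exact/ndF/ltW.
have lm : l = F t by apply/eqP; rewrite eq_le l2 E l1.
have hl : F x @[x --> t^'-] --> F t by rewrite -lm.
have hr : F x @[x --> t^'+] --> F t by rewrite -lm E.
have /left_right_continuousP/cvgrPdist_le/(_ _ e0) := conj hl hr.
move=> /nbhs_ballP[r /= r0 h]; exists r => // s sI st.
have := h s; rewrite /ball/= distrC => /(_ st).
rewrite /F (clamp_id sI) clamp_id ?opprK 1?addrC//.
by case/andP: tI => /ltW-> /ltW->.
Unshelve. all: by end_near. Qed.

End monotone_functions.

Lemma ae_imply d (S : measurableType d) (R : realType) (mu : {measure set S -> \bar R})
    (P Q : S -> Prop) : (forall x, P x -> Q x) ->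
  {ae mu, forall x, P x} -> {ae mu, forall x, Q x}.
Proof. by move=> PQ; apply: filterS. Qed.

Lemma ae_imply3 d (S : measurableType d) (R : realType) (mu : {measure set S -> \bar R})
    (P Q W N : S -> Prop) : (forall x, P x -> Q x -> W x -> N x) ->
  {ae mu, forall x, P x} -> {ae mu, forall x, Q x} -> {ae mu, forall x, W x} ->
  {ae mu, forall x, N x}.
Proof. by move=> PQ; apply: filterS3. Qed.

(** * Measurability and convergence of functionals depending on time *)

Section time_dependent_functionals.
Context (R : realType) (d : nat) (Omega : set 'rV[R]_d.+1) (T : R).
Local Notation V := 'rV[R]_d.+1.
Local Notation lebV := (lebT R d).
Local Notation e_ i := (basis_vector R i).
Local Notation I := `]0, T[%classic.
Local Notation leb1 := (@lebesgue_measure R).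
Hypotheses (oOmega : open Omega) (bOmega : bounded_set Omega) (T0 : 0 < T).
Let mOmega := domain_measurable oOmega.
Let fOmega := domain_lty bOmega.
Implicit Types (Z : set V) (phi : V -> R) (psi : R -> V -> R).
Local Notation sub := (lebesgue_subset Omega).

(* The two functionals of interest are phi |-> int_(Z t) phi and the integral of
   phi with respect to D_i chi_(Z t); on test functions both are measurable in t
   by monotonicity of Z. *)
Record admissible (L : R -> (V -> R) -> R) (K : R) : Prop := {
  adm_add : forall t, I t -> forall phi1 phi2, C0 Omega phi1 -> C0 Omega phi2 ->
    L t (fun x => phi1 x + phi2 x) = L t phi1 + L t phi2;
  adm_scale : forall t, I t -> forall c phi, C0 Omega phi ->
    L t (fun x => c * phi x) = c * L t phi;
  adm_bound : forall t, I t -> forall phi M, C0 Omega phi ->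
    (forall x, `|phi x| <= M) -> `|L t phi| <= K * M;
  adm_measurable_C1c : forall phi, C1c Omega phi ->
    measurable_fun I (fun t => L t phi) }.

Lemma C0_0 : C0 Omega (fun=> 0 : R).
Proof. by split=> //; exact: cst_continuous. Qed.

Lemma adm_0 L K t : admissible L K -> I t -> L t (fun=> 0) = 0.
Proof.
by move=> aL It; have := adm_scale aL It 0 C0_0; rewrite !mul0r.
Qed.

Lemma adm_sum L K t (J : Type) (s : seq J) (P : pred J) (c : J -> R) (b : J -> V -> R) :
  admissible L K -> I t -> (forall j, P j -> C0 Omega (b j)) ->
  L t (fun x => \sum_(j <- s | P j) c j * b j x) = \sum_(j <- s | P j) c j * L t (b j).
Proof.
move=> aL It Cb.
have [] : C0 Omega (fun x => \sum_(j <- s | P j) c j * b j x) /\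
  L t (fun x => \sum_(j <- s | P j) c j * b j x) = \sum_(j <- s | P j) c j * L t (b j);
  last by [].
elim: s => [|j s [IH1 IH2]].
  under [X in C0 _ X]eq_fun do rewrite big_nil.
  under [X in L t X]eq_fun do rewrite big_nil.
  by rewrite big_nil (adm_0 aL It); split=> //; exact: C0_0.
under [X in C0 _ X]eq_fun do rewrite big_cons.
under [X in L t X]eq_fun do rewrite big_cons.
rewrite big_cons; case: ifPn => [Pj|//].
have Cj : C0 Omega (fun x => c j * b j x) by apply: C0Z; exact: Cb.
by split; [exact: C0D|rewrite (adm_add aL It Cj IH1) IH2 (adm_scale aL It)//; exact: Cb].
Qed.

Lemma adm_sub L K t phi1 phi2 : admissible L K -> I t -> C0 Omega phi1 -> C0 Omega phi2 ->
  L t (fun x => phi1 x - phi2 x) = L t phi1 - L t phi2.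
Proof.
move=> aL It C1 C2.
have -> : (fun x => phi1 x - phi2 x) = (fun x => phi1 x + -1 * phi2 x).
  by apply/funext => x; rewrite mulN1r.
by rewrite (adm_add aL It C1 (C0Z _ C2)) (adm_scale aL It)// mulN1r.
Qed.

(** Quasi-interpolation separates the two ways in which [t] enters: it gives a finite sum of values
    of [psi t] at grid points times [L t] of fixed bumps. The bound [K] carries measurability to the
    limit. *)
Lemma adm_measurable L K psi : admissible L K -> 0 <= K ->
  (forall t, I t -> C0 Omega (psi t)) ->
  (forall x, measurable_fun I (fun t => psi t x)) ->
  measurable_fun I (fun t => L t (psi t)).
Proof.
move=> aL K0 Cpsi mpsi.
apply: (@measurable_fun_cvg _ _ _ _ (fun n t => L t (qi Omega n (psi t)))).
- move=> n.
  pose good (m : {ffun 'I_d.+1 -> 'I_((n.+1 * Omega_radius Omega) + (n.+1 * Omega_radius Omega)).+1}) :=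
    `[< forall y : V, `|y - grid_point n.+1%:R^-1 m| <= n.+1%:R^-1 -> Omega y >].
  apply: (@eq_measurable_fun _ _ _ _ _ (fun t => \sum_(m | good m)
      psi t (grid_point n.+1%:R^-1 m) * L t (hat_bump n.+1%:R^-1 (grid_point n.+1%:R^-1 m)))).
    move=> t /[!inE] It; rewrite -(adm_sum _ _ aL It)//.
    by move=> m /asboolP gm; apply: C1c_C0; apply: hat_bump_C1c.
  have -> : (fun t => \sum_(m | good m)
      psi t (grid_point n.+1%:R^-1 m) * L t (hat_bump n.+1%:R^-1 (grid_point n.+1%:R^-1 m)))
    = (fun t => \sum_(m <- [seq m <- index_enum _ | good m])
      psi t (grid_point n.+1%:R^-1 m) * L t (hat_bump n.+1%:R^-1 (grid_point n.+1%:R^-1 m))).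
    by apply/funext => t; rewrite big_filter.
  have : all good [seq m <- index_enum _ | good m] by exact: filter_all.
  elim: [seq m <- index_enum _ | good m] => [_|m s IH /= /andP[gm gs]].
    under [X in measurable_fun _ X]eq_fun do rewrite big_nil.
    exact: measurable_cst.
  under [X in measurable_fun _ X]eq_fun do rewrite big_cons.
  apply: measurable_funD; last exact: IH.
  apply: measurable_funM; first exact: mpsi.
  apply: (adm_measurable_C1c aL); apply: hat_bump_C1c => //.
  by move/asboolP : gm.
- move=> t It; apply/cvgrPdist_le => e e0.
  have K1 : 0 < K + 1 by rewrite ltr_wpDl.
  have eK : 0 < e / (K + 1) by rewrite divr_gt0.
  have := qi_unif_cvg bOmega (Cpsi t It) eK; apply: filterS => n qn.
  have Cq := C1c_C0 (@qi_C1c _ _ Omega n (psi t)).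
  rewrite distrC -(adm_sub aL It Cq (Cpsi t It)).
  apply: le_trans (adm_bound aL It (C0B Cq (Cpsi t It)) qn) _.
  by rewrite mulrA ler_pdivrMr// mulrC ler_pM2l// lerDl.
Qed.

Definition rational_point (n : nat) : V :=
  if (unpickle n : option 'rV[rat]_d.+1) is Some q then map_mx ratr q else 0.

Lemma rational_point_dense (x : V) (e : R) : 0 < e ->
  exists n, `|rational_point n - x| < e.
Proof.
move=> e0; have [p [q [xpq h]]] := box_rat_nbhs x e0.
exists (pickle q); rewrite /rational_point pickleK; apply: h => i.
by rewrite lexx andbT; have /andP[? ?] := xpq i; rewrite (lt_le_trans (y := x 0 i)).
Qed.

(** A supremum over countably many points is measurable in time, which the dominating function
    requires. *)
Lemma sup_rational_points phi : continuous phi ->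
  ereal_sup (range (fun x => `|phi x|%:E)) = esups (fun n => `|phi (rational_point n)|%:E) 0.
Proof.
move=> cphi; apply/eqP; rewrite eq_le; apply/andP; split.
  apply: ge_ereal_sup => _ [x _ <-]; apply/lee_addgt0Pr => e e0.
  have : \forall y \near x, `|phi x - phi y| < e.
    by move/cvgrPdist_lt : (cphi x); exact.
  move=> /(@nbhs_normP R _ x)[r /= r0 h].
  have [n nr] := rational_point_dense x r0.
  apply: (@le_trans _ _ (`|phi (rational_point n)| + e)%:E).
    rewrite lee_fin -lerBlDl; apply: le_trans (lerB_dist _ _) _.
    by apply/ltW/h; rewrite /= distrC.
  rewrite EFinD leeD2r//; apply: ereal_sup_ubound.
  by exists n.
apply: ge_ereal_sup => _ [n _ <-]; apply: ereal_sup_ubound.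
by exists (rational_point n).
Qed.

Lemma L1_C0_dominating psi : L1_C0 Omega T psi ->
  leb1.-integrable I (fun t => ereal_sup (range (fun x => `|psi t x|%:E))).
Proof.
move=> [Cpsi mpsi ipsi].
have g0 t : (0 <= ereal_sup (range (fun x => `|psi t x|%:E)))%E.
  apply: le_trans (ereal_sup_ubound (x := `|psi t 0|%:E) _); last by exists 0.
  by rewrite lee_fin.
apply/integrableP; split; last by under eq_integral do rewrite gee0_abs//.
apply: (eq_measurable_fun (fun t => esups (fun n => `|psi t (rational_point n)|%:E) 0)).
  by move=> t /[!inE] It; rewrite sup_rational_points//; case: (Cpsi t It).
apply: (measurable_fun_esups (f := fun n t => `|psi t (rational_point n)|%:E)) => n.
by apply/measurable_EFinP; apply: measurableT_comp => //; exact: mpsi.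
Qed.

(** Dominated convergence in time, with [K] times the supremum norm of [psi t] as dominating
    function. *)
Lemma adm_cvg L_ L K psi : (forall j, admissible (L_ j) K) -> admissible L K -> 0 <= K ->
  {ae leb1, forall t, I t -> forall phi, C0 Omega phi -> L_ j t phi @[j --> \oo] --> L t phi} ->
  L1_C0 Omega T psi ->
  \int[leb1]_(t in I) L_ j t (psi t) @[j --> \oo] --> \int[leb1]_(t in I) L t (psi t).
Proof.
move=> aL_ aL K0 cL Lpsi; have [Cpsi mpsi ipsi] := Lpsi.
pose g t := (K%:E * ereal_sup (range (fun x => `|psi t x|%:E)))%E.
apply: (@Rintegral_dominated_cvg _ _ R leb1 I _ _ _ g).
- exact: measurable_itv.
- by move=> j; exact: adm_measurable (aL_ j) K0 Cpsi mpsi.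
- exact: adm_measurable aL K0 Cpsi mpsi.
- by apply: integrableZl; [exact: measurable_itv|exact: L1_C0_dominating].
- move=> j; apply: aeW => t It; have Ct := Cpsi t It.
  have [M psiM] := bounded_support_bounded Ct.1 (C0_bounded_support bOmega Ct).
  pose S := ereal_sup (range (fun x => `|psi t x|%:E)).
  have SM : (S <= M%:E)%E by apply: ge_ereal_sup => _ [x _ <-]; rewrite lee_fin.
  have Sx x : (`|psi t x|%:E <= S)%E by apply: ereal_sup_ubound; exists x.
  have fS : S \is a fin_num.
    rewrite fin_numE; apply/andP; split.
      by apply: contraPneq (Sx 0) => ->; rewrite leeNy_eq.
    by rewrite -ltey; exact: le_lt_trans SM (ltry _).
  rewrite /g -/S -(fineK fS) -EFinM lee_fin.
  by apply: (adm_bound (aL_ j) It Ct) => x; rewrite -lee_fin fineK.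
- by apply: (ae_imply _ cL) => t cLt It; apply: cLt => //; exact: Cpsi.
Qed.

Definition decreasing_family (Z : R -> set V) : Prop :=
  (forall t, 0 <= t <= T -> sub (Z t)) /\
  forall s t, 0 <= s -> s <= t -> t <= T -> ae_subset (Z t) (Z s).

Lemma ae_subset_integral_le A B (f : V -> R) : sub A -> sub B -> ae_subset A B ->
  bounded_measurable (f : lebV -> R) -> (forall x, 0 <= f x) ->
  \int[leb]_(x in A) f x <= \int[leb]_(x in B) f x.
Proof.
move=> sA sB AB bf f0; have [_ [M fM]] := bf.
have sAB := lebesgue_subsetI sA sB.
have bB := lebesgue_subset_bm sB; have bAB := lebesgue_subset_bm sAB.
have d0 : ldist Omega A (A `&` B) = 0.
  rewrite (ldist_setD oOmega bOmega sA sAB).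
  have -> : A `\` (A `&` B) = A `\` B.
    by apply/seteqP; split=> x [Ax] h; split => //; [move=> Bx; exact: h|case].
  have -> : (A `&` B) `\` A = set0 by rewrite -subset0 => x [[]].
  by move: AB; rewrite /ae_subset /null => ->; rewrite measure0 addr0.
have := ldist_integral oOmega bOmega sA sAB bf fM.
rewrite d0 mulr0 normr_le0 subr_eq0 => /eqP ->.
rewrite -(Rintegral_subset f sAB.2) -(Rintegral_subset f sB.2).
apply: (bm_le_Rintegral mOmega fOmega (bmM bAB bf) (bmM bB bf)) => x _.
by rewrite ler_wpM2r// indic_setI ler_piMl.
Qed.

(** Integrals of nonnegative functions over a decreasing family are monotone in [t], and [f] is a
    difference of the nonnegative functions [f + M'] and [M']. *)
Lemma measurable_integral_family (Z : R -> set V) (f : V -> R) : decreasing_family Z ->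
  bounded_measurable (f : lebV -> R) ->
  measurable_fun I (fun t => \int[leb]_(x in Z t) f x).
Proof.
move=> [sZ dZ] bf; have [_ [M fM]] := bf.
pose M' := `|M|.
have fM' x : 0 <= f x + M'.
  have := fM x; rewrite ler_norml => /andP[+ _]; rewrite lerNl => h.
  by rewrite -lerBlDl sub0r (le_trans h)// ler_norm.
have bM : bounded_measurable ((fun=> M') : lebV -> R) by exact: bm_cst.
have mono (g : V -> R) : bounded_measurable (g : lebV -> R) -> (forall x, 0 <= g x) ->
    measurable_fun I (fun t => \int[leb]_(x in Z t) g x).
  move=> bg g0; apply: monotone_measurable => // s t s0 st tT.
  have sT : s <= T by exact: le_trans tT.
  have t0 : 0 <= t by exact: le_trans st.
  apply: ae_subset_integral_le => //; [apply: sZ|apply: sZ|exact: dZ].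
    by rewrite t0.
  by rewrite s0.
apply: (eq_measurable_fun (fun t =>
    \int[leb]_(x in Z t) (f x + M') - \int[leb]_(x in Z t) M')).
  move=> t; rewrite inE/= in_itv/= => /andP[t0 tT].
  have sZt : sub (Z t) by apply: sZ; rewrite !ltW.
  have lZt := lebesgue_subset_lty bOmega sZt.
  by rewrite (bm_RintegralD sZt.1 lZt bf bM) addrK.
exact: (measurable_funB (mono _ (bmD bf bM) fM') (mono _ bM (fun=> normr_ge0 M))).
Qed.

Lemma volume_admissible (Z : R -> set V) : decreasing_family Z ->
  admissible (fun t phi => \int[leb]_(x in Omega) (phi x * \1_(Z t) x)) (fine (leb Omega)).
Proof.
move=> dZ.
have sZ t : I t -> sub (Z t).
  by rewrite /= in_itv/= => /andP[? ?]; apply: dZ.1; rewrite !ltW.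
have bZ t : I t -> bounded_measurable (\1_(Z t) : lebV -> R).
  by move=> /sZ/lebesgue_subset_bm.
split.
- move=> t It p1 p2 C1 C2.
  have b1 := bmM (C0_bm bOmega C1) (bZ t It); have b2 := bmM (C0_bm bOmega C2) (bZ t It).
  rewrite -(bm_RintegralD mOmega fOmega b1 b2); apply: eq_Rintegral => x _.
  by rewrite mulrDl.
- move=> t It c p Cp; have b := bmM (C0_bm bOmega Cp) (bZ t It).
  rewrite -(bm_RintegralZ mOmega fOmega c b); apply: eq_Rintegral => x _.
  by rewrite mulrA.
- move=> t It p M Cp pM; have b := bmM (C0_bm bOmega Cp) (bZ t It).
  rewrite mulrC.
  apply: (bm_normr_Rintegral_le mOmega fOmega b) => x _.
  rewrite normrM; apply: le_trans (pM x); rewrite ler_piMr// indicE.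
  by case: (_ \in _); rewrite /= ?normr1 ?normr0.
- move=> p Cp; apply: (eq_measurable_fun (fun t => \int[leb]_(x in Z t) p x)).
    move=> t /[!inE] It; rewrite -(Rintegral_subset p (sZ t It).2).
    by apply: eq_Rintegral => x _; rewrite mulrC.
  exact: (measurable_integral_family dZ (C0_bm bOmega (C1c_C0 Cp))).
Qed.

Lemma derivative_admissible (Z : R -> set V) P i (nu : R -> {charge set borelT R d -> \bar R}) :
  decreasing_family Z -> (forall t, I t -> (perimeter Omega (Z t) <= P%:E)%E) ->
  (forall t, I t -> distr_partial Omega i \1_(Z t) (nu t)) ->
  admissible (fun t phi => charge_integral Omega (nu t) phi) P.
Proof.
move=> dZ PZ dnu.
have sZ t : I t -> sub (Z t).
  by rewrite /= in_itv/= => /andP[? ?]; apply: dZ.1; rewrite !ltW.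
split.
- by move=> t It p1 p2 C1 C2; exact: charge_integralD.
- by move=> t It c p Cp; exact: charge_integralZ.
- by move=> t It p M Cp pM; apply: (charge_integral_C0_le oOmega bOmega (sZ t It) (PZ t It) (dnu t It)).
- move=> p Cp; apply: (eq_measurable_fun (fun t => - \int[leb]_(x in Z t) 'D_(e_ i) p x)).
    by move=> t /[!inE] It; rewrite (distr_partialE (sZ t It) (dnu t It) Cp).
  exact: (measurable_funN (measurable_integral_family dZ (C1c_derive_bm bOmega i Cp))).
Qed.

Let vol0 : 0 <= fine (leb Omega).
Proof. by apply: fine_ge0; exact: leb_outer_ge0. Qed.

Lemma Linf_SBV_family (Z : R -> set V) P : decreasing_family Z -> 0 <= P ->
  (forall t, I t -> (perimeter Omega (Z t) <= P%:E)%E) -> Linf_SBV Omega T Z.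
Proof.
move=> dZ P0 PZ; split.
- exists P; apply: aeW => t It; have [t0 tT] : 0 < t /\ t < T.
    by move: It; rewrite /= in_itv/= => /andP[].
  split; last exact: PZ.
  split; first by apply: dZ.1; rewrite !ltW.
  by apply: le_lt_trans (PZ t It) _; exact: ltry.
- move=> phi Cphi.
  exact: (adm_measurable (psi := fun=> phi) (volume_admissible dZ) vol0
    (fun _ _ => Cphi) (fun x => measurable_cst _)).
- move=> i nu dnu phi Cphi.
  exact: (adm_measurable (psi := fun=> phi) (derivative_admissible dZ PZ dnu) P0
    (fun _ _ => Cphi) (fun x => measurable_cst _)).
Qed.

Lemma weakstar_Linf_of_ae (Z_ : nat -> R -> set V) (Z : R -> set V) P : 0 <= P ->
  (forall j, decreasing_family (Z_ j)) -> decreasing_family Z ->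
  (forall j t, I t -> (perimeter Omega (Z_ j t) <= P%:E)%E) ->
  (forall t, I t -> (perimeter Omega (Z t) <= P%:E)%E) ->
  {ae leb1, forall t, I t -> weakstar_SBV Omega (fun j => Z_ j t) (Z t)} ->
  weakstar_Linf_SBV Omega T Z_ Z.
Proof.
move=> P0 dZ_ dZ PZ_ PZ wZ; split.
- by split=> [j|]; [exact: (Linf_SBV_family (dZ_ j) P0 (PZ_ j))|exact: Linf_SBV_family dZ P0 PZ].
- move=> psi Lpsi.
  apply: (adm_cvg (fun j => volume_admissible (dZ_ j)) (volume_admissible dZ) vol0 _ Lpsi).
  apply: (ae_imply _ wZ) => t wt It phi Cphi.
  have [[fZ_ fZ] cZ _] := wt It.
  have cl : ldist Omega (Z_ j t) (Z t) @[j --> \oo] --> 0.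
    exact: (fine_cvg cZ).
  have := integral_cvg oOmega bOmega (fun j => (fZ_ j).1) fZ.1 cl (C0_bm bOmega Cphi).
  rewrite -(Rintegral_subset _ fZ.1.2).
  under eq_fun do rewrite -(Rintegral_subset _ (fZ_ _).1.2).
  under eq_fun do under eq_Rintegral do rewrite mulrC.
  by under eq_Rintegral do rewrite mulrC.
- move=> i nu_ nu dnu_ dnu psi Lpsi.
  apply: (adm_cvg (fun j => derivative_admissible (dZ_ j) (PZ_ j) (dnu_ j))
    (derivative_admissible dZ PZ dnu) P0 _ Lpsi).
  apply: (ae_imply _ wZ) => t wt It phi Cphi; have [_ _ h] := wt It.
  by apply: h => //; [move=> j; exact: dnu_|exact: dnu].
Qed.

End time_dependent_functionals.

(** * Convergence in L^q *)

Section bounded_tonelli.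
Context d1 d2 (T1 : measurableType d1) (T2 : measurableType d2) (R : realType).
Variable m1 : {sigma_finite_measure set T1 -> \bar R}.
Variable m2 : {sigma_finite_measure set T2 -> \bar R}.
Context (D1 : set T1) (D2 : set T2) (mD1 : measurable D1) (mD2 : measurable D2)
  (fD1 : (m1 D1 < +oo)%E) (fD2 : (m2 D2 < +oo)%E).

Lemma bm_Tonelli (F : T1 * T2 -> R) : bounded_measurable F -> (forall p, 0 <= F p) ->
  (\int[(m1 \x m2)%E]_(p in D1 `*` D2) (F p)%:E =
   (\int[m1]_(x in D1) (\int[m2]_(y in D2) F (x, y)))%:E)%E.
Proof.
move=> bF F0; pose f p := \1_D1 p.1 * (\1_D2 p.2 * F p).
have bf : bounded_measurable f.
  apply: bmM; first by apply: bm_fst; exact: bm_indic.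
  by apply: bmM => //; apply: bm_snd; exact: bm_indic.
have -> : (\int[(m1 \x m2)%E]_(p in D1 `*` D2) (F p)%:E = \int[(m1 \x m2)%E]_p (f p)%:E)%E.
  rewrite integral_mkcond; apply: eq_integral => -[x y] _.
  rewrite /patch /f /= !indicE in_setX /=.
  by case: (x \in D1); case: (y \in D2); rewrite /= ?mul1r ?mul0r.
rewrite (@fubini_tonelli1 _ _ _ _ _ m1 m2 (EFin \o f)); last 2 first.
- by apply/measurable_EFinP; case: bf.
- by move=> p; rewrite lee_fin /f !mulr_ge0.
have E x : fubini_F m2 (EFin \o f) x = (\1_D1 x * \int[m2]_(y in D2) F (x, y))%:E.
  have bx := bm_pair1 x bF.
  rewrite -(bm_RintegralZ mD2 fD2 _ bx).
  have -> : fubini_F m2 (EFin \o f) x = (\int[m2]_(y in D2) (\1_D1 x * F (x, y))%:E)%E.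
    rewrite [RHS]integral_mkcond; apply: eq_integral => y _.
    by rewrite /patch /f /= (indicE _ D2); case: (y \in D2); rewrite ?mul1r ?mul0r ?mulr0.
  rewrite /Rintegral fineK//; apply: integrable_fin_num => //.
  exact: (bm_integrable mD2 fD2 (bmM (bm_cst _ (\1_D1 x)) bx)).
under eq_integral do rewrite E.
have -> : (\int[m1]_x (\1_D1 x * \int[m2]_(y in D2) F (x, y))%:E =
    \int[m1]_(x in D1) (\int[m2]_(y in D2) F (x, y))%:E)%E.
  rewrite [RHS]integral_mkcond; apply: eq_integral => x _.
  by rewrite /patch indicE; case: (x \in D1); rewrite ?mul1r ?mul0r.
rewrite [in RHS]/Rintegral fineK//; apply: integrable_fin_num => //.
have [_ [M FM]] := bF.
apply: (bm_integrable mD1 fD1); split; first exact: bm_measurable_Rintegral.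
exists (M * fine (m2 D2)) => x.
by apply: (bm_normr_Rintegral_le mD2 fD2 (bm_pair1 x bF)) => y _; exact: FM.
Qed.

End bounded_tonelli.

Section space_time_representative.
Context (R : realType) (d : nat) (Omega : set 'rV[R]_d.+1) (T : R).
Local Notation V := 'rV[R]_d.+1.
Local Notation lebV := (lebT R d).
Local Notation I := `]0, T[%classic.
Local Notation leb1 := (@lebesgue_measure R).
Local Notation timeT := (measurableTypeR R).
Hypotheses (oOmega : open Omega) (bOmega : bounded_set Omega) (T0 : 0 < T).
Let mOmega := domain_measurable oOmega.
Let fOmega := domain_lty bOmega.
Local Notation sub := (lebesgue_subset Omega).
Implicit Types (Z : R -> set V) (A B : set V) (t : R).

(** Only one of the two set differences has mass, so L1 distances within a decreasing family become
    increments of a monotone real function of time. *)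
Lemma ldist_decreasing A B : sub A -> sub B -> ae_subset B A ->
  ldist Omega A B = fine (leb A) - fine (leb B).
Proof.
move=> sA sB BA; rewrite (ldist_setD oOmega bOmega sA sB) BA addr0.
have sAB := sub_setD sA sB; have sBA := sub_setD sB sA.
have b1 := lebesgue_subset_bm sAB; have b2 := lebesgue_subset_bm sBA.
have b3 := lebesgue_subset_bm sA; have b4 := lebesgue_subset_bm sB.
have : fine (leb (A `\` B)) + fine (leb B) = fine (leb A) + fine (leb (B `\` A)).
  rewrite -(indic_integral oOmega sAB) -(indic_integral oOmega sBA).
  rewrite -(indic_integral oOmega sA) -(indic_integral oOmega sB).
  rewrite -(bm_RintegralD mOmega fOmega b1 b4) -(bm_RintegralD mOmega fOmega b3 b2).
  apply: eq_Rintegral => x _; rewrite !indicE !in_setD.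
  by case: (x \in A); case: (x \in B); rewrite /= ?addr0 ?add0r.
by rewrite BA addr0 => <-; rewrite addrK.
Qed.

Lemma ae_subset_measure_le A B : sub A -> sub B -> ae_subset B A ->
  fine (leb B) <= fine (leb A).
Proof.
by move=> sA sB BA; rewrite -subr_ge0 -(ldist_decreasing sA sB BA); exact: ldist_ge0.
Qed.

Lemma null_negligible A : sub A -> null A -> (@leb R d).-negligible A.
Proof. by move=> [mA _] nA; exists A; split. Qed.

Lemma ae_equal_indic A B : sub A -> sub B -> ae_equal A B ->
  {ae (@leb R d), forall x, (\1_A x : R) = \1_B x}.
Proof.
move=> sA sB [AB BA].
have : (@leb R d).-negligible ((A `\` B) `|` (B `\` A)).
  by apply: negligibleU; apply: null_negligible => //; exact: sub_setD.
apply: negligibleS => x /= h; apply: contrapT => n; apply: h.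
rewrite !indicE; have [Ax|Ax] := pselect (A x); have [Bx|Bx] := pselect (B x).
- by rewrite !mem_set.
- by exfalso; apply: n; left.
- by exfalso; apply: n; right.
- by rewrite !memNset.
Qed.

Lemma leb_null_subset A B : A `<=` B -> null B -> null A.
Proof.
by move=> AB nB; apply/eqP; rewrite eq_le leb_outer_ge0 andbT -nB; exact: le_leb_outer.
Qed.

Lemma leb_null_setU A B : null A -> null B -> null (A `|` B).
Proof.
move=> nA nB; apply/eqP; rewrite eq_le leb_outer_ge0 andbT.
by apply: le_trans (outer_measureU2 _ _ _) _; rewrite nA nB adde0.
Qed.

Lemma ae_subset_trans A B C : ae_subset A B -> ae_subset B C -> ae_subset A C.
Proof.
move=> AB BC; apply: leb_null_subset (leb_null_setU AB BC) => x [Ax nC].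
by have [Bx|Bx] := pselect (B x); [right|left].
Qed.

Lemma ae_equal_sym A B : ae_equal A B -> ae_equal B A.
Proof. by case. Qed.

(* Only countably many of the sets [Z t] enter, which makes the union jointly
   measurable; its slices agree with [Z t] wherever t |-> |Z t| is continuous. *)
Definition graph_set Z : set (timeT * lebV) :=
  [set p | exists r : rat, [/\ 0 < p.1, p.1 <= ratr r, ratr r < T & Z (ratr r) p.2]].

Definition slice Z t : set V := [set x | graph_set Z (t, x)].

Lemma graph_set_measurable Z : (forall t, 0 <= t <= T -> sub (Z t)) ->
  measurable (graph_set Z).
Proof.
move=> sZ; have -> : graph_set Z = \bigcup_(r : rat)
    (if (0 < (ratr r : R) < T) then (`]0, ratr r]%classic : set timeT) `*` (Z (ratr r) : set lebV)
     else set0).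
  apply/seteqP; split=> -[t x] /=.
    move=> [r /= [t0 tr rT Zx]]; exists r => //=.
    by rewrite rT (lt_le_trans t0 tr); split; rewrite //= in_itv/= t0.
  move=> [r _]; case: ifPn => // /andP[r0 rT] [/=]; rewrite in_itv/= => /andP[t0 tr] Zx.
  by exists r.
apply: bigcupT_measurable_rat => r; case: ifPn => // /andP[r0 rT].
by apply: measurableX; [exact: measurable_itv|apply: (sZ _ _).1; rewrite !ltW].
Qed.

Lemma sliceE Z t : 0 < t -> slice Z t = \bigcup_(r : rat)
    (if (t <= ratr r) && (ratr r < T) then Z (ratr r) else set0).
Proof.
move=> t0; apply/seteqP; split=> x /=.
  by move=> [r /= [_ tr rT Zx]]; exists r => //=; rewrite tr rT.
by move=> [r _]; case: ifPn => // /andP[tr rT] Zx; exists r.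
Qed.

Lemma slice_sub Z t : (forall t, 0 <= t <= T -> sub (Z t)) -> 0 < t -> sub (slice Z t).
Proof.
move=> sZ t0; rewrite (sliceE _ t0).
have h (r : rat) : (t <= ratr r) && (ratr r < T) -> sub (Z (ratr r)).
  by move=> /andP[tr rT]; apply: sZ; rewrite ltW ?(lt_le_trans t0 tr)//= ltW.
split; first apply: (@bigcupT_measurable_rat _ lebV) => r.
  by case: ifPn => // /h[].
by move=> x [r _]; case: ifPn => // /h[_]; exact.
Qed.

(** The slice is a countable union of sets [Z (ratr r)] with [ratr r >= t], each almost contained in
    [Z t]. What it misses is contained in [Z t] minus any [Z (ratr q)] of the union, which is small
    for rational [q] slightly above a continuity time [t]. *)
Lemma slice_ae_equal Z : decreasing_family Omega T Z ->
  {ae leb1, forall t, I t -> ae_equal (slice Z t) (Z t)}.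
Proof.
move=> [sZ dZ].
have dm s t : 0 <= s -> s <= t -> t <= T -> fine (leb (Z t)) <= fine (leb (Z s)).
  move=> s0 st tT; apply: ae_subset_measure_le; last exact: dZ.
    by apply: sZ; rewrite s0 (le_trans st).
  by apply: sZ; rewrite (le_trans s0).
have [N cN HN] := monotone_continuity T0 dm.
exists N; split.
- exact: countable_measurable.
- exact: countable_lebesgue_measure0.
move=> t /= h; apply: contrapT => Nt; apply: h; rewrite in_itv/= => tI.
have /andP[t0 tT] := tI.
have sZt : sub (Z t) by apply: sZ; rewrite !ltW.
have sS := slice_sub sZ t0.
split.
  apply/(@measure_negligible _ _ _ (@leb R d)); first exact: (sub_setD sS sZt).1.
  rewrite (sliceE _ t0) setD_bigcupl.
  pose G (n : nat) : set V := if (unpickle n : option rat) is Some r then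
    (if (t <= ratr r) && (ratr r < T) then Z (ratr r) else set0) `\` Z t else set0.
  have nG : (@leb R d).-negligible (\bigcup_n G n).
    apply: negligible_bigcup => n; rewrite /G.
    case: unpickle => [r|]; last exact: negligible_set0.
    case: ifPn => [/andP[tr rT]|_]; last by rewrite set0D; exact: negligible_set0.
    apply: null_negligible; last by apply: dZ => //; exact: ltW.
    by apply: sub_setD => //; apply: sZ; rewrite (le_trans (ltW t0) tr) ltW.
  apply: negligibleS nG => x [r _ h].
  by exists (pickle r); [exact: Logic.I|rewrite /G pickleK; exact: h].
apply/eqP; rewrite eq_le leb_outer_ge0 andbT; apply/lee_addgt0Pr => e e0; rewrite add0e.
have [r r0 h] := HN t tI Nt e e0.
have : t < Num.min T (t + r) by rewrite lt_min tT ltrDl.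
move=> /rat_in_itvoo[q]; rewrite in_itv/= lt_min => /and3P[tq qT qr].
have sZq : sub (Z (ratr q)) by apply: sZ; rewrite (le_trans (ltW t0) (ltW tq)) ltW.
apply: (@le_trans _ _ (leb (Z t `\` Z (ratr q)))).
  by apply: le_leb_outer => x [Zx nS]; split => // Zq; apply: nS; exists q; split => //; exact: ltW.
rewrite -(leb_fineK bOmega (sub_setD sZt sZq)) lee_fin.
have ss : ae_subset (Z (ratr q)) (Z t) by apply: dZ; rewrite ?ltW.
have : ldist Omega (Z t) (Z (ratr q)) <= e.
  rewrite (ldist_decreasing sZt sZq ss).
  have : `|fine (leb (Z (ratr q))) - fine (leb (Z t))| <= e.
    apply: h; first by rewrite (le_trans (ltW t0) (ltW tq)) ltW.
    by rewrite gtr0_norm ?subr_gt0// ltrBlDl.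
  by rewrite ler_norml => /andP[+ _]; rewrite lerNl opprB.
by rewrite (ldist_setD oOmega bOmega sZt sZq) ss addr0.
Qed.

Lemma powR01 (q x : R) : 0 < q -> x = 0 \/ x = 1 -> x `^ q = x.
Proof. by move=> q0 [] ->; rewrite ?powR1// powR0// gt_eqF. Qed.

Lemma indicB01 (X : Type) (A B : set X) (x : X) :
  `|\1_A x - \1_B x| = 0 :> R \/ `|\1_A x - \1_B x| = 1 :> R.
Proof.
rewrite !indicE; case: (x \in A); case: (x \in B);
  rewrite /= ?subrr ?normr0 ?subr0 ?sub0r ?normrN ?normr1; by [left|right].
Qed.

Lemma interval_lty : (leb1 I < +oo)%E.
Proof. by rewrite lebesgue_measure_itv /= lte_fin T0 -EFinD ltry. Qed.

Lemma cylinderE : cylinder Omega T = (I : set timeT) `*` (Omega : set lebV).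
Proof. by apply/seteqP; split=> -[t x]; rewrite /cylinder /= in_itv. Qed.

Lemma cylinder_integral (F : timeT * lebV -> R) : bounded_measurable F ->
  (forall p, 0 <= F p) ->
  (\int[(leb1 \x @leb R d)%E]_(p in cylinder Omega T) (F p)%:E =
   (\int[leb1]_(t in I) (\int[leb]_(x in Omega) F (t, x)))%:E)%E.
Proof.
move=> bF F0; rewrite cylinderE.
exact: (@bm_Tonelli _ _ timeT lebV R leb1 (lebs R d) I Omega (measurable_itv _) mOmega
  interval_lty fOmega F bF F0).
Qed.

Lemma graph_set_bm Z : decreasing_family Omega T Z ->
  bounded_measurable (\1_(graph_set Z) : timeT * lebV -> R).
Proof. by move=> [sZ _]; apply: bm_indic; exact: graph_set_measurable. Qed.

Lemma graph_set_representative Z (q : R) : 0 < q -> decreasing_family Omega T Z ->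
  Lq_representative Omega T q (fun t => \1_(Z t)) \1_(graph_set Z).
Proof.
move=> q0 dZ; have bW := graph_set_bm dZ; split.
- by apply: measurable_funTS; case: bW.
- apply: (ae_imply _ (slice_ae_equal dZ)) => t St It.
  have t01 : 0 < t < T by move: It; rewrite /= in_itv.
  have sS : sub (slice Z t) by apply: slice_sub dZ.1 _; case/andP: t01.
  have sZt : sub (Z t) by apply: dZ.1; case/andP: t01 => *; rewrite !ltW.
  apply: (ae_imply _ (ae_equal_indic sS sZt (St It))) => x <- _.
  by rewrite /slice !indicE; congr ((_ : bool)%:R); apply/idP/idP; rewrite !inE.
- have -> : (fun p : timeT * lebV => (`|\1_(graph_set Z) p| `^ q)%:E) =
      (fun p => (\1_(graph_set Z) p : R)%:E).
    apply/funext => p; rewrite ger0_norm// powR01// indicE.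
    by case: (_ \in _); [right|left].
  by rewrite (cylinder_integral bW)// ltry.
Qed.

Lemma powR_cvg0 (u : nat -> R) (s : R) : 0 < s -> (forall j, 0 <= u j) ->
  u j @[j --> \oo] --> 0 -> u j `^ s @[j --> \oo] --> 0.
Proof.
move=> s0 u0 cu; apply/cvgrPdist_le => e e0.
have es : 0 < e `^ s^-1 by rewrite powR_gt0.
move/cvgrPdist_le : cu => /(_ _ es); apply: filterS => j.
rewrite !sub0r !normrN ger0_norm// ger0_norm ?powR_ge0// => h.
rewrite -[leRHS](powRr1 (ltW e0)) -(mulVf (lt0r_neq0 s0)).
rewrite powRrM; apply: (ge0_ler_powR (ltW s0)) => //; rewrite nnegrE//.
exact: powR_ge0.
Qed.

(** A difference of indicators has modulus 0 or 1, so its power does not depend on [q] and the claim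
    reduces to L1; there the slicewise distances are dominated by the volume of [Omega]. *)
Lemma Lq_cvg_of_ae (Z_ : nat -> R -> set V) Z (q : R) : 1 <= q ->
  (forall j, decreasing_family Omega T (Z_ j)) -> decreasing_family Omega T Z ->
  {ae leb1, forall t, I t -> ldist Omega (Z_ j t) (Z t) @[j --> \oo] --> 0} ->
  Lq_cvg Omega T q (fun j t => \1_(Z_ j t)) (fun t => \1_(Z t)).
Proof.
move=> q1 dZ_ dZ cZ; have q0 : 0 < q by exact: lt_le_trans q1.
exists (fun j => \1_(graph_set (Z_ j))), \1_(graph_set Z); split.
- by move=> j; exact: graph_set_representative.
- exact: graph_set_representative.
pose F j (p : timeT * lebV) := `|\1_(graph_set (Z_ j)) p - \1_(graph_set Z) p| : R.
have bF j : bounded_measurable (F j).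
  exact: (bm_norm (bmB (graph_set_bm (dZ_ j)) (graph_set_bm dZ))).
have F0 j p : 0 <= F j p by exact: normr_ge0.
have F1 j p : F j p <= 1 by rewrite /F; case: (indicB01 (graph_set (Z_ j)) (graph_set Z) p) => ->.
pose D j := \int[leb1]_(t in I) (\int[leb]_(x in Omega) F j (t, x)).
have E j : (\int[(leb1 \x @leb R d)%E]_(y in cylinder Omega T)
    (`|\1_(graph_set (Z_ j)) y - \1_(graph_set Z) y| `^ q)%:E = (D j)%:E)%E.
  rewrite -(cylinder_integral (bF j) (F0 j)); congr (integral _ _ _).
  by apply/funext => p; rewrite powR01//; exact: indicB01.
under eq_fun do rewrite E poweR_EFin.
apply: cvg_EFin; first exact: nearW.
apply: powR_cvg0; first by rewrite invr_gt0.
  by move=> j; apply: Rintegral_ge0 => t _; apply: Rintegral_ge0 => x _.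
have -> : (0 : R) = \int[leb1]_(t in I) (0 : R) by rewrite Rintegral_cst// mul0r.
have Fle j (t : R) : `|\int[leb]_(x in Omega) F j (t, x)| <= 1 * fine (leb Omega).
  apply: (bm_normr_Rintegral_le mOmega fOmega (bm_pair1 (t : timeT) (bF j))) => x _.
  by rewrite ger0_norm.
apply: (@Rintegral_dominated_cvg _ timeT R leb1 I (measurable_itv _) _ _
  (EFin \o cst (1 * fine (leb Omega)))).
- move=> j; apply: measurable_funTS.
  exact: (@bm_measurable_Rintegral _ _ timeT lebV R (lebs R d) Omega mOmega fOmega _ (bF j)).
- exact: measurable_cst.
- by apply: (@bm_integrable _ timeT R leb1 I (measurable_itv _) interval_lty); exact: bm_cst.
- by move=> j; apply: aeW => t _; rewrite lee_fin; exact: Fle.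
have aeS : {ae leb1, forall t, forall j, I t -> ae_equal (slice (Z_ j) t) (Z_ j t)}.
  by apply: ae_foralln => j; exact: slice_ae_equal.
apply: (ae_imply3 _ aeS (slice_ae_equal dZ) cZ) => t h1 h2 h3 It.
have t01 : 0 < t < T by move: It; rewrite /= in_itv.
have t0 : 0 < t by case/andP: t01.
have tT : 0 <= t <= T by case/andP: t01 => *; rewrite !ltW.
have D0 A B : sub A -> sub B -> ae_equal A B -> ldist Omega A B = 0.
  by move=> sA sB AB; apply/ldist_ae_equal.
have sS := slice_sub dZ.1 t0; have sZ := dZ.1 t tT.
apply: (@squeeze_cvgr _ _ _ _ (fun=> 0) (fun j => ldist Omega (Z_ j t) (Z t))).
- apply: nearW => j.
  have sSj := slice_sub (dZ_ j).1 t0; have sZj := (dZ_ j).1 t tT.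
  have -> : \int[leb]_(x in Omega) F j (t, x) = ldist Omega (slice (Z_ j) t) (slice Z t).
    apply: eq_Rintegral => x _; rewrite /F !indicE /slice.
    by congr (`|(_ : bool)%:R - (_ : bool)%:R|); apply/idP/idP; rewrite !inE.
  rewrite ldist_ge0//=.
  apply: le_trans (ldist_triangle oOmega bOmega sSj sZj sS) _.
  rewrite (D0 _ _ sSj sZj (h1 j It)) add0r.
  apply: le_trans (ldist_triangle oOmega bOmega sZj sZ sS) _.
  by rewrite (D0 _ _ sZ sS (ae_equal_sym (h2 It))) addr0.
- exact: cvg_cst.
- exact: h3 It.
Qed.

End space_time_representative.

(** * Loading and energy *)

Section loading.
Context (R : realType) (d : nat) (Omega : set 'rV[R]_d.+1) (T : R).
Context (F : R -> set 'rV[R]_d.+1) (f : R -> 'rV[R]_d.+1 -> R).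
Local Notation V := 'rV[R]_d.+1.
Local Notation lebV := (lebT R d).
Local Notation leb1 := (@lebesgue_measure R).
Hypotheses (oOmega : open Omega) (bOmega : bounded_set Omega) (T0 : 0 < T).
Hypothesis ld : loading Omega T F f.
Let mOmega := domain_measurable oOmega.
Local Notation sub := (lebesgue_subset Omega).
Implicit Types (A B : set V) (s t : R).

(** A set of full measure meets every neighbourhood of a point of [0,T]; it carries properties of
    the load from almost every time to every time. *)
Lemma ae_dense (P : R -> Prop) : {ae leb1, forall t, 0 < t < T -> P t} ->
  forall t r, 0 <= t <= T -> 0 < r -> exists s, [/\ 0 < s < T, `|s - t| < r & P s].
Proof.
move=> [N [mN N0 NP]] t r /andP[t0 tT] r0.
pose lo := Num.max 0 (t - r); pose hi := Num.min T (t + r).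
have lohi : lo < hi.
  rewrite /lo /hi lt_min !gt_max T0/= ltrBlDr (le_lt_trans tT) ?ltrDl//=.
  by rewrite ltr_wpDl//= ltrBlDr -addrA ltrDl addr_gt0.
have [s [sI Ns]] : exists s, `]lo, hi[%classic s /\ ~ N s.
  apply: contrapT => h.
  have IN : `]lo, hi[%classic `<=` N.
    by move=> s sI; apply: contrapT => nN; apply: h; exists s.
  have : (leb1 `]lo, hi[%classic <= leb1 N)%E by apply: le_measure; rewrite ?inE.
  by rewrite N0 lebesgue_measure_itv /= lte_fin lohi -EFinD lee_fin subr_le0 leNgt lohi.
move: sI; rewrite /= in_itv/= /lo /hi gt_max lt_min => /andP[/andP[s0 sl] /andP[sT su]].
exists s; split; first by rewrite s0.
  by rewrite ltr_norml; apply/andP; split; lra.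
by apply: contrapT => nP; apply: Ns; apply: NP => /= h; apply: nP; apply: h; rewrite s0.
Qed.

Let fint t : 0 <= t <= T -> leb.-integrable Omega (EFin \o f t).
Proof. by move=> tI; case: ld => _ _ [h _ _] _; exact: h. Qed.

Definition load_distance s t : R := \int[leb]_(x in Omega) `|f s x - f t x|.

Let dint s t : 0 <= s <= T -> 0 <= t <= T ->
  leb.-integrable Omega (EFin \o (fun x : lebV => `|f s x - f t x|)).
Proof.
move=> sI tI; have := integrableB mOmega (fint sI) (fint tI).
by move=> /integrable_abse.
Qed.

Lemma load_distance_cvg t e : 0 <= t <= T -> 0 < e ->
  exists2 r, 0 < r & forall s, 0 <= s <= T -> `|s - t| < r -> load_distance s t <= e.
Proof.
move=> tI e0; case: ld => _ _ [_ /(_ t tI) h _] _.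
have /(_ (within_filter _ _))/cvgrPdist_le/(_ _ e0) := fine_cvg h.
move=> /nbhs_ballP[r /= r0 H]; exists r => // s sI st.
have := H s; rewrite /ball/= distrC => /(_ st).
rewrite in_itv/= => /(_ sI); rewrite sub0r normrN.
exact: le_trans (ler_norm (load_distance s t)).
Qed.

(** At a nearby good time [s] the negative part of [f t] is at most [|f s - f t|] almost everywhere,
    and the L1 norm of the latter tends to 0. *)
Lemma loading_ge0 t : 0 <= t <= T -> {ae (@leb R d), forall x, Omega x -> 0 <= f t x}.
Proof.
move=> tI; have [_ _ _ good] := ld.
pose g (x : V) := Num.max 0 (- f t x).
have gint : leb.-integrable Omega (EFin \o (g : lebV -> R)).
  apply: (le_integrable mOmega _ _ (integrable_abse (fint tI))) => /=.
    apply/measurable_EFinP; apply: measurable_maxr; first exact: measurable_cst.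
    by apply: measurable_funN; apply/measurable_EFinP; exact: measurable_int (fint tI).
  move=> x _; rewrite lee_fin /g ger0_norm; last by rewrite le_max lexx.
  by rewrite normr_id ge_max normr_ge0 -normrN ler_norm.
have g0 : \int[leb]_(x in Omega) g x = 0.
  apply/eqP; rewrite eq_le; apply/andP; split; last first.
    by apply: Rintegral_ge0 => x _; rewrite le_max lexx.
  apply/ler_addgt0Pr => e e0; rewrite add0r.
  have [r r0 hr] := load_distance_cvg tI e0.
  have [s [sI st [fs0 _]]] := ae_dense good tI r0.
  have sI' : 0 <= s <= T by case/andP: sI => *; rewrite !ltW.
  apply: le_trans (hr s sI' st).
  rewrite /Rintegral fine_le//; [exact: (integrable_fin_num _ gint)|
    exact: (integrable_fin_num _ (dint sI' tI))|].
  have pos x : Omega x -> (0 <= (g x)%:E)%E by rewrite lee_fin le_max lexx.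
  have posd x : Omega x -> (0 <= `|f s x - f t x|%:E)%E by rewrite lee_fin.
  apply: (ae_ge0_le_integral mOmega pos (measurable_int _ gint) posd
    (measurable_int _ (dint sI' tI))).
  apply: (ae_imply _ fs0) => x h Ox; rewrite lee_fin ge_max normr_ge0/=.
  by apply: le_trans (ler_norm _); have := h Ox; lra.
have : ae_eq leb Omega (EFin \o (g : lebV -> R)) (cst 0%E).
  apply/(ae_eq_integral_abs _ mOmega); first exact: measurable_int gint.
  have -> : (\int[leb]_(x in Omega) `|(EFin \o g) x| = \int[leb]_(x in Omega) (g x)%:E)%E.
    by apply: eq_integral => x _; rewrite /= ger0_norm// le_max lexx.
  by rewrite -(fineK (integrable_fin_num mOmega gint)) -/(Rintegral _ _ _) g0.
apply: ae_imply => x h Ox; have := h Ox => /= -[].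
by rewrite /g => h'; rewrite -oppr_le0 -h' le_max lexx orbT.
Qed.

(** A representative of [f t] that is nonnegative everywhere and vanishes outside [Omega], so that
    pointwise comparisons hold without exceptional sets. *)
Definition load_density t : V -> R := (fun x => Num.max 0 (f t x)) \_ Omega.

Lemma load_density_ge0 t x : 0 <= load_density t x.
Proof. by rewrite /load_density patchE; case: ifPn => // _; rewrite le_max lexx. Qed.

Lemma load_density_integrable t : 0 <= t <= T ->
  leb.-integrable setT (EFin \o (load_density t : lebV -> R)).
Proof.
move=> tI.
have gint : leb.-integrable Omega (EFin \o (fun x : lebV => Num.max 0 (f t x))).
  apply: (le_integrable mOmega _ _ (fint tI)) => /=.
    apply/measurable_EFinP; apply: measurable_maxr; first exact: measurable_cst.
    by apply/measurable_EFinP; exact: measurable_int (fint tI).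
  move=> x _; rewrite lee_fin ger0_norm; last by rewrite le_max lexx.
  by rewrite ge_max normr_ge0 ler_norm.
have := (integrable_mkcond _ mOmega).1 gint.
apply: eq_integrable => // x _; rewrite /load_density /= !patchE.
by case: ifP.
Qed.

Definition load t A : R := \int[leb]_(x in A) load_density t x.

Let lint t A : 0 <= t <= T -> measurable (A : set lebV) ->
  leb.-integrable A (EFin \o (load_density t : lebV -> R)).
Proof. by move=> tI mA; apply: integrableS (load_density_integrable tI). Qed.

Lemma load_ge0 t A : 0 <= load t A.
Proof. by apply: Rintegral_ge0 => x _; exact: load_density_ge0. Qed.

Lemma load_split t A B : 0 <= t <= T -> sub A -> sub B ->
  load t A = load t (A `&` B) + load t (A `\` B).
Proof.
move=> tI [mA _] [mB _]; have mI := measurableI _ _ mA mB; have mD := measurableD mA mB.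
rewrite /load -{1}(setUIDK A B) Rintegral_setU//.
  by rewrite setUIDK; exact: lint.
by rewrite disj_set2E; apply/eqP; rewrite -subset0 => x [[_ Bx] [_]].
Qed.

Lemma load_null t A : 0 <= t <= T -> sub A -> null A -> load t A = 0.
Proof.
move=> tI [mA _] nA.
by rewrite /load /Rintegral (null_set_integral mA (measurable_int _ (lint tI mA)) nA).
Qed.

Lemma load_time s t A : 0 <= s <= T -> 0 <= t <= T -> sub A ->
  load t A <= load s A + load_distance s t.
Proof.
move=> sI tI [mA AO].
have iA : leb.-integrable A (EFin \o (fun x : lebV => `|f s x - f t x|)).
  exact: integrableS mOmega mA AO (dint sI tI).
apply: (@le_trans _ _ (load s A + \int[leb]_(x in A) `|f s x - f t x|)).
  rewrite -(RintegralD mA (lint sI mA) iA).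
  apply: (le_Rintegral mA (lint tI mA)).
    by have := integrableD mA (lint sI mA) iA.
  move=> x /AO Ox; rewrite /load_density !patchE (mem_set Ox).
  have := ler_norm (f t x - f s x); rewrite distrC.
  have := normr_ge0 (f s x - f t x); move: (`|_|) => n n0 h.
  have := le_max 0 0 (f s x); have := le_max (f s x) 0 (f s x); rewrite !lexx orbT /=.
  by move=> h1 h2; rewrite ge_max; apply/andP; split; lra.
rewrite lerD2l /Rintegral fine_le//; [exact: (integrable_fin_num mA iA)|
  exact: (integrable_fin_num mOmega (dint sI tI))|].
have posd x : Omega x -> (0 <= `|f s x - f t x|%:E)%E by rewrite lee_fin.
exact: (ge0_subset_integral _ mA mOmega (measurable_int _ (dint sI tI)) posd AO).
Qed.

Lemma load_small t e : 0 <= t <= T -> 0 < e ->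
  exists2 r, 0 < r & forall A, sub A -> fine (leb A) < r -> load t A <= e.
Proof.
move=> tI e0.
have [r [r0 h]] := integral_normr_continuous (load_density_integrable tI) e0.
exists r => // A sA Ar.
have -> : load t A = \int[leb]_(x in A) `|load_density t x|.
  by apply: eq_Rintegral => x _; rewrite ger0_norm// load_density_ge0.
by apply/ltW/h; [exact: sA.1|rewrite -(leb_fineK bOmega sA) lte_fin].
Qed.

(** By [load_time] the load of all of [Omega] is continuous in time and attains a maximum on
    [0,T]. *)
Lemma load_bounded : exists2 C, 0 <= C & forall t A, 0 <= t <= T -> sub A -> load t A <= C.
Proof.
pose H t := load t Omega.
have sO : sub Omega by split.
have cH : {within `[0, T], continuous H}.
  apply/subspace_continuousP => t; rewrite /= in_itv/= => tI.
  apply/cvgrPdist_le => e e0; have [r r0 h] := load_distance_cvg tI e0.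
  apply/nbhs_ballP; exists r => // s; rewrite /ball/= distrC in_itv/= => st sI.
  have h1 := load_time sI tI sO; have h2 := load_time tI sI sO.
  have dE : load_distance t s = load_distance s t.
    by apply: eq_Rintegral => x _; rewrite distrC.
  have := h s sI st; rewrite dE in h2.
  rewrite -[from_subspace _ _ _]/(load t Omega) -[from_subspace _ _ s]/(load s Omega).
  move: h1 h2.
  move: (load t _) (load s _) (load_distance _ _) => x y z *.
  by rewrite ler_norml; apply/andP; split; lra.
have [c _ hc] := EVT_max (ltW T0) cH.
exists (H c); first exact: load_ge0.
move=> t A tI sA; apply: (@le_trans _ _ (H t)); last by apply: hc; rewrite in_itv.
rewrite /H (load_split tI sO sA) (setIidr sA.2) lerDl; exact: load_ge0.
Qed.

Lemma load_energyE m t A : 0 <= t <= T -> sub A ->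
  load_energy Omega F f (Some m) t A = (m%:R * load t A)%:E.
Proof.
move=> tI sA; have [mA AO] := sA; rewrite /load_energy.
have -> : (\int[leb]_(x in Omega) (m%:R * f t x * \1_A x)%:E =
    \int[leb]_(x in A) (m%:R * f t x)%:E)%E.
  rewrite integral_mkcond [RHS]integral_mkcond; apply: eq_integral => x _.
  rewrite !patchE indicE; have [Ax|Ax] := boolP (x \in A); rewrite ?mulr1 ?mulr0.
    by rewrite mem_set//; apply: AO; rewrite inE in Ax.
  by case: ifP.
have -> : (\int[leb]_(x in A) (m%:R * f t x)%:E =
    \int[leb]_(x in A) (m%:R * load_density t x)%:E)%E.
  apply: (ae_eq_integral (fun x : lebV => (m%:R * load_density t x)%:E) _ mA).
  - apply/measurable_EFinP; apply: measurable_funM; first exact: measurable_cst.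
    apply/measurable_EFinP; apply: measurable_int (integrableS mOmega mA AO (fint tI)).
  - apply/measurable_EFinP; apply: measurable_funM; first exact: measurable_cst.
    by apply/measurable_EFinP; exact: measurable_int (lint tI mA).
  apply: (ae_imply _ (loading_ge0 tI)) => x h /AO Ox.
  by rewrite /load_density patchE (mem_set Ox) max_r// h.
rewrite -(RintegralZl _ mA (lint tI mA)) /Rintegral fineK//.
apply: integrable_fin_num => //.
exact: (integrableZl mA m%:R (lint tI mA)).
Qed.

End loading.

Section load_energy.
Context (R : realType) (d : nat) (Omega : set 'rV[R]_d.+1) (T : R).
Context (F : R -> set 'rV[R]_d.+1) (f : R -> 'rV[R]_d.+1 -> R) (k : option nat).
Local Notation V := 'rV[R]_d.+1.
Hypotheses (oOmega : open Omega) (bOmega : bounded_set Omega) (T0 : 0 < T).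
Hypothesis ld : loading Omega T F f.
Local Notation sub := (lebesgue_subset Omega).
Local Notation J := (load_energy Omega F f k).
Implicit Types (A B : set V) (s t : R).

Lemma leb_null_set0 : null (set0 : set V).
Proof. exact: leb_outer0. Qed.

Lemma lebesgue_subset_set0 : sub set0.
Proof. by split; [exact: measurable0|move=> x []]. Qed.

Lemma load_energy_ge0 t A : 0 <= t <= T -> sub A -> (0 <= J t A)%E.
Proof.
move=> tI sA; case: k => [m|] /=; last by case: ifP.
rewrite -[leRHS]/(load_energy Omega F f (Some m) t A).
rewrite (load_energyE oOmega T0 ld m tI sA) lee_fin mulr_ge0//; exact: load_ge0.
Qed.

(** Additivity holds for the constraint with values 0 and infinity as well, because a union of two
    sets is null exactly when both are; both kinds of load can then be treated alike. *)
Lemma load_energy_split t A B : 0 <= t <= T -> sub A -> sub B ->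
  J t A = (J t (A `&` B) + J t (A `\` B))%E.
Proof.
move=> tI sA sB; have sI := lebesgue_subsetI sA sB; have sD := sub_setD sA sB.
case: k => [m|].
  rewrite !(load_energyE oOmega T0 ld m tI)// -EFinD -mulrDr.
  by rewrite (load_split oOmega ld tI sA sB).
rewrite /load_energy; case: ifPn => [/asboolP nA|/asboolPn nA].
  have n1 : null (A `&` B `&` F t) by apply: leb_null_subset nA => x [[]].
  have n2 : null ((A `\` B) `&` F t) by apply: leb_null_subset nA => x [[]].
  by rewrite (asboolT n1) (asboolT n2) adde0.
case: ifPn => [/asboolP n1|_]; last by case: ifP.
rewrite ifN ?add0e//; apply/asboolPn => n2; apply: nA.
apply: leb_null_subset (leb_null_setU n1 n2) => x [Ax Fx].
by have [Bx|Bx] := pselect (B x); [left|right].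
Qed.

Lemma load_energy_null t A : 0 <= t <= T -> sub A -> null A -> J t A = 0%E.
Proof.
move=> tI sA nA; case: k => [m|].
  by rewrite (load_energyE oOmega T0 ld m tI)// (load_null oOmega ld tI sA nA) mulr0.
by rewrite /load_energy asboolT//; apply: leb_null_subset nA => x [].
Qed.

Lemma load_energy_le t A B : 0 <= t <= T -> sub A -> sub B -> ae_subset A B ->
  (J t A <= J t B)%E.
Proof.
move=> tI sA sB AB; have sAB := sub_setD sA sB.
rewrite (load_energy_split tI sA sB) (load_energy_null tI sAB AB) adde0.
rewrite (load_energy_split tI sB sA) setIC leeDl//.
by apply: load_energy_ge0 => //; exact: sub_setD.
Qed.

Lemma load_sub t : 0 <= t <= T -> sub (F t).
Proof.
move=> tI; have [h _ _ _] := ld; have [oF FO] := h t tI.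
by split => //; exact: lebesgue_open_measurable.
Qed.

(** A left interpolant minimizes at the next node, while property (G) evaluates its energy at the
    earlier time [s]. For finite [k] the load is bounded outright; for [k = None] the sets [F]
    increase, so the constraint is inherited with constant 0. *)
Lemma load_energy_time : exists2 C, 0 <= C & forall s t A,
  0 <= s -> s <= t -> t <= T -> sub A -> (J s A <= J t A + C%:E)%E.
Proof.
case: k => [m|].
  have [C C0 hC] := load_bounded oOmega T0 ld.
  exists (m%:R * C); first by rewrite mulr_ge0.
  move=> s t A s0 st tT sA.
  have sI : 0 <= s <= T by rewrite s0 (le_trans st).
  have tI : 0 <= t <= T by rewrite (le_trans s0).
  rewrite !(load_energyE oOmega T0 ld m)// -EFinD lee_fin.
  apply: (@le_trans _ _ (m%:R * C)); first by rewrite ler_wpM2l// hC.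
  by rewrite lerDr mulr_ge0//; exact: load_ge0.
exists 0 => // s t A s0 st tT sA; rewrite adde0 /load_energy.
case: (ifPn `[< null (A `&` F t) >]) => [/asboolP nA|_]; last by rewrite leey.
rewrite asboolT//; have [_ Fle _ _] := ld.
apply: leb_null_subset (leb_null_setU nA (Fle s t s0 st tT)) => x [Ax Fx].
by have [Fx'|Fx'] := pselect (F t x); [left|right].
Qed.

(* The times approach t from above: for k = None this matters, since only then
   is F t contained in F (t_ j). *)
Lemma load_energy_lsc (t_ : nat -> R) t (D_ : nat -> set V) D (M_ : nat -> R) M :
  0 <= t -> (forall j, t <= t_ j <= T) -> t_ j @[j --> \oo] --> t ->
  (forall j, sub (D_ j)) -> sub D -> ldist Omega (D_ j) D @[j --> \oo] --> 0 ->
  (forall j, (J (t_ j) (D_ j) <= (M_ j)%:E)%E) -> M_ j @[j --> \oo] --> M ->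
  (J t D <= M%:E)%E.
Proof.
move=> t0 tt_ ct sD_ sD cD JM cM.
have tI : 0 <= t <= T by rewrite t0; have /andP[h1 h2] := tt_ 0%N; exact: le_trans h2.
have tjI j : 0 <= t_ j <= T.
  by have /andP[h1 ->] := tt_ j; rewrite (le_trans t0).
case: k JM => [m|] JM; last first.
  have M0 : 0 <= M.
    apply: (cvg_le_limit (u := fun=> 0) _ cM) => [|j]; first exact: cvg_cst.
    rewrite -lee_fin; apply: le_trans (JM j).
    by rewrite /load_energy /=; case: ifP => _; rewrite ?lexx ?leey.
  have n_ j : null (D_ j `&` F t).
    have := JM j; rewrite /load_energy; case: ifPn => [/asboolP nA _|_]; last by rewrite leye_eq.
    have [_ Fle _ _] := ld; have /andP[h1 h2] := tt_ j.
    apply: leb_null_subset (leb_null_setU nA (Fle t (t_ j) t0 h1 h2)) => x [Dx Fx].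
    by have [Fx'|Fx'] := pselect (F (t_ j) x); [left|right].
  suff nD : null (D `&` F t) by rewrite /load_energy asboolT// lee_fin.
  have sF := load_sub tI.
  have sDF := lebesgue_subsetI sD sF.
  have D0 A : sub A -> ldist Omega A set0 = fine (leb A).
    move=> sA; rewrite (ldist_setD oOmega bOmega sA lebesgue_subset_set0).
    by rewrite setD0 set0D measure0 addr0.
  (* Since each [D_ j] misses [F t], the volume of [D] inside [F t] is at most the distance of
     [D_ j] to [D]. *)
  have : ldist Omega (D `&` F t) set0 <= 0.
    apply: (cvg_le_limit (u := fun=> ldist Omega (D `&` F t) set0) _ cD) => [|j].
      exact: cvg_cst.
    have sDjF := lebesgue_subsetI (sD_ j) sF.
    apply: le_trans (ldist_triangle oOmega bOmega sDF sDjF lebesgue_subset_set0) _.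
    rewrite (D0 _ sDjF) n_ addr0 ldistC.
    exact: (ldist_setI oOmega bOmega (sD_ j) sD sF).
  rewrite (D0 _ sDF) => h; rewrite /null -(leb_fineK bOmega sDF); congr (_%:E).
  by apply/eqP; rewrite eq_le h fine_ge0// leb_outer_ge0.
rewrite (load_energyE oOmega T0 ld m tI sD) lee_fin.
apply/ler_addgt0Pr => e e0.
have m1 : 0 < m%:R + 1 :> R by rewrite ltr_wpDl.
(* Time shift and set difference each enter multiplied by [m], hence cost less than [e / 3]; the
   last third is the distance of [M_ j] to [M]. The summand 1 covers [m = 0]. *)
have em : 0 < e / 3 / (m%:R + 1) by rewrite !divr_gt0.
have e3 : 0 < e / 3 by rewrite divr_gt0.
have [r1 r10 h1] := load_distance_cvg ld tI em.
have [r2 r20 h2] := load_small oOmega bOmega ld tI em.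
move/cvgrPdist_lt : ct => /(_ _ r10) n1.
move/cvgrPdist_lt : cD => /(_ _ r20) n2.
move/cvgrPdist_lt : cM => /(_ _ e3) n3.
have [j [j1 j2 j3]] : exists j, [/\ `|t - t_ j| < r1, `|0 - ldist Omega (D_ j) D| < r2 &
    `|M - M_ j| < e / 3].
  apply: (@filter_ex _ \oo); apply: filterS3 n1 n2 n3 => j h3 h4 h5.
  by split.
have sDD := sub_setD sD (sD_ j).
have b2 : load Omega f t (D `\` D_ j) <= e / 3 / (m%:R + 1).
  apply: h2 => //; apply: le_lt_trans j2.
  rewrite sub0r normrN ger0_norm ?ldist_ge0//.
  by rewrite (ldist_setD oOmega bOmega (sD_ j) sD) lerDr fine_ge0// leb_outer_ge0.
have b1 : load_distance Omega f (t_ j) t <= e / 3 / (m%:R + 1).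
  by apply: h1 => //; rewrite distrC.
have b3 := load_time oOmega ld (tjI j) tI (sD_ j).
have b4 : load Omega f t (D `&` D_ j) <= load Omega f t (D_ j).
  rewrite (load_split oOmega ld tI (sD_ j) sD) setIC lerDl; exact: load_ge0.
have b5 := load_split oOmega ld tI sD (sD_ j).
have := JM j; rewrite (load_energyE oOmega T0 ld m (tjI j) (sD_ j)) lee_fin => b6.
have E : load Omega f t D <= load Omega f (t_ j) (D_ j) + 2 * (e / 3 / (m%:R + 1)).
  move: b1 b2 b3 b4 b5; move: (load _ _ _ _) (load _ _ _ _) (load _ _ _ _) (load _ _ _ _)
    (load _ _ _ _) (load_distance _ _ _ _) (_ / (_ + _)) => *; lra.
apply: (@le_trans _ _ (m%:R * (load Omega f (t_ j) (D_ j) + 2 * (e / 3 / (m%:R + 1))))).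
  by rewrite ler_wpM2l.
rewrite mulrDr.
have c : m%:R * (2 * (e / 3 / (m%:R + 1))) <= 2 * (e / 3).
  rewrite mulrCA; apply: ler_wpM2l => //; rewrite mulrA ler_pdivrMr// [leLHS]mulrC.
  by apply: ler_wpM2l; [exact: ltW|rewrite lerDl].
move: c b6 j3; rewrite ltr_norml => c b6 /andP[j3 _].
move: c b6; move: (m%:R * load _ _ _ _) (m%:R * (2 * _)) => x y *; lra.
Qed.

End load_energy.

(** * Incremental minimization *)

Section minimization.
Context (R : realType) (d : nat) (Omega : set 'rV[R]_d.+1) (T a : R).
Context (F : R -> set 'rV[R]_d.+1) (f : R -> 'rV[R]_d.+1 -> R) (k : option nat).
Local Notation V := 'rV[R]_d.+1.
Hypotheses (oOmega : open Omega) (bOmega : bounded_set Omega) (T0 : 0 < T) (a0 : 0 < a).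
Hypothesis ld : loading Omega T F f.
Local Notation sub := (lebesgue_subset Omega).
Local Notation E := (energy Omega F f k).
Local Notation J := (load_energy Omega F f k).
Local Notation P := (perimeter Omega).
Local Notation vol A := (fine (leb A)).
Implicit Types (A B C Z : set V) (s t : R).

Lemma vol_ge0 A : 0 <= vol A.
Proof. by apply: fine_ge0; exact: leb_outer_ge0. Qed.

Lemma vol_null A : null A -> vol A = 0.
Proof. by move=> ->. Qed.

Lemma vol_le A B : A `<=` B -> sub B -> vol A <= vol B.
Proof.
move=> AB sB; apply: fine_le; last exact: le_leb_outer.
  rewrite ge0_fin_numE; last exact: leb_outer_ge0.
  by apply: le_lt_trans (lebesgue_subset_lty bOmega sB); exact: le_leb_outer.
by rewrite ge0_fin_numE; [exact: lebesgue_subset_lty sB|exact: leb_outer_ge0].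
Qed.

Lemma vol_domain_le A : sub A -> vol A <= vol Omega.
Proof. by move=> [_ AO]; apply: vol_le => //; split => //; exact: domain_measurable. Qed.

Lemma perimeter_set0 : (P set0 <= 0)%E.
Proof.
apply/(perimeter_leP oOmega bOmega 0 (@lebesgue_subset_set0 R d Omega)) => phi _.
by rewrite Rintegral_set0.
Qed.

Lemma finite_perimeter_set0 : finite_perimeter Omega set0.
Proof.
split; first exact: lebesgue_subset_set0.
by apply: le_lt_trans perimeter_set0 _; exact: ltry.
Qed.

Lemma perimeter_fin A : (P A < +oo)%E -> P A \is a fin_num.
Proof. by move=> h; rewrite ge0_fin_numE//; exact: perimeter_ge0. Qed.

Lemma perimeter_ae A B : sub A -> sub B -> ae_equal A B -> P A = P B.
Proof.
suff H A' B' : sub A' -> sub B' -> ae_equal A' B' -> (P A' <= P B')%E.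
  move=> sA sB AB; apply/eqP; rewrite eq_le H//= H//; exact: ae_equal_sym.
move=> sA sB AB; have [->|/eqP PB] := eqVneq (P B') +oo%E; first exact: leey.
have fB : P B' \is a fin_num by apply: perimeter_fin; rewrite ltey; apply/eqP.
rewrite -(fineK fB).
apply: (perimeter_lsc oOmega bOmega (Z_ := fun=> B') (M_ := fun=> fine (P B'))) => //.
- have -> : (fun=> ldist Omega B' A') = (fun=> 0) :> (nat -> R).
    apply/funext => _; apply/(ldist_ae_equal oOmega bOmega sB sA); exact: ae_equal_sym.
  exact: cvg_cst.
- by move=> j; rewrite fineK.
- exact: cvg_cst.
Qed.

Lemma load_energy_ae t A B : 0 <= t <= T -> sub A -> sub B -> ae_equal A B -> J t A = J t B.
Proof.
move=> tI sA sB [AB BA]; apply/eqP; rewrite eq_le.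
by rewrite !(load_energy_le k oOmega T0 ld tI).
Qed.

Lemma energy_ae t A B : 0 <= t <= T -> sub A -> sub B -> ae_equal A B -> E t A = E t B.
Proof.
by move=> tI sA sB AB; rewrite /energy (perimeter_ae sA sB AB) (load_energy_ae tI sA sB AB).
Qed.

Lemma energy_ge0 t A : 0 <= t <= T -> sub A -> (0 <= E t A)%E.
Proof.
move=> tI sA; rewrite /energy adde_ge0//; first exact: perimeter_ge0.
exact: (load_energy_ge0 k oOmega T0 ld tI sA).
Qed.

Lemma perimeter_le_energy t A : 0 <= t <= T -> sub A -> (P A <= E t A)%E.
Proof.
by move=> tI sA; rewrite /energy leeDl//; exact: (load_energy_ge0 k oOmega T0 ld tI sA).
Qed.

Lemma load_le_energy t A : (J t A <= E t A)%E.
Proof. by rewrite /energy leeDr//; exact: perimeter_ge0. Qed.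

Lemma dissipationE A B : sub A -> sub B -> ae_subset B A ->
  dissipation a A B = (a * vol (A `\` B))%:E.
Proof.
move=> sA sB BA; rewrite /dissipation asboolT// EFinM.
by rewrite (leb_fineK bOmega (sub_setD sA sB)).
Qed.

Lemma dissipation_infty A B : ~ ae_subset B A -> dissipation a A B = +oo%E.
Proof. by move=> h; rewrite /dissipation asboolF. Qed.

Lemma dissipation_ge0 A B : sub A -> sub B -> (0 <= dissipation a A B)%E.
Proof.
move=> sA sB; have [BA|/dissipation_infty ->] := pselect (ae_subset B A); last exact: leey.
by rewrite dissipationE// lee_fin mulr_ge0 ?vol_ge0// ltW.
Qed.

Lemma vol_setD_triangle A B C : sub A -> sub B -> sub C ->
  vol (A `\` C) <= vol (A `\` B) + vol (B `\` C).
Proof.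
move=> sA sB sC; have sAB := sub_setD sA sB; have sBC := sub_setD sB sC.
have sAC := sub_setD sA sC.
rewrite -lee_fin EFinD (leb_fineK bOmega sAC) (leb_fineK bOmega sAB) (leb_fineK bOmega sBC).
apply: le_trans (outer_measureU2 _ _ _); apply: le_leb_outer => x [Ax nC].
by have [Bx|Bx] := pselect (B x); [right|left].
Qed.

Lemma vol_setD_cvg (A_ B_ : nat -> set V) A B :
  (forall j, sub (A_ j)) -> (forall j, sub (B_ j)) -> sub A -> sub B ->
  ldist Omega (A_ j) A @[j --> \oo] --> 0 -> ldist Omega (B_ j) B @[j --> \oo] --> 0 ->
  vol (A_ j `\` B_ j) @[j --> \oo] --> vol (A `\` B).
Proof.
move=> sA_ sB_ sA sB cA cB.
have tri X Y X' Y' : sub X -> sub Y -> sub X' -> sub Y' ->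
    vol (X `\` Y) <= vol (X' `\` Y') + (ldist Omega X X' + ldist Omega Y Y').
  move=> sX sY sX' sY'; have h1 := vol_setD_triangle sX sX' sY.
  have h2 := vol_setD_triangle sX' sY' sY.
  rewrite (ldist_setD oOmega bOmega sX sX') (ldist_setD oOmega bOmega sY sY').
  have := vol_ge0 (X' `\` X); have := vol_ge0 (Y `\` Y'); lra.
have cAB : ldist Omega (A_ j) A + ldist Omega (B_ j) B @[j --> \oo] --> 0.
  by rewrite -[X in _ --> X]addr0; exact: cvgD.
apply/cvgrPdist_le => e e0; move/cvgrPdist_le : cAB => /(_ _ e0).
apply: filterS => j; rewrite sub0r normrN => h; apply: le_trans h.
apply: le_trans (ler_norm _).
have h1 := tri _ _ _ _ (sA_ j) (sB_ j) sA sB.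
have := tri _ _ _ _ sA sB (sA_ j) (sB_ j).
rewrite (ldistC Omega A) (ldistC Omega B) => h2.
by rewrite ler_norml; apply/andP; split; lra.
Qed.

Lemma ae_subset_limit (A_ B_ : nat -> set V) A B :
  (forall j, sub (A_ j)) -> (forall j, sub (B_ j)) -> sub A -> sub B ->
  ldist Omega (A_ j) A @[j --> \oo] --> 0 -> ldist Omega (B_ j) B @[j --> \oo] --> 0 ->
  (forall j, ae_subset (A_ j) (B_ j)) -> ae_subset A B.
Proof.
move=> sA_ sB_ sA sB cA cB AB.
rewrite /ae_subset /null -(leb_fineK bOmega (sub_setD sA sB)); congr (_%:E).
have := vol_setD_cvg sA_ sB_ sA sB cA cB.
have -> : (fun j => vol (A_ j `\` B_ j)) = (fun=> 0).
  by apply/funext => j; rewrite vol_null//; exact: AB.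
by move=> h; apply/esym; apply: (cvg_unique _ (cvg_cst _) h).
Qed.

Lemma ldist_refl A : ldist Omega A A = 0.
Proof.
have -> : ldist Omega A A = \int[leb]_(x in Omega) (0 : R).
  by apply: eq_Rintegral => x _; rewrite subrr normr0.
by rewrite (Rintegral_cst _ (domain_measurable oOmega)) mul0r.
Qed.

Lemma ldist_refl_cvg A : ldist Omega A A @[_ --> \oo] --> (0 : R).
Proof. by rewrite ldist_refl; exact: cvg_cst. Qed.

Lemma dissipation_triangle A B C : sub A -> sub B -> sub C -> ae_subset B A ->
  (dissipation a A C <= dissipation a A B + dissipation a B C)%E.
Proof.
move=> sA sB sC BA; have [CB|/dissipation_infty ->] := pselect (ae_subset C B); last first.
  by rewrite addey ?leey// dissipationE.
rewrite !dissipationE//; last exact: ae_subset_trans CB BA.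
by rewrite -EFinD lee_fin -mulrDr ler_wpM2l ?vol_setD_triangle// ltW.
Qed.

Definition minimizer t A B : Prop := finite_perimeter Omega B /\
  forall Z, finite_perimeter Omega Z ->
    (E t B + dissipation a A B <= E t Z + dissipation a A Z)%E.

Lemma minimizer_bound t A B : 0 <= t <= T -> sub A -> minimizer t A B ->
  (E t B + dissipation a A B <= (a * vol A)%:E)%E.
Proof.
move=> tI sA [_ /(_ _ finite_perimeter_set0)]; move/le_trans; apply.
have sE : ae_subset set0 A by apply: leb_null_subset (leb_null_set0 R d) => x [].
have s0 := @lebesgue_subset_set0 R d Omega.
rewrite (dissipationE sA s0 sE) setD0 /energy.
rewrite (load_energy_null k oOmega T0 ld tI s0 (leb_null_set0 R d)) adde0.
by rewrite -[leRHS]add0e leeD2r// perimeter_set0.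
Qed.

Lemma minimizer_subset t A B : 0 <= t <= T -> sub A -> minimizer t A B -> ae_subset B A.
Proof.
move=> tI sA mB; apply: contrapT => /dissipation_infty h.
have := minimizer_bound tI sA mB; rewrite h addey ?leye_eq//.
by apply: contraTneq (energy_ge0 tI mB.1.1) => ->; rewrite leeNy_eq.
Qed.

Lemma minimizer_energy t A B : 0 <= t <= T -> sub A -> minimizer t A B ->
  (E t B <= (a * vol Omega)%:E)%E.
Proof.
move=> tI sA mB; apply: (@le_trans _ _ (a * vol A)%:E).
  apply: le_trans (minimizer_bound tI sA mB).
  by rewrite leeDl//; exact: dissipation_ge0 sA mB.1.1.
by rewrite lee_fin ler_wpM2l ?vol_domain_le// ltW.
Qed.

Lemma minimizer_stable t A B : 0 <= t <= T -> sub A -> minimizer t A B ->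
  stable Omega a F f k t B.
Proof.
move=> tI sA mB Z sZ; have sB := mB.1.1; have BA := minimizer_subset tI sA mB.
have [PZ|] := boolP (P Z < +oo)%E; last first.
  rewrite -leNgt leye_eq => /eqP PZ; rewrite /energy PZ addye; last first.
    by rewrite gt_eqF// (lt_le_trans (ltNyr 0))//; exact: (load_energy_ge0 k oOmega T0 ld tI sZ).
  by rewrite addye ?leey// gt_eqF// (lt_le_trans (ltNyr 0))//; exact: dissipation_ge0.
have := mB.2 Z (conj sZ PZ).
have := dissipation_triangle sA sB sZ BA; rewrite (dissipationE sA sB BA) => h1 h2.
have := le_trans h2 (leeD2l (E t Z) h1).
rewrite [leRHS]addeCA [leLHS]addeC => h3.
(* The dissipation from [A] to [B] appears on both sides and can be cancelled because it is
   finite. *)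
by rewrite -(leeD2lE _ _ (isT : (a * vol (A `\` B))%:E \is a fin_num)).
Qed.

Lemma minimizer_exists t A : 0 <= t <= T -> sub A -> exists B, minimizer t A B.
Proof.
move=> tI sA.
pose G Z := (E t Z + dissipation a A Z)%E.
pose S := [set G Z | Z in finite_perimeter Omega].
have G0 Z : sub Z -> (0 <= G Z)%E.
  by move=> sZ; rewrite adde_ge0 ?energy_ge0 ?dissipation_ge0.
have S0 : (0 <= ereal_inf S)%E by apply: le_ereal_inf_tmp => _ [Z [sZ _] <-]; exact: G0.
have S1 : (ereal_inf S <= (a * vol A)%:E)%E.
  apply: (@le_trans _ _ (G set0)).
    by apply: ereal_inf_lbound; exists set0 => //; exact: finite_perimeter_set0.
  have sE : ae_subset set0 A by apply: leb_null_subset (leb_null_set0 R d) => x [].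
  have s0 := @lebesgue_subset_set0 R d Omega.
  rewrite /G (dissipationE sA s0 sE) setD0 /energy.
  rewrite (load_energy_null k oOmega T0 ld tI s0 (leb_null_set0 R d)) adde0.
  by rewrite -[leRHS]add0e leeD2r// perimeter_set0.
have fS : ereal_inf S \is a fin_num.
  by rewrite ge0_fin_numE//; exact: le_lt_trans S1 (ltry _).
set m := fine (ereal_inf S).
have [Z_ HZ] : {Z_ : nat -> set V & forall j,
    finite_perimeter Omega (Z_ j) /\ (G (Z_ j) <= (m + j.+1%:R^-1)%:E)%E}.
  apply: (@choice _ _ (fun (j : nat) Z => finite_perimeter Omega Z /\ (G Z <= (m + j.+1%:R^-1)%:E)%E)).
  move=> j; have j0 : 0 < j.+1%:R^-1 :> R by rewrite invr_gt0.
  have [_ [Z fZ <-] h] := lb_ereal_inf_adherent j0 fS.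
  by exists Z; split => //; rewrite EFinD /m fineK//; exact: ltW.
have sZ j : sub (Z_ j) by case: (HZ j) => -[].
have GZ j := (HZ j).2.
have EZ j : (E t (Z_ j) <= (m + j.+1%:R^-1)%:E)%E.
  by apply: le_trans (GZ j); rewrite leeDl//; exact: dissipation_ge0.
have dZ j : ae_subset (Z_ j) A.
  apply: contrapT => /dissipation_infty h; have := GZ j.
  rewrite /G h addey ?leye_eq//.
  by apply: contraTneq (energy_ge0 tI (sZ j)) => ->; rewrite leeNy_eq.
have PZ j : (P (Z_ j) <= (m + 1)%:E)%E.
  apply: le_trans (perimeter_le_energy tI (sZ j)) _; apply: le_trans (EZ j) _.
  by rewrite lee_fin lerD2l invf_le1// ler1n.
have [g [gi /(_ 0%N)[Z sZ0]]] := BV_compact oOmega bOmega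
  (Z_ := fun _ : nat => Z_) (P := fun=> m + 1) (fun _ => sZ) (fun _ => PZ).
rewrite /= => cZ.
have PZ0 : (P Z <= (m + 1)%:E)%E.
  apply: (perimeter_lsc oOmega bOmega (M_ := fun=> m + 1) (fun j => sZ (g j)) sZ0 cZ) => //.
  exact: cvg_cst.
have fpZ : finite_perimeter Omega Z.
  by split => //; apply: le_lt_trans PZ0 _; exact: ltry.
have ZA : ae_subset Z A.
  exact: (ae_subset_limit (fun j => sZ (g j)) (fun=> sA) sZ0 sA cZ (ldist_refl_cvg A)
    (fun j => dZ (g j))).
exists Z; split => // Z' fpZ'.
apply: (@le_trans _ _ (ereal_inf S)); last by apply: ereal_inf_lbound; exists Z'.
rewrite -(fineK fS) -/m (dissipationE sA sZ0 ZA).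
pose r := a * vol (A `\` Z); pose r_ j := a * vol (A `\` Z_ (g j)).
have cr : r_ j @[j --> \oo] --> r.
  apply: cvgM; first exact: cvg_cst.
  exact: (vol_setD_cvg (fun=> sA) (fun j => sZ (g j)) sA sZ0 (ldist_refl_cvg A) cZ).
(* Perimeter and load are both only lower semicontinuous. With [phi] fixed, the perimeter is bounded
   below by a convergent integral, which is moved to the right side; then only the load has to pass
   to the limit. *)
have key phi : test_field Omega phi ->
    (J t Z <= (m - r - \int[leb]_(x in Z) divergence phi x)%:E)%E.
  move=> tphi.
  apply: (load_energy_lsc oOmega bOmega T0 ld (t_ := fun=> t) (D_ := fun j => Z_ (g j))
    (M_ := fun j => m + (g j).+1%:R^-1 - r_ j - \int[leb]_(x in Z_ (g j)) divergence phi x)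
    _ _ _ (fun j => sZ (g j)) sZ0 cZ).
  - by case/andP: tI.
  - by move=> j; rewrite lexx; case/andP: tI.
  - exact: cvg_cst.
  - move=> j; cbv beta; have := GZ (g j); rewrite /G (dissipationE sA (sZ _) (dZ _)) -/(r_ j) /energy.
    have fP : P (Z_ (g j)) \is a fin_num.
      by apply: perimeter_fin; exact: le_lt_trans (PZ _) (ltry _).
    have := (perimeter_leP oOmega bOmega (fine (P (Z_ (g j)))) (sZ (g j))).1 _ phi tphi.
    rewrite fineK// lexx => /(_ isT).
    rewrite -(fineK fP); move: (fine (P _)) (\int[leb]_(x in _) _) => p i /= ip.
    case: (J t (Z_ (g j))) => [q||]; last by move=> _; exact: leNye.
      by rewrite -!EFinD !lee_fin ; move: (r_ j) (m + _) => x y h; rewrite /= in ip; lra.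
    by rewrite addey// addye// leye_eq.
  - apply: cvgB; last first.
      exact: (integral_cvg oOmega bOmega (Z_ := fun j => Z_ (g j)) (fun j => sZ (g j)) sZ0
        cZ (divergence_bm bOmega tphi.1)).
    apply: cvgB => //; rewrite -[X in _ --> X]addr0; apply: cvgD; first exact: cvg_cst.
    (* The excess over the infimum along the subsequence is compared with the harmonic sequence, as
       [g j] is at least [j]. *)
    apply: (@squeeze_cvgr _ _ _ _ (fun=> 0) (fun j => j.+1%:R^-1)).
    + apply: nearW => j; rewrite invr_ge0 ler0n/= lef_pV2 ?posrE// ler_nat ltnS.
      exact: increasing_seq_ge.
    + exact: cvg_cst.
    + exact: cvg_harmonic.
have fJ : J t Z \is a fin_num.
  rewrite ge0_fin_numE; last exact: (load_energy_ge0 k oOmega T0 ld tI sZ0).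
  by apply: le_lt_trans (key _ (@test_field0 _ _ _)) _; exact: ltry.
have : (P Z <= (m - r - fine (J t Z))%:E)%E.
  apply/(perimeter_leP oOmega bOmega _ sZ0) => phi tphi.
  by have := key phi tphi; rewrite -{1}(fineK fJ) lee_fin lerBrDr => h; rewrite lerBrDr addrC.
have fP := perimeter_fin fpZ.2.
rewrite /energy -(fineK fJ) -(fineK fP) -!EFinD !lee_fin -/r.
by rewrite !lerBrDr.
Qed.

End minimization.

(** * Partitions, interpolants and discrete solutions *)

Section partitions.
Context (R : realType) (d : nat) (T : R) (D : discrete_curve R d).
Hypothesis pD : is_partition T D.
Local Notation N := (nb_steps D).
Implicit Types (i j : nat) (t : R).

Lemma node_lt i j : (i < j)%N -> (j <= N)%N -> node D i < node D j.
Proof.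
elim: j => // j IH; rewrite ltnS leq_eqVlt => /predU1P[->|ij] jN.
  by case: pD => _ _; apply.
apply: (lt_trans (IH ij (ltnW jN))); by case: pD => _ _; apply.
Qed.

Lemma node_le i j : (i <= j)%N -> (j <= N)%N -> node D i <= node D j.
Proof. by rewrite leq_eqVlt => /predU1P[->//|ij] jN; exact/ltW/node_lt. Qed.

Lemma node_bounds i : (i <= N)%N -> 0 <= node D i <= T.
Proof.
by move=> iN; case: pD => [n0 nN _]; rewrite -{1}n0 -nN !node_le.
Qed.

Lemma step_size_ge i : (i < N)%N -> node D i.+1 - node D i <= step_size D.
Proof.
move=> iN; rewrite /step_size.
exact: (le_bigmax 0 (fun i : 'I_N => node D i.+1 - node D i) (Ordinal iN)).
Qed.

(** Taking the least index whose node is not before [t] merges the clause for [t = 0] with the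
    general one. *)
Lemma left_interpolantP t : 0 <= t <= T -> exists i,
  [/\ (i <= N)%N, left_interpolant D t = state D i, t <= node D i &
      forall j, (j < i)%N -> node D j < t].
Proof.
move=> /andP[t0 tT]; have [n0 nN _] := pD.
have ex : exists i, t <= node D i by exists N; rewrite nN.
case: (ex_minnP ex) => i ti imin.
have iN : (i <= N)%N by apply: imin; rewrite nN.
have jlt j : (j < i)%N -> node D j < t.
  by move=> ji; rewrite ltNge; apply: contraTN ji => /imin; rewrite -leqNgt.
exists i; split=> //; apply/seteqP; split=> x /=.
  move=> [[t00 s0]|[j [jN /andP[jt tj] sx]]].
    suff -> : i = 0%N by [].
    by apply/eqP; rewrite -leqn0; apply: imin; rewrite n0 t00.
  suff -> : i = j.+1 by [].
  apply/eqP; rewrite eqn_leq imin//= ltnNge; apply/negP => ij.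
  have := node_le ij (ltnW jN); rewrite leNgt => /negP; apply.
  exact: lt_le_trans jt ti.
move=> sx; case: i => [|i] in ti imin iN jlt sx *.
  by left; split => //; apply/eqP; rewrite eq_le t0 andbT -n0.
by right; exists i; rewrite iN ti jlt.
Qed.

Lemma right_interpolantP t : 0 <= t <= T -> exists i,
  [/\ (i <= N)%N, right_interpolant T D t = state D i, node D i <= t &
      forall j, (i < j)%N -> (j <= N)%N -> t < node D j].
Proof.
move=> /andP[t0]; rewrite le_eqVlt => /predU1P[->|tT]; have [n0 nN _] := pD.
  exists N; split; rewrite ?nN//; last by move=> j Nj /(leq_trans Nj); rewrite ltnn.
  apply/seteqP; split=> x /=; last by left.
  move=> [[]//|[i [iN /andP[_ Ti] _]]]; exfalso.
  by have := node_le iN (leqnn _); rewrite nN leNgt Ti.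
have ex : exists i, t < node D i by exists N; rewrite nN.
case: (ex_minnP ex) => -[|i] ti imin; first by move: ti; rewrite n0 ltNge t0.
have iN : (i < N)%N by apply: imin; rewrite nN.
have it : node D i <= t by rewrite leNgt; apply/negP => /imin; rewrite ltnn.
exists i; split=> //; first exact: ltnW; last first.
  by move=> j ij jN; apply: lt_le_trans ti _; exact: node_le.
apply/seteqP; split=> x /=; last by move=> sx; right; exists i; rewrite it ti.
move=> [[tT' _]|[j [jN /andP[jt tj] sx]]]; first by rewrite tT' ltxx in tT.
suff -> : i = j by [].
apply/eqP; rewrite eqn_leq -ltnS imin//= -ltnS ltnNge; apply/negP => ij.
by have := node_le ij (ltnW jN); rewrite leNgt => /negP; apply; exact: le_lt_trans jt ti.
Qed.

(** The right interpolant at [t] is the left one at the last node not after [t]. All facts on right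
    interpolants come from the left ones in this way. *)
Lemma right_interpolant_left t : 0 <= t <= T -> exists s,
  [/\ 0 <= s <= t, t <= s + step_size D & right_interpolant T D t = left_interpolant D s].
Proof.
move=> tI; have [i [iN E it lt]] := right_interpolantP tI.
have [n0 nN _] := pD.
exists (node D i); have /andP[ni _] := node_bounds iN.
have stepge0 : 0 <= step_size D by rewrite /step_size; exact: bigmax_ge_id.
split; first by rewrite ni.
  move: iN; rewrite leq_eqVlt => /predU1P[iN|iN].
    by rewrite iN nN (le_trans (proj2 (andP tI)))// lerDl.
  rewrite -lerBlDl; apply: le_trans (step_size_ge iN); rewrite lerD2r.
  by apply/ltW/lt.
rewrite E; have [j [jN -> ij lt']] := left_interpolantP (node_bounds iN).
suff -> : j = i by [].
apply/eqP; rewrite eqn_leq; apply/andP; split; rewrite leqNgt; apply/negP => h.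
  by have := lt' _ h; rewrite ltxx.
by have := node_lt h iN; rewrite ltNge ij.
Qed.

End partitions.

Section discrete_solutions.
Context (R : realType) (d : nat) (Omega : set 'rV[R]_d.+1) (T a : R).
Context (F : R -> set 'rV[R]_d.+1) (f : R -> 'rV[R]_d.+1 -> R) (k : option nat).
Local Notation V := 'rV[R]_d.+1.
Hypotheses (oOmega : open Omega) (bOmega : bounded_set Omega) (T0 : 0 < T) (a0 : 0 < a).
Hypothesis ld : loading Omega T F f.
Local Notation sub := (lebesgue_subset Omega).
Local Notation E := (energy Omega F f k).
Context (Z0 : set V) (D : discrete_curve R d).
Hypothesis sD : discrete_solution Omega T a F f k Z0 D.
Local Notation N := (nb_steps D).
Implicit Types (i j : nat) (t s : R).

Let pD : is_partition T D. Proof. by case: sD. Qed.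

Lemma state_finite_perimeter i : (i <= N)%N -> finite_perimeter Omega (state D i).
Proof.
have [_ h _ h1] := sD.
by case: i => [_|i iN]; [exact: h|case: (h1 i iN)].
Qed.

Lemma state_minimizer i : (i < N)%N ->
  minimizer Omega a F f k (node D i.+1) (state D i) (state D i.+1).
Proof. by move=> iN; have [_ _ _ h1] := sD; exact: h1. Qed.

Lemma state_decreasing i j : (i <= j)%N -> (j <= N)%N -> ae_subset (state D j) (state D i).
Proof.
elim: j => [|j IH]; first by rewrite leqn0 => /eqP -> _; rewrite /ae_subset setDv; exact: leb_null_set0.
rewrite leq_eqVlt => /predU1P[->|]; first by move=> _; rewrite /ae_subset setDv; exact: leb_null_set0.
rewrite ltnS => ij jN; apply: ae_subset_trans (IH ij (ltnW jN)).
exact: (minimizer_subset oOmega bOmega T0 ld (node_bounds pD jN)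
  (state_finite_perimeter (ltnW jN)).1 (state_minimizer jN)).
Qed.

Lemma left_decreasing : decreasing_family Omega T (left_interpolant D).
Proof.
split=> [t tI|s t s0 st tT].
  by have [i [iN -> _ _]] := left_interpolantP pD tI; exact: (state_finite_perimeter iN).1.
have sI : 0 <= s <= T by rewrite s0 (le_trans st).
have tI : 0 <= t <= T by rewrite (le_trans s0).
have [i [iN -> si iP]] := left_interpolantP pD sI.
have [j [jN -> tj jP]] := left_interpolantP pD tI.
apply: state_decreasing => //; rewrite leqNgt; apply/negP => ji.
have := iP _ ji; rewrite ltNge => /negP; apply; exact: le_trans tj.
Qed.

Lemma right_decreasing : decreasing_family Omega T (right_interpolant T D).
Proof.
split=> [t tI|s t s0 st tT].
  by have [i [iN -> _ _]] := right_interpolantP pD tI; exact: (state_finite_perimeter iN).1.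
have sI : 0 <= s <= T by rewrite s0 (le_trans st).
have tI : 0 <= t <= T by rewrite (le_trans s0).
have [i [iN -> si iP]] := right_interpolantP pD sI.
have [j [jN -> tj jP]] := right_interpolantP pD tI.
apply: state_decreasing => //; rewrite leqNgt; apply/negP => ji.
have := jP _ ji iN; rewrite ltNge => /negP; apply; exact: le_trans st.
Qed.

Lemma left_finite_perimeter t : 0 <= t <= T -> finite_perimeter Omega (left_interpolant D t).
Proof. by move=> tI; have [i [iN -> _ _]] := left_interpolantP pD tI; exact: state_finite_perimeter. Qed.

Lemma right_finite_perimeter t : 0 <= t <= T -> finite_perimeter Omega (right_interpolant T D t).
Proof. by move=> tI; have [i [iN -> _ _]] := right_interpolantP pD tI; exact: state_finite_perimeter. Qed.

Lemma left_interpolant0 : left_interpolant D 0 = state D 0.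
Proof.
have [|i [iN -> _ iP]] := left_interpolantP pD (t := 0); first by rewrite lexx ltW.
case: i iN iP => // i iN /(_ 0%N isT); have [-> _ _] := pD.
by rewrite ltxx.
Qed.

Lemma left_interpolant0_ae : ae_equal (left_interpolant D 0) Z0.
Proof. by rewrite left_interpolant0; case: sD. Qed.

Lemma left_minimizer t : 0 < t <= T -> exists t' A,
  [/\ t <= t' <= T, t' <= t + step_size D, sub A &
      minimizer Omega a F f k t' A (left_interpolant D t)].
Proof.
move=> /andP[t0 tT]; have tI : 0 <= t <= T by rewrite ltW.
have [[|i] [iN -> ti iP]] := left_interpolantP pD tI.
  by have [n0 _ _] := pD; move: ti; rewrite n0 leNgt t0.
exists (node D i.+1), (state D i); split.
- by rewrite ti; have /andP[_] := node_bounds pD iN.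
- rewrite addrC -lerBlDr; apply: le_trans (step_size_ge iN).
  by rewrite lerB// ltW// iP.
- exact: (state_finite_perimeter (ltnW iN)).1.
- exact: state_minimizer.
Qed.

Lemma left_energy t : 0 < t <= T -> exists2 t', t <= t' <= T &
  (E t' (left_interpolant D t) <= (a * fine (leb Omega))%:E)%E.
Proof.
move=> tI; have [t' [A [tt' _ sA mB]]] := left_minimizer tI.
exists t' => //; apply: (minimizer_energy oOmega bOmega T0 a0 ld _ sA mB).
by case/andP: tt' => h ->; case/andP: tI => /ltW t0 _; rewrite (le_trans t0).
Qed.

End discrete_solutions.

(** * Convergence of interpolants *)

Section convergence.
Context (R : realType) (d : nat) (Omega : set 'rV[R]_d.+1) (T a : R).
Context (F : R -> set 'rV[R]_d.+1) (f : R -> 'rV[R]_d.+1 -> R) (k : option nat).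
Local Notation V := 'rV[R]_d.+1.
Local Notation leb1 := (@lebesgue_measure R).
Local Notation I := `]0, T[%classic.
Hypotheses (oOmega : open Omega) (bOmega : bounded_set Omega) (T0 : 0 < T).
Hypothesis ld : loading Omega T F f.
Local Notation sub := (lebesgue_subset Omega).
Local Notation E := (energy Omega F f k).
Local Notation P := (perimeter Omega).
Local Notation vol A := (fine (leb A)).
Context (Z0 : set V) (fpZ0 : finite_perimeter Omega Z0).
Context (D_ : nat -> discrete_curve R d) (Z : R -> set V) (J : set R).
Hypothesis JT : forall t, 0 < t <= T -> J t.
Hypothesis fpZ : forall t, 0 <= t <= T -> finite_perimeter Omega (Z t).
Hypothesis dD : discrete_sequence Omega T a F f k Z0 D_.
Hypothesis gZ : property_G Omega T F f J k D_ Z.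

Let sD j : discrete_solution Omega T a F f k Z0 (D_ j). Proof. by case: dD. Qed.
Let pD j : is_partition T (D_ j). Proof. by case: (sD j). Qed.
Let sZ t : 0 <= t <= T -> sub (Z t). Proof. by move=> /fpZ[]. Qed.
Let dl j := left_decreasing oOmega bOmega T0 ld (sD j).
Let dr j := right_decreasing oOmega bOmega T0 ld (sD j).

Lemma left_ldist_cvg t : 0 <= t <= T ->
  ldist Omega (left_interpolant (D_ j) t) (Z t) @[j --> \oo] --> 0.
Proof. by move=> tI; have [_ /(_ t tI)[_ h _]] := gZ; exact: (fine_cvg h). Qed.

Lemma limit_decreasing : decreasing_family Omega T Z.
Proof.
split=> // s t s0 st tT.
have sI : 0 <= s <= T by rewrite s0 (le_trans st).
have tI : 0 <= t <= T by rewrite (le_trans s0).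
exact: (ae_subset_limit oOmega bOmega (fun j => (dl j).1 t tI) (fun j => (dl j).1 s sI)
  (sZ tI) (sZ sI) (left_ldist_cvg tI) (left_ldist_cvg sI)
  (fun j => (dl j).2 s t s0 st tT)).
Qed.

Lemma perimeter_bounds : exists2 C, 0 <= C & forall t, 0 < t <= T ->
  (P (Z t) <= C%:E)%E /\ forall j, (P (left_interpolant (D_ j) t) <= C%:E)%E /\
    (P (right_interpolant T (D_ j) t) <= C%:E)%E.
Proof.
have [[C C0 hC] _] := gZ.
have fP0 := perimeter_fin fpZ0.2.
have bl j t : 0 < t <= T -> (P (left_interpolant (D_ j) t) <= C%:E)%E.
  move=> tI; have tI' : 0 <= t <= T by case/andP: tI => /ltW -> ->.
  apply: le_trans (hC j t (JT tI)).
  exact: (perimeter_le_energy k oOmega T0 ld tI' ((dl j).1 t tI')).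
(* Before the first interior node the right interpolant is the initial state, whose energy at time 0
   is not bounded by (G) when [J] omits 0; hence the perimeter of [Z0]. *)
exists (Num.max C (fine (P Z0))); first by rewrite le_max (ltW C0).
move=> t tI; have tI' : 0 <= t <= T by case/andP: tI => /ltW -> ->.
split=> [|j].
  apply: (perimeter_lsc oOmega bOmega (M_ := fun=> Num.max C (fine (P Z0)))
    (fun j => (dl j).1 t tI') (sZ tI') (left_ldist_cvg tI')); last exact: cvg_cst.
  by move=> j; apply: le_trans (bl j t tI) _; rewrite lee_fin le_max lexx.
split; first by apply: le_trans (bl j t tI) _; rewrite lee_fin le_max lexx.
have [s [/andP[s0 st] _ ->]] := right_interpolant_left (pD j) tI'.
have sT : s <= T by case/andP: tI => _; exact: le_trans.
move: s0; rewrite le_eqVlt => /predU1P[<-|s0].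
  have e0 := left_interpolant0_ae T0 (sD j).
  have sl : sub (left_interpolant (D_ j) 0) by apply: (dl j).1; rewrite lexx ltW.
  rewrite (perimeter_ae oOmega bOmega sl fpZ0.1 e0) -(fineK fP0) lee_fin.
  by rewrite le_max lexx orbT.
by apply: le_trans (bl j s _) _; rewrite ?s0// lee_fin le_max lexx.
Qed.

Lemma vol_cvg (A_ : nat -> set V) A : (forall j, sub (A_ j)) -> sub A ->
  ldist Omega (A_ j) A @[j --> \oo] --> 0 -> vol (A_ j) @[j --> \oo] --> vol A.
Proof.
move=> sA_ sA cA; have s0 := @lebesgue_subset_set0 R d Omega.
have := vol_setD_cvg oOmega bOmega sA_ (fun=> s0) sA s0 cA (ldist_refl_cvg oOmega set0).
by rewrite setD0; under eq_fun do rewrite setD0.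
Qed.

(* A right interpolant at t lies between the left ones at t and at any s < t,
   once the step size is below t - s. *)
Lemma right_ldist_cvg : {ae leb1, forall t, I t ->
  ldist Omega (right_interpolant T (D_ j) t) (Z t) @[j --> \oo] --> 0}.
Proof.
have dZ := limit_decreasing.
have dm s t : 0 <= s -> s <= t -> t <= T -> vol (Z t) <= vol (Z s).
  move=> s0 st tT; apply: (ae_subset_measure_le oOmega bOmega _ _ (dZ.2 s t s0 st tT)).
    by apply: sZ; rewrite s0 (le_trans st).
  by apply: sZ; rewrite (le_trans s0).
have [N cN HN] := monotone_continuity T0 dm.
exists N; split.
- exact: countable_measurable.
- exact: countable_lebesgue_measure0.
move=> t /= h; apply: contrapT => Nt; apply: h; rewrite in_itv/= => tI.
have /andP[t0 tT] := tI; have tI' : 0 <= t <= T by rewrite !ltW.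
apply/cvgrPdist_le => e e0; have e2 : 0 < e / 2 by rewrite divr_gt0.
have [r r0 hr] := HN t tI Nt _ e2.
have [s [s0 st sr]] : exists s, [/\ 0 <= s, s < t & `|s - t| < r].
  (* Strictly before [t], still positive, and within the continuity radius [r]. *)
  exists (Num.max (t / 2) (t - r / 2)).
  have : Num.max (t / 2) (t - r / 2) < t by rewrite gt_max; apply/andP; split; lra.
  have : t / 2 <= Num.max (t / 2) (t - r / 2) by rewrite le_max lexx.
  have : t - r / 2 <= Num.max (t / 2) (t - r / 2) by rewrite le_max lexx orbT.
  move: (Num.max _ _) => u *; split=> //; first lra.
  by rewrite ltr_norml; apply/andP; split; lra.
have sI : 0 <= s <= T by rewrite s0 (le_trans (ltW st)) ?ltW.
have mst : vol (Z s) - vol (Z t) <= e / 2.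
  by have := hr s sI sr; apply: le_trans; exact: ler_norm.
(* An upper bound for the distance of the right interpolant to [Z t]: the loss of volume between [s]
   and [t] plus the error of the left interpolant. Its limit is at most [e / 2] by the choice of
   [s]. *)
pose u j := vol (left_interpolant (D_ j) s) - vol (left_interpolant (D_ j) t) +
  ldist Omega (left_interpolant (D_ j) t) (Z t).
have cu : u j @[j --> \oo] --> vol (Z s) - vol (Z t).
  rewrite -[X in _ --> X]addr0; apply: cvgD; last exact: left_ldist_cvg.
  apply: cvgB.
    exact: (vol_cvg (fun j => (dl j).1 s sI) (sZ sI) (left_ldist_cvg sI)).
  exact: (vol_cvg (fun j => (dl j).1 t tI') (sZ tI') (left_ldist_cvg tI')).
have ts : 0 < t - s by rewrite subr_gt0.
have [_ _ cstep] := dD.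
move/cvgrPdist_le : cstep => /(_ _ ts); move/cvgrPdist_le : cu => /(_ _ e2).
apply: filterS2 => j hu hstep; rewrite sub0r normrN ger0_norm ?ldist_ge0//.
have step_le : step_size (D_ j) <= t - s.
  by apply: le_trans hstep; rewrite sub0r normrN ler_norm.
have [s' [/andP[s'0 s't] ts' ->]] := right_interpolant_left (pD j) tI'.
have ss' : s <= s' by lra.
have s'I : 0 <= s' <= T by rewrite s'0 (le_trans s't) ?ltW.
have s1 := (dl j).1 s sI; have s2 := (dl j).1 s' s'I; have s3 := (dl j).1 t tI'.
apply: le_trans (ldist_triangle oOmega bOmega s2 s3 (sZ tI')) _.
rewrite (ldist_decreasing oOmega bOmega s2 s3 ((dl j).2 s' t s'0 s't (ltW tT))).
have := ae_subset_measure_le oOmega bOmega s1 s2 ((dl j).2 s s' s0 ss' (le_trans s't (ltW tT))).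
move: hu mst; rewrite /u ler_norml => /andP[h1 _] h2 h3; lra.
Qed.

Lemma right_weakstar : {ae leb1, forall t, I t ->
  weakstar_SBV Omega (fun j => right_interpolant T (D_ j) t) (Z t)}.
Proof.
have [C C0 hC] := perimeter_bounds.
apply: (ae_imply _ right_ldist_cvg) => t h; rewrite /= in_itv/= => tI.
have tI1 : 0 < t <= T by case/andP: tI => -> /ltW ->.
have tI' : 0 <= t <= T by case/andP: tI => *; rewrite !ltW.
have [_ hj] := hC t tI1.
apply: (weakstar_of_ldist oOmega bOmega _ (fpZ tI') (fun j => (hj j).2)).
  by move=> j; exact: (right_finite_perimeter (sD j) tI').
by apply: h; rewrite /= in_itv.
Qed.

Lemma interpolants_convergence :
  [/\ \forall t \ae leb1, 0 < t < T ->
        weakstar_SBV Omega (fun j => left_interpolant (D_ j) t) (Z t) /\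
        weakstar_SBV Omega (fun j => right_interpolant T (D_ j) t) (Z t),
      weakstar_Linf_SBV Omega T (fun j => left_interpolant (D_ j)) Z /\
      weakstar_Linf_SBV Omega T (fun j => right_interpolant T (D_ j)) Z &
      forall q : R, 1 <= q ->
        Lq_cvg Omega T q
          (fun j t => \1_(left_interpolant (D_ j) t)) (fun t => \1_(Z t)) /\
        Lq_cvg Omega T q
          (fun j t => \1_(right_interpolant T (D_ j) t)) (fun t => \1_(Z t))].
Proof.
have [C C0 hC] := perimeter_bounds; have [_ wl] := gZ; have wr := right_weakstar.
have II t : I t -> 0 < t <= T /\ 0 <= t <= T.
  by rewrite /= in_itv/= => /andP[t0 tT]; rewrite t0 !ltW.
have dZ := limit_decreasing.
split.
- apply: (ae_imply _ wr) => t h tI.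
  split; first by apply: wl; case/andP: tI => *; rewrite !ltW.
  by apply: h; rewrite /= in_itv.
- split.
    apply: (weakstar_Linf_of_ae oOmega bOmega T0 C0 dl dZ).
    + by move=> j t /II[tI _]; case: (hC t tI) => _ /(_ j)[].
    + by move=> t /II[tI _]; case: (hC t tI).
    + by apply: aeW => t /II[_ tI]; exact: wl.
  apply: (weakstar_Linf_of_ae oOmega bOmega T0 C0 dr dZ) => //.
  + by move=> j t /II[tI _]; case: (hC t tI) => _ /(_ j)[].
  + by move=> t /II[tI _]; case: (hC t tI).
- move=> q q1; split.
    apply: (Lq_cvg_of_ae oOmega bOmega T0 q1 dl dZ).
    by apply: aeW => t /II[_ tI]; exact: left_ldist_cvg.
  exact: (Lq_cvg_of_ae oOmega bOmega T0 q1 dr dZ right_ldist_cvg).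
Qed.

End convergence.

(** * Stability *)

Section stability.
Context (R : realType) (d : nat) (Omega : set 'rV[R]_d.+1) (T a : R).
Context (F : R -> set 'rV[R]_d.+1) (f : R -> 'rV[R]_d.+1 -> R) (k : option nat).
Local Notation V := 'rV[R]_d.+1.
Hypotheses (oOmega : open Omega) (bOmega : bounded_set Omega) (T0 : 0 < T) (a0 : 0 < a).
Hypothesis ld : loading Omega T F f.
Local Notation sub := (lebesgue_subset Omega).
Local Notation E := (energy Omega F f k).
Local Notation J := (load_energy Omega F f k).
Local Notation P := (perimeter Omega).
Local Notation vol A := (fine (leb A)).

Lemma stable_ae t A B : 0 <= t <= T -> sub A -> sub B -> ae_equal A B ->
  stable Omega a F f k t A -> stable Omega a F f k t B.
Proof.
move=> tI sA sB AB stA Z' sZ'.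
rewrite -(energy_ae k oOmega bOmega T0 ld tI sA sB AB).
apply: le_trans (stA Z' sZ') _; rewrite leeD2l//.
apply: le_trans (dissipation_triangle bOmega a0 sA sB sZ' AB.2) _.
by rewrite (dissipationE a bOmega sA sB AB.2) (vol_null AB.1) mulr0 add0e.
Qed.

(** Submodularity with the supremum taken on the intersection only. The union keeps a single field,
    because its contribution has to converge along a sequence of sets. *)
Lemma perimeter_setI_le A B (x y : R) phi : sub A -> sub B ->
  (P A <= x%:E)%E -> (P B <= y%:E)%E -> test_field Omega phi ->
  (P (A `&` B) <= (x + y - \int[leb]_(z in A `|` B) divergence phi z)%:E)%E.
Proof.
move=> sA sB PA PB tphi.
apply/(perimeter_leP oOmega bOmega _ (lebesgue_subsetI sA sB)) => psi tpsi.
have := submodular_test oOmega bOmega sA sB PA PB tphi tpsi.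
by move=> h; rewrite lerBrDr [leLHS]addrC; exact: h.
Qed.

(* Stability is tested with Z' n L, so that both the load of Z' n L and, by
   submodularity, the perimeter of L cancel; no upper bound for P(L) is lost. *)
Lemma stable_test t L Z' phi : 0 <= t <= T -> finite_perimeter Omega L ->
  finite_perimeter Omega Z' -> (J t L < +oo)%E -> test_field Omega phi ->
  stable Omega a F f k t L ->
  (J t (L `\` Z') <= (fine (P Z') + a * vol (L `\` Z') -
     \int[leb]_(x in Z' `|` L) divergence phi x)%:E)%E.
Proof.
move=> tI fpL fpZ' JL tphi stL; have [sL _] := fpL; have [sZ' _] := fpZ'.
have sI := lebesgue_subsetI sZ' sL; have sD := sub_setD sL sZ'.
have fPL := perimeter_fin fpL.2; have fPZ := perimeter_fin fpZ'.2.
have IL : ae_subset (Z' `&` L) L by apply: leb_null_subset (leb_null_set0 R d) => x [[]].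
have PI : (P (Z' `&` L) <= (fine (P Z') + fine (P L) -
    \int[leb]_(x in Z' `|` L) divergence phi x)%:E)%E.
  by apply: perimeter_setI_le => //; rewrite fineK.
have := stL _ sI; rewrite (dissipationE a bOmega sL sI IL).
have -> : L `\` (Z' `&` L) = L `\` Z'.
  by apply/seteqP; split=> x [Lx h]; split => // h'; apply: h => //; case: h'.
rewrite /energy (load_energy_split k oOmega T0 ld tI sL sZ') setIC.
have g1 := load_energy_ge0 k oOmega T0 ld tI sI.
have g2 := load_energy_ge0 k oOmega T0 ld tI sD.
have fin2 : J t (L `\` Z') \is a fin_num.
  rewrite ge0_fin_numE//; apply: le_lt_trans JL.
  by rewrite (load_energy_split k oOmega T0 ld tI sL sZ') setIC leeDr.
have fin1 : J t (Z' `&` L) \is a fin_num.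
  rewrite ge0_fin_numE//; apply: le_lt_trans JL.
  by rewrite (load_energy_split k oOmega T0 ld tI sL sZ') setIC leeDl.
have fP := perimeter_fin (le_lt_trans PI (ltry _)).
move: PI; rewrite -(fineK fPL) -(fineK fP) -(fineK fin1) -(fineK fin2) -!EFinD !lee_fin.
rewrite !fineK//.
move: (fine _) (fine _) (fine _) (fine _) (fine _) (_ * _) (\int[_]_(_ in _) _) => *; lra.
Qed.

Context (Z0 : set V) (D_ : nat -> discrete_curve R d) (Z : R -> set V).
Hypothesis fpZ : forall t, 0 <= t <= T -> finite_perimeter Omega (Z t).
Hypothesis dD : discrete_sequence Omega T a F f k Z0 D_.
Hypothesis cZ : pointwise_cvg Omega T D_ Z.

Lemma limit_stable t : 0 < t <= T -> stable Omega a F f k t (Z t).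
Proof.
move=> tI Z' sZ'; have tI' : 0 <= t <= T by case/andP: tI => /ltW -> ->.
have sZ := (fpZ tI').1.
have [Zsub|/dissipation_infty ->] := pselect (ae_subset Z' (Z t)); last first.
  rewrite addey ?leey// gt_eqF// (lt_le_trans (ltNyr 0))//.
  exact: (energy_ge0 k oOmega T0 ld tI' sZ').
have [PZ'|] := boolP (P Z' < +oo)%E; last first.
  rewrite -leNgt leye_eq => /eqP PZ'; rewrite (dissipationE a bOmega sZ sZ' Zsub).
  rewrite /energy PZ' addye ?addye ?leey//.
  by rewrite gt_eqF// (lt_le_trans (ltNyr 0))//; exact: (load_energy_ge0 k oOmega T0 ld tI' sZ').
have fpZ' : finite_perimeter Omega Z' by [].
pose L j := left_interpolant (D_ j) t.
have sD j : discrete_solution Omega T a F f k Z0 (D_ j) by case: dD.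
have fpL j : finite_perimeter Omega (L j) by exact: (left_finite_perimeter (sD j)).
have sL j := (fpL j).1.
have cL : ldist Omega (L j) (Z t) @[j --> \oo] --> 0.
  by have [_ h _] := cZ tI'; exact: (fine_cvg h).
(* The set [L j] is stable at the node [t_ j] that ends its time step, not at [t]; these nodes
   approach [t] from above. *)
have [t_ ht] : {t_ : nat -> R & forall j, [/\ t <= t_ j <= T, t_ j <= t + step_size (D_ j),
    (J (t_ j) (L j) < +oo)%E & stable Omega a F f k (t_ j) (L j)]}.
  apply: (@choice _ _ (fun j t' => [/\ t <= t' <= T, t' <= t + step_size (D_ j),
    (J t' (L j) < +oo)%E & stable Omega a F f k t' (L j)])) => j.
  have [t' [A [tt' t't sA mA]]] := left_minimizer (sD j) tI.
  have t'I : 0 <= t' <= T.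
    by case/andP: tt' => h ->; case/andP: tI' => h0 _; rewrite (le_trans h0).
  exists t'; split=> //; last exact: (minimizer_stable oOmega bOmega T0 a0 ld t'I sA mA).
  apply: le_lt_trans (load_le_energy Omega F f k t' (L j)) _.
  by apply: le_lt_trans (minimizer_energy oOmega bOmega T0 a0 ld t'I sA mA) _; exact: ltry.
have ct : t_ j @[j --> \oo] --> t.
  have [_ _ cstep] := dD.
  apply: (@squeeze_cvgr _ _ _ _ (fun=> t) (fun j => t + step_size (D_ j))).
  - by apply: nearW => j; have [/andP[-> _] -> _ _] := ht j.
  - exact: cvg_cst.
  - by rewrite -[X in _ --> X]addr0; apply: cvgD; [exact: cvg_cst|exact: cstep].
have sDZ := sub_setD sZ sZ'.
have cD : ldist Omega (L j `\` Z') (Z t `\` Z') @[j --> \oo] --> 0.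
  apply: (@squeeze_cvgr _ _ _ _ (fun=> 0) (fun j => ldist Omega (L j) (Z t))) => //.
    apply: nearW => j; rewrite ldist_ge0/= !setDE.
    have sC : sub (Omega `\` Z') by apply: sub_setD => //; split => //; exact: domain_measurable.
    have e X : sub X -> X `&` ~` Z' = X `&` (Omega `\` Z').
      by move=> sX; apply/seteqP; split=> x [Xx h]; split => //; [split => //; exact: sX.2|case: h].
    by rewrite (e _ (sL j)) (e _ sZ); exact: (ldist_setI oOmega bOmega (sL j) sZ sC).
  exact: cvg_cst.
have sU j := lebesgue_subsetU sZ' (sL j); have sU0 := lebesgue_subsetU sZ' sZ.
have cU : ldist Omega (Z' `|` L j) (Z' `|` Z t) @[j --> \oo] --> 0.
  apply: (@squeeze_cvgr _ _ _ _ (fun=> 0) (fun j => ldist Omega (L j) (Z t))) => //.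
    apply: nearW => j; rewrite ldist_ge0/= !(setUC Z').
    exact: (ldist_setU oOmega bOmega (sL j) sZ sZ').
  exact: cvg_cst.
(* The discrete inequality for the load outside [Z'] passes to the limit with [phi] fixed; the
   supremum over [phi] then yields the perimeter of the union. *)
have key phi : test_field Omega phi -> (J t (Z t `\` Z') <=
    (fine (P Z') + a * vol (Z t `\` Z') - \int[leb]_(x in Z' `|` Z t) divergence phi x)%:E)%E.
  move=> tphi.
  apply: (load_energy_lsc oOmega bOmega T0 ld (t_ := t_) (D_ := fun j => L j `\` Z')
    (M_ := fun j => fine (P Z') + a * vol (L j `\` Z') -
       \int[leb]_(x in Z' `|` L j) divergence phi x) _ _ ct _ sDZ cD).
  - by case/andP: tI'.
  - by move=> j; have [] := ht j.
  - by move=> j; exact: sub_setD.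
  - move=> j; have [tj _ h1 h2] := ht j; apply: stable_test => //.
    by case/andP: tj => h ->; case/andP: tI' => h0 _; rewrite (le_trans h0).
  - apply: cvgB; last first.
      exact: (integral_cvg oOmega bOmega (Z_ := fun j => Z' `|` L j) sU sU0 cU
        (divergence_bm bOmega tphi.1)).
    apply: cvgD; first exact: cvg_cst.
    apply: cvgM; first exact: cvg_cst.
    exact: (vol_setD_cvg oOmega bOmega sL (fun=> sZ') sZ sZ' cL (ldist_refl_cvg oOmega Z')).
have fJ : J t (Z t `\` Z') \is a fin_num.
  rewrite ge0_fin_numE; last exact: (load_energy_ge0 k oOmega T0 ld tI' sDZ).
  by apply: le_lt_trans (key _ (@test_field0 _ _ _)) _; exact: ltry.
have PU : (P (Z' `|` Z t) <=
    (fine (P Z') + a * vol (Z t `\` Z') - fine (J t (Z t `\` Z')))%:E)%E.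
  apply/(perimeter_leP oOmega bOmega _ sU0) => phi tphi.
  by have := key phi tphi; rewrite -{1}(fineK fJ) lee_fin lerBrDr => h; rewrite lerBrDr addrC.
(* Only competitors almost contained in [Z t] have finite dissipation, and for them the union is
   [Z t] and the intersection is [Z']. *)
have UZ : ae_equal (Z' `|` Z t) (Z t).
  split; last by apply: leb_null_subset (leb_null_set0 R d) => x [Zx []]; right.
  by apply: leb_null_subset Zsub => x [[]].
rewrite (perimeter_ae oOmega bOmega sU0 sZ UZ) in PU.
rewrite (dissipationE a bOmega sZ sZ' Zsub) /energy.
rewrite (load_energy_split k oOmega T0 ld tI' sZ sZ').
have IZ : ae_equal (Z t `&` Z') Z'.
  split; first by apply: leb_null_subset (leb_null_set0 R d) => x [[_ ?] []].
  by apply: leb_null_subset Zsub => x [Zx h]; split => // h'; apply: h.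
rewrite (load_energy_ae k oOmega T0 ld tI' (lebesgue_subsetI sZ sZ') sZ' IZ).
rewrite addeCA [leRHS]addeAC [leRHS]addeC leeD2l//.
apply: le_trans (leeD2r _ PU) _.
by rewrite -{2}(fineK fJ) -EFinD subrK EFinD (fineK (perimeter_fin PZ')).
Qed.

End stability.

(** * Existence *)

Section helly.
Context (R : realType) (d : nat) (Omega : set 'rV[R]_d.+1) (T : R).
Local Notation V := 'rV[R]_d.+1.
Hypotheses (oOmega : open Omega) (bOmega : bounded_set Omega) (T0 : 0 < T).
Local Notation sub := (lebesgue_subset Omega).
Local Notation vol A := (fine (leb A)).
Context (L : nat -> R -> set V) (C : R).
Hypothesis dL : forall n, decreasing_family Omega T (L n).
Hypothesis PL : forall n t, 0 <= t <= T -> (perimeter Omega (L n t) <= C%:E)%E.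

Lemma compact_times (q : nat -> R) (h : nat -> nat) : (forall k, 0 <= q k <= T) ->
  exists g : nat -> nat, increasing_seq g /\ forall k, exists2 A, sub A &
    ldist Omega (L (h (g j)) (q k)) A @[j --> \oo] --> 0.
Proof.
move=> qI.
exact: (BV_compact oOmega bOmega (Z_ := fun k j => L (h j) (q k)) (P := fun=> C)
  (fun k j => (dL (h j)).1 _ (qI k)) (fun k j => PL (h j) (qI k))).
Qed.

(** Clamping keeps all times in [0,T] and makes [T] itself one of them even if it is irrational, as
    the image of a large integer. *)
Definition rational_time (k : nat) : R :=
  clamp T (if (unpickle k : option rat) is Some r then ratr r else 0).

Lemma rational_time_bounds k : 0 <= rational_time k <= T.
Proof. exact: clamp_bounds. Qed.

Lemma rational_time_pickle (r : rat) : 0 <= (ratr r : R) <= T ->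
  rational_time (pickle r) = (ratr r : R).
Proof. by move=> rI; rewrite /rational_time pickleK clamp_id. Qed.

Lemma rational_time_dense (x y : R) : 0 <= x -> x < y -> y <= T ->
  exists k, x < rational_time k < y.
Proof.
move=> x0 xy yT; have /rat_in_itvoo[r] := xy; rewrite in_itv/= => /andP[xr ry].
exists (pickle r); rewrite rational_time_pickle ?xr//.
by rewrite (le_trans x0 (ltW xr)) (le_trans (ltW ry) yT).
Qed.

Lemma rational_time0 : exists k, rational_time k = 0.
Proof.
exists (pickle (0 : rat)); rewrite rational_time_pickle ?rmorph0//.
by rewrite lexx ltW.
Qed.

Lemma rational_timeT : exists k, rational_time k = T.
Proof.
exists (pickle ((Num.bound T)%:R : rat)); rewrite /rational_time pickleK ratr_nat /clamp.
have TB : T <= (Num.bound T)%:R.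
  by apply: ltW; have := archi_boundP (ltW T0).
by rewrite max_r ?min_r// (le_trans (ltW T0)).
Qed.

(* Volumes of a decreasing family control its L1 distances. *)
Lemma cauchy_between (g : nat -> nat) s t s' A B e : 0 <= s -> s <= t -> t <= s' -> s' <= T ->
  sub A -> sub B -> ldist Omega (L (g j) s) A @[j --> \oo] --> 0 ->
  ldist Omega (L (g j) s') B @[j --> \oo] --> 0 -> vol A - vol B < e ->
  exists N, forall i j, (N <= i)%N -> (N <= j)%N ->
    ldist Omega (L (g i) t) (L (g j) t) <= 2 * e.
Proof.
move=> s0 st ts' s'T sA sB cA cB AB.
have sI : 0 <= s <= T by rewrite s0 (le_trans st (le_trans ts' s'T)).
have tI : 0 <= t <= T by rewrite (le_trans s0 st) (le_trans ts').
have s'I : 0 <= s' <= T by rewrite s'T (le_trans s0 (le_trans st ts')).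
have sLs j := (dL (g j)).1 s sI; have sLt j := (dL (g j)).1 t tI.
have sLs' j := (dL (g j)).1 s' s'I.
have vA := vol_cvg oOmega bOmega sLs sA cA; have vB := vol_cvg oOmega bOmega sLs' sB cB.
(* A quarter of the slack: six errors of this size come on top of twice [vol A - vol B], and the
   total stays below [2 * e]. *)
pose r := (e - (vol A - vol B)) / 4.
have r0 : 0 < r by rewrite divr_gt0// subr_gt0.
move/cvgrPdist_le : vA => /(_ _ r0) nA; move/cvgrPdist_le : vB => /(_ _ r0) nB.
move/cvgrPdist_le : cA => /(_ _ r0) nC.
have [N _ HN] := filterS3 _ (fun j h1 h2 h3 => And3 h1 h2 h3) nA nB nC.
exists N => i j Ni Nj; have [a1 b1 c1] := HN i Ni; have [a2 b2 c2] := HN j Nj.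
have near_st n : ldist Omega (L (g n) s) (L (g n) t) <= vol (L (g n) s) - vol (L (g n) s').
  rewrite (ldist_decreasing oOmega bOmega (sLs n) (sLt n) ((dL (g n)).2 s t s0 st _)).
    by rewrite lerD2l lerN2; apply: (ae_subset_measure_le oOmega bOmega (sLt n) (sLs' n));
      apply: (dL (g n)).2 => //; exact: le_trans st.
  by case/andP: tI.
have h1 := ldist_triangle oOmega bOmega (sLt i) (sLs i) (sLt j).
have h2 := ldist_triangle oOmega bOmega (sLs i) sA (sLt j).
have h3 := ldist_triangle oOmega bOmega sA (sLs j) (sLt j).
have n1 := near_st i; have n2 := near_st j.
rewrite (ldistC Omega (L (g i) t) (L (g i) s)) in h1; rewrite (ldistC Omega A (L (g j) s)) in h3.
rewrite sub0r normrN ger0_norm ?ldist_ge0// in c1.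
rewrite sub0r normrN ger0_norm ?ldist_ge0// in c2.
rewrite /r in a1 b1 c1 a2 b2 c2; move: a1 b1 a2 b2.
rewrite !ler_norml => /andP[? ?] /andP[? ?] /andP[? ?] /andP[? ?].
move: (ldist _ (L (g i) t) (L (g j) t)) h1 => x1 h1.
move: (ldist _ (L (g i) s) (L (g j) t)) h1 h2 => x2 h1 h2.
move: (ldist _ A _) h2 h3 => x3 h2 h3.
move: (ldist _ (L (g i) s) (L (g i) t)) n1 h1 => x4 n1 h1.
move: (ldist _ (L (g j) s) (L (g j) t)) n2 h3 => x5 n2 h3.
lra.
Qed.

Theorem helly : exists g : nat -> nat, increasing_seq g /\
  forall t, 0 <= t <= T -> exists2 A, sub A & ldist Omega (L (g j) t) A @[j --> \oo] --> 0.
Proof.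
have [g1 [g1i /(_ _)/cid2-/all_sig2[Zq sZq cZq]]] := compact_times id rational_time_bounds.
pose q := rational_time; have qI k : 0 <= q k <= T := rational_time_bounds k.
have sLq k j := (dL (g1 j)).1 _ (qI k).
have volq k l : q k <= q l -> vol (Zq l) <= vol (Zq k).
  move=> kl; apply: (cvg_le_limit (vol_cvg oOmega bOmega (sLq l) (sZq l) (cZq l))
    (vol_cvg oOmega bOmega (sLq k) (sZq k) (cZq k))) => j.
  apply: (ae_subset_measure_le oOmega bOmega (sLq k j) (sLq l j)).
  by apply: (dL (g1 j)).2 => //; [case/andP: (qI k)|case/andP: (qI l)].
(* The limit volume is known at rational times only; the infimum over earlier rational times extends
   it monotonically to all of [0,T], keeping its values by [mq]. *)
pose S t := [set vol (Zq k) | k in [set k | q k <= t]].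
have lbS t : has_lbound (S t) by exists 0 => _ [k _ <-]; exact: vol_ge0.
have S0 t : 0 <= t -> S t !=set0.
  by move=> t0; have [k k0] := rational_time0; exists (vol (Zq k)), k => //=; rewrite /q k0.
pose m t := inf (S t).
have mq k : m (q k) = vol (Zq k).
  apply/eqP; rewrite eq_le; apply/andP; split; first by apply: ge_inf => //; exists k => /=.
  by apply: lb_le_inf; [apply: S0; case/andP: (qI k)|move=> _ [l /= lk <-]; exact: volq].
have dm s t : 0 <= s -> s <= t -> t <= T -> m t <= m s.
  move=> s0 st _; apply: lb_le_inf; first exact: S0.
  move=> _ [k /= ks <-]; apply: ge_inf => //; exists k => //=; exact: le_trans st.
have [N cN HN] := monotone_continuity T0 dm.
have /countable_injP[p injp] := cN.
(* Enumerates the exceptional times by their codes; codes not in use give the harmless time 0, and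
   clamping keeps every value in [0,T] for the second extraction. *)
pose r k := clamp T (xget 0 [set x | N x /\ p x = k]).
have rI k : 0 <= r k <= T by exact: clamp_bounds.
have [g2 [g2i g2P]] := compact_times g1 rI.
have gi : increasing_seq (g1 \o g2) by move=> i j; exact: etrans (g1i (g2 i) (g2 j)) (g2i i j).
exists (g1 \o g2); split => // t tI.
have sub_cvg A s : ldist Omega (L (g1 j) s) A @[j --> \oo] --> 0 ->
    ldist Omega (L ((g1 \o g2) j) s) A @[j --> \oo] --> 0.
  move=> h; exact: (cvg_comp g2 (fun j => ldist Omega (L (g1 j) s) A)
    (increasing_seq_cvgnr g2i) h).
have [Nt|Nt] := pselect (N t).
  have [A sA cA] := g2P (p t); exists A => //.
  have -> : t = r (p t); last exact: cA.
  have -> : r (p t) = clamp T t; last by rewrite clamp_id.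
  congr clamp; apply: xget_subset1; first by split.
  by move=> x y [Nx px] [Ny py]; apply: injp; rewrite ?inE// px py.
(* Continuity of the limit volume is available at interior times; the endpoints are rational times
   and already settled. *)
have [k0 k0E] := rational_time0; have [kT kTE] := rational_timeT.
have := tI => /andP[t0 tT].
move: t0; rewrite le_eqVlt => /predU1P[<-|t0].
  by exists (Zq k0) => //; have := sub_cvg _ _ (cZq k0); rewrite k0E.
move: tT; rewrite le_eqVlt => /predU1P[->|tT].
  by exists (Zq kT) => //; have := sub_cvg _ _ (cZq kT); rewrite kTE.
have tI0 : 0 < t < T by rewrite t0.
suff [A sA cA] : exists2 A, sub A & ldist Omega (L (g1 j) t) A @[j --> \oo] --> 0.
  by exists A => //; exact: sub_cvg.
apply: (ldist_complete oOmega bOmega (fun j => (dL (g1 j)).1 t tI)) => e e0.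
(* Volumes within [e / 8] of [m t] on either side differ by less than [e / 2], and [cauchy_between]
   doubles this. *)
have e8 : 0 < e / 8 by rewrite divr_gt0.
have [w w0 hw] := HN t tI0 Nt _ e8.
have [k /andP[k1 k2]] : exists k, Num.max 0 (t - w) < q k < t.
  apply: rational_time_dense; last exact: ltW.
    by rewrite le_max lexx.
  by rewrite gt_max t0 ltrBlDr ltrDl.
have [l /andP[l1 l2]] : exists l, t < q l < Num.min T (t + w).
  apply: rational_time_dense; first exact: ltW.
    by rewrite lt_min tT ltrDl.
  by rewrite ge_min lexx.
have {}k1 : t - w < q k by apply: le_lt_trans k1; rewrite le_max lexx orbT.
have {}l2 : q l < t + w by apply: lt_le_trans l2 _; rewrite ge_min lexx orbT.
have hk := hw _ (qI k); have hl := hw _ (qI l); rewrite !mq in hk hl.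
have {}hk : `|vol (Zq k) - m t| <= e / 8.
  by apply: hk; rewrite ltr_norml; apply/andP; split; lra.
have {}hl : `|vol (Zq l) - m t| <= e / 8.
  by apply: hl; rewrite ltr_norml; apply/andP; split; lra.
have kl : vol (Zq k) - vol (Zq l) < e / 2.
  move: hk hl; rewrite !ler_norml => /andP[? ?] /andP[? ?]; lra.
have [M HM] := cauchy_between (g := g1) (proj1 (andP (qI k))) (ltW k2) (ltW l1)
  (proj2 (andP (qI l))) (sZq k) (sZq l) (cZq k) (cZq l) kl.
by exists M => i j Mi Mj; apply: le_trans (HM i j Mi Mj) _; rewrite mulrC divfK.
Qed.

End helly.

Section existence.
Context (R : realType) (d : nat) (Omega : set 'rV[R]_d.+1) (T a : R).
Context (F : R -> set 'rV[R]_d.+1) (f : R -> 'rV[R]_d.+1 -> R) (k : option nat).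
Local Notation V := 'rV[R]_d.+1.
Hypotheses (oOmega : open Omega) (bOmega : bounded_set Omega) (T0 : 0 < T) (a0 : 0 < a).
Hypothesis ld : loading Omega T F f.
Local Notation sub := (lebesgue_subset Omega).
Local Notation E := (energy Omega F f k).
Local Notation P := (perimeter Omega).
Local Notation vol A := (fine (leb A)).
Context (Z0 : set V) (fpZ0 : finite_perimeter Omega Z0).

Lemma uniform_solution n : exists D : discrete_curve R d,
  discrete_solution Omega T a F f k Z0 D /\ step_size D = T / n.+1%:R.
Proof.
(* A total choice of minimizers, constrained only at admissible arguments, so that the states can be
   defined by plain recursion. *)
have [next nextP] : {next : R * set V -> set V & forall p, 0 <= p.1 <= T -> sub p.2 ->
    minimizer Omega a F f k p.1 p.2 (next p)}.
  apply: (@choice _ _ (fun p B => 0 <= p.1 <= T -> sub p.2 ->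
    minimizer Omega a F f k p.1 p.2 B)) => -[t A] /=.
  have [tI|tI] := boolP (0 <= t <= T); last by exists A.
  have [sA|sA] := pselect (sub A); last by exists A.
  have [B mB] := minimizer_exists k oOmega bOmega T0 a0 ld tI sA.
  by exists B.
pose nd (i : nat) : R := T * i%:R / n.+1%:R.
pose st := fix st (i : nat) : set V := if i is j.+1 then next (nd j.+1, st j) else Z0.
have n1 : n.+1%:R != 0 :> R by rewrite pnatr_eq0.
have ndI i : (i <= n.+1)%N -> 0 <= nd i <= T.
  move=> iN; rewrite divr_ge0 ?mulr_ge0 ?(ltW T0)//= ler_pdivrMr ?ltr0n//.
  by rewrite ler_wpM2l ?(ltW T0)// ler_nat.
have nd_step i : nd i.+1 - nd i = T / n.+1%:R.
  by rewrite /nd -mulrBl -mulrBr -natrB// subSnn mulr1.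
have step0 : 0 < T / n.+1%:R by rewrite divr_gt0.
have fpst i : (i <= n.+1)%N -> finite_perimeter Omega (st i).
  elim: i => // i IH iN.
  by have [] := nextP (nd i.+1, st i) (ndI i.+1 iN) (IH (ltnW iN)).1.
exists (DiscreteCurve n.+1 nd st); split; first split => //=.
- split=> /=; first by rewrite /nd mulr0 mul0r.
    by rewrite /nd mulfK.
  by move=> i _; rewrite -subr_gt0 nd_step.
- by split; rewrite /ae_subset setDv; exact: leb_null_set0.
- by move=> i iN; exact: (nextP (nd i.+1, st i) (ndI i.+1 iN) (fpst i (ltnW iN)).1).
rewrite /step_size /=; apply/eqP; rewrite eq_le; apply/andP; split.
  by apply/bigmax_leP; split; [exact: ltW|move=> i _; rewrite nd_step].
rewrite -(nd_step 0%N).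
exact: (le_bigmax 0 (fun i : 'I_n.+1 => nd i.+1 - nd i) ord0).
Qed.

Lemma gmm_exists (J : set R) : (forall t, J t -> 0 <= t <= T) ->
  (J 0 -> (E 0 Z0 < +oo)%E) -> GMM_on Omega T a F f J k Z0 !=set0.
Proof.
move=> JT J0; have fP0 := perimeter_fin fpZ0.2.
have [D0 /all_and2[sD0 stepD0]] := choice uniform_solution.
have T1 : 0 <= (0 : R) <= T by rewrite lexx ltW.
pose B := a * vol Omega.
have B0 : 0 <= B by rewrite mulr_ge0 ?vol_ge0// ltW.
have energy_left n t : 0 < t <= T -> exists2 t', t <= t' <= T &
    (E t' (left_interpolant (D0 n) t) <= B%:E)%E.
  exact: (left_energy oOmega bOmega T0 a0 ld (sD0 n)).
have dL n := left_decreasing oOmega bOmega T0 ld (sD0 n).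
have PL n t : 0 <= t <= T ->
    (P (left_interpolant (D0 n) t) <= (Num.max B (fine (P Z0)))%:E)%E.
  move=> tI; have := tI => /andP[+ tT]; rewrite le_eqVlt => /predU1P[t0|t0].
    rewrite -t0 (perimeter_ae oOmega bOmega ((dL n).1 0 T1) fpZ0.1
      (left_interpolant0_ae T0 (sD0 n))) -(fineK fP0) lee_fin.
    by rewrite le_max lexx orbT.
  have [t' tt' Et'] := energy_left n t (introT andP (conj t0 tT)).
  have t'I : 0 <= t' <= T.
    by case/andP: tt' => h ->; rewrite (le_trans (ltW t0)).
  apply: le_trans (perimeter_le_energy k oOmega T0 ld t'I ((dL n).1 t tI)) _.
  by apply: le_trans Et' _; rewrite lee_fin le_max lexx.
have [g [gi gP]] := helly oOmega bOmega T0 dL PL.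
have [Z ZP] : {Z : R -> set V & forall t, 0 <= t <= T -> sub (Z t) /\
    ldist Omega (left_interpolant (D0 (g j)) t) (Z t) @[j --> \oo] --> 0}.
  apply: (@choice _ _ (fun t A => 0 <= t <= T -> sub A /\
    ldist Omega (left_interpolant (D0 (g j)) t) A @[j --> \oo] --> 0)) => t.
  have [tI|tI] := boolP (0 <= t <= T); last by exists set0.
  by have [A sA cA] := gP t tI; exists A.
have fpZ t : 0 <= t <= T -> finite_perimeter Omega (Z t).
  move=> tI; have [sZ cZ] := ZP t tI; split => //.
  apply: (@le_lt_trans _ _ (Num.max B (fine (P Z0)))%:E); last exact: ltry.
  apply: (perimeter_lsc oOmega bOmega (Z_ := fun j => left_interpolant (D0 (g j)) t)
    (M_ := fun=> Num.max B (fine (P Z0))) (fun j => (dL (g j)).1 t tI) sZ cZ).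
    by move=> j; exact: PL.
  exact: cvg_cst.
exists Z; split => //.
  have [sZ cZ] := ZP 0 T1; apply/(ldist_ae_equal oOmega bOmega sZ fpZ0.1).
  apply/eqP; rewrite eq_le ldist_ge0 andbT.
  apply: (cvg_le_limit (u := fun=> ldist Omega (Z 0) Z0) _ cZ) => [|j]; first exact: cvg_cst.
  have sl := (dL (g j)).1 0 T1.
  rewrite (ldistC _ (left_interpolant _ _)).
  apply: le_trans (ldist_triangle oOmega bOmega sZ sl fpZ0.1) _.
  have -> : ldist Omega (left_interpolant (D0 (g j)) 0) Z0 = 0.
    by apply/(ldist_ae_equal oOmega bOmega sl fpZ0.1); exact: (left_interpolant0_ae T0 (sD0 (g j))).
  by rewrite addr0.
exists (D0 \o g); split; last split.
- split=> [j||] /=; first exact: sD0.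
    move=> i j ij /=; rewrite !stepD0 ler_pM2l// lef_pV2 ?posrE// ler_nat ltnS.
    by rewrite -leEnat gi.
  have -> : (fun j => step_size (D0 (g j))) = (fun j => T * (g j).+1%:R^-1).
    by apply/funext => j; rewrite stepD0.
  rewrite -[X in _ --> X](mulr0 T); apply: cvgM; first exact: cvg_cst.
  exact: (cvg_comp g (fun j => j.+1%:R^-1 : R) (increasing_seq_cvgnr gi) (@cvg_harmonic R)).
- have [C C0 hC] := load_energy_time k oOmega T0 ld.
  (* [B] bounds the energy at the next node by comparison with the empty set, [C] pays for going
     back to time [t], the third term is the initial energy if [J] contains 0, and 1 makes the bound
     positive. *)
  pose C' := B + C + (if pselect (J 0) is left _ then fine (E 0 Z0) else 0) + 1.
  have E0 : 0 <= (if pselect (J 0) is left _ then fine (E 0 Z0) else 0).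
    by case: pselect => // _; apply: fine_ge0; exact: (energy_ge0 k oOmega T0 ld T1 fpZ0.1).
  exists C'; first by rewrite ltr_wpDl// !addr_ge0.
  move=> j t Jt; have tI := JT t Jt; have sl := (dL (g j)).1 t tI.
  have := tI => /andP[+ tT]; rewrite le_eqVlt => /predU1P[t0|t0].
    rewrite -t0 in Jt sl *.
    rewrite (energy_ae k oOmega bOmega T0 ld T1 sl fpZ0.1 (left_interpolant0_ae T0 (sD0 (g j)))).
    have fE : E 0 Z0 \is a fin_num.
      by rewrite ge0_fin_numE ?J0//; exact: (energy_ge0 k oOmega T0 ld T1 fpZ0.1).
    rewrite -(fineK fE) lee_fin /C'; case: pselect => // _.
    by rewrite addrAC addrC lerDl !addr_ge0.
  have [t' /andP[tt' t'T] Et'] := energy_left (g j) t (introT andP (conj t0 tT)).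
  apply: (@le_trans _ _ (E t' (left_interpolant (D0 (g j)) t) + C%:E)%E).
    by rewrite /energy -addeA leeD2l//; exact: (hC t t' _ (ltW t0) tt' t'T sl).
  apply: (@le_trans _ _ (B%:E + C%:E)%E); first by rewrite leeD2r.
  by rewrite -EFinD lee_fin /C' -addrA lerDl addr_ge0.
- move=> t tI; have [sZ cZ] := ZP t tI.
  apply: (weakstar_of_ldist oOmega bOmega (P := Num.max B (fine (P Z0))) _ (fpZ t tI) _ cZ).
    by move=> j; exact: (left_finite_perimeter (sD0 (g j)) tI).
  by move=> j; exact: PL.
Qed.

End existence.

Theorem theorem4p1 (R : realType) (d : nat) (Omega : set 'rV[R]_d.+1)
    (T a : R) (F : R -> set 'rV[R]_d.+1) (f : R -> 'rV[R]_d.+1 -> R)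
    (k : option nat) :
  bounded_lipschitz_domain Omega -> 0 < T -> 0 < a -> loading Omega T F f ->
  forall Z0 : set 'rV[R]_d.+1, finite_perimeter Omega Z0 ->
  [/\ GMM_on Omega T a F f `]0, T]%classic k Z0 !=set0,
      (energy Omega F f k 0 Z0 < +oo)%E -> GMM Omega T a F f k Z0 !=set0,
      forall J : set R, J = `[0, T]%classic \/ J = `]0, T]%classic ->
        forall Z, GMM_on Omega T a F f J k Z0 Z ->
        forall D_, discrete_sequence Omega T a F f k Z0 D_ ->
        property_G Omega T F f J k D_ Z ->
        [/\ \forall t \ae (@lebesgue_measure R), 0 < t < T ->
              weakstar_SBV Omega (fun j => left_interpolant (D_ j) t) (Z t) /\
              weakstar_SBV Omega (fun j => right_interpolant T (D_ j) t) (Z t),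
            weakstar_Linf_SBV Omega T (fun j => left_interpolant (D_ j)) Z /\
            weakstar_Linf_SBV Omega T (fun j => right_interpolant T (D_ j)) Z &
            forall q : R, 1 <= q ->
              Lq_cvg Omega T q
                (fun j t => \1_(left_interpolant (D_ j) t)) (fun t => \1_(Z t)) /\
              Lq_cvg Omega T q
                (fun j t => \1_(right_interpolant T (D_ j) t)) (fun t => \1_(Z t))]
    & stable Omega a F f k 0 Z0 ->
        GMM Omega T a F f k Z0 = SMM Omega T a F f k Z0].
Proof.
move=> [oOmega _ _ bOmega _] T0 a0 ld Z0 fpZ0; split.
- apply: (gmm_exists oOmega bOmega T0 a0 ld fpZ0) => [t|]; rewrite /= in_itv/=.
    by case/andP => /ltW -> ->.
  by rewrite ltxx.
- move=> E0; apply: (gmm_exists oOmega bOmega T0 a0 ld fpZ0) => [t|_ //].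
  by rewrite /= in_itv.
- move=> J HJ Z [fpZ _ _] D_ dD gZ.
  apply: (interpolants_convergence oOmega bOmega T0 ld fpZ0 _ fpZ dD gZ) => t /andP[t0 tT].
  by case: HJ => ->; rewrite /= in_itv/= ?t0 ?(ltW t0).
- move=> st0; apply/seteqP; split=> Z; last by case.
  move=> gZ; split => // t tI; have [fpZ Z00 [D_ [dD [_ cZ]]]] := gZ.
  (* At time 0 nothing has been minimized, so stability there is the assumption on [Z0], transported
     to the almost equal set [Z 0]. *)
  have := tI => /andP[+ tT]; rewrite le_eqVlt => /predU1P[<-|t0].
    have T1 : 0 <= (0 : R) <= T by rewrite lexx ltW.
    exact: (stable_ae oOmega bOmega T0 a0 ld T1 fpZ0.1 (fpZ 0 T1).1 (ae_equal_sym Z00) st0).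
  by apply: (limit_stable oOmega bOmega T0 a0 ld fpZ dD cZ); rewrite t0.
Qed.
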